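(* Let $k$ be a field of characteristic zero and $L$ a Lie $k$-algebra whose universal enveloping algebra $U(L)$ is an Ore domain, with Ore division ring of fractions $\mathfrak D(L)$. Let $u,v\in L$ be such that the Lie subalgebra generated by $u$ and $v$ has dimension at least three. Let $w=[v,u]$, $V=\tfrac12 w(uv+vu)w$, and $$S=(V-\tfrac13w^3)(V+\tfrac13w^3)^{-1}+(V-\tfrac13w^3)^{-1}(V+\tfrac13w^3),\qquad T=(w+v^2)^{-1}(w-v^2)\,S\,(w+v^2)(w-v^2)^{-1}.$$ Then (1) the $k$-subalgebra of $\mathfrak D(L)$ generated by $S$ and $T$ is the free $k$-algebra on $\{S,T\}$, and (2) $S$ and $T$ are symmetric with respect to the principal involution on $\mathfrak D(L)$.
   Context: The principal involution of $L$ is $a\mapsto -a$; it extends uniquely to a $k$-involution (an order-two $k$-linear anti-automorphism) of $U(L)$, and then uniquely to the Ore division ring of fractions $\mathfrak D(L)$ via $(f^{-1})^*=(f^* )^{-1}$. The free $k$-algebra on $X$ is the noncommutative polynomial algebra on $X$. *)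

(* Defs.v *)
From HB Require Import structures.
From mathcomp Require Import all_boot all_order all_algebra.
Set Implicit Arguments. Unset Strict Implicit. Unset Printing Implicit Defensive.
Import Order.TTheory GRing.Theory Num.Theory.
Local Open Scope ring_scope.

Definition lie_bracket (k : fieldType) (L : lmodType k) (br : L -> L -> L) : Prop :=
  [/\ (forall (c : k) (a b x : L), br (c *: a + b) x = c *: br a x + br b x),
      (forall (c : k) (a b x : L), br x (c *: a + b) = c *: br x a + br x b),
      (forall a : L, br a a = 0) &
      (forall a b c : L, br a (br b c) + br b (br c a) + br c (br a b) = 0)].

Inductive lie_gen (k : fieldType) (L : lmodType k) (br : L -> L -> L) (u v : L)
  : L -> Prop :=
  | lie_gen_u : lie_gen br u v u
  | lie_gen_v : lie_gen br u v v
  | lie_gen_0 : lie_gen br u v 0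
  | lie_gen_lin : forall (c : k) a b, lie_gen br u v a -> lie_gen br u v b ->
      lie_gen br u v (c *: a + b)
  | lie_gen_br : forall a b, lie_gen br u v a -> lie_gen br u v b ->
      lie_gen br u v (br a b).

Definition dim_ge3 (k : fieldType) (L : lmodType k) (P : L -> Prop) : Prop :=
  exists x1 x2 x3 : L, [/\ P x1, P x2, P x3 &
    forall a b c : k, a *: x1 + b *: x2 + c *: x3 = 0 -> [/\ a = 0, b = 0 & c = 0]].

Definition lie_hom (k : fieldType) (L : lmodType k) (br : L -> L -> L)
  (A : algType k) (f : L -> A) : Prop :=
  (forall (c : k) (a b : L), f (c *: a + b) = c *: f a + f b) /\
  (forall a b : L, f (br a b) = f a * f b - f b * f a).

Definition alg_hom (k : fieldType) (A B : algType k) (g : A -> B) : Prop :=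
  [/\ (forall (c : k) (x y : A), g (c *: x + y) = c *: g x + g y),
      (forall x y : A, g (x * y) = g x * g y) & g 1 = 1].

Definition is_enveloping (k : fieldType) (L : lmodType k) (br : L -> L -> L)
  (U : algType k) (iota : L -> U) : Prop :=
  lie_hom br iota /\
  forall (A : algType k) (f : L -> A), lie_hom br f ->
    (exists g : U -> A, alg_hom g /\ forall a, g (iota a) = f a) /\
    (forall g1 g2 : U -> A, alg_hom g1 -> alg_hom g2 ->
       (forall a, g1 (iota a) = f a) -> (forall a, g2 (iota a) = f a) ->
       forall x, g1 x = g2 x).

Definition is_ore_fractions (k : fieldType) (U : algType k) (D : unitAlgType k)
  (j : U -> D) : Prop :=
  [/\ (forall x : D, x != 0 -> x \is a GRing.unit),
      alg_hom j, injective j,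
      (forall x : D, exists f g : U, j g != 0 /\ x = j f * (j g)^-1) &
      (forall x : D, exists f g : U, j g != 0 /\ x = (j g)^-1 * j f)].

Definition k_involution (k : fieldType) (D : algType k) (star : D -> D) : Prop :=
  [/\ (forall (c : k) (x y : D), star (c *: x + y) = c *: star x + star y),
      (forall x y : D, star (x * y) = star y * star x),
      star 1 = 1 & (forall x, star (star x) = x)].

Definition word_eval (k : fieldType) (D : algType k) (x y : D) (w : seq bool) : D :=
  \prod_(b <- w) (if b then y else x).

(* The k-subalgebra generated by x and y is the free k-algebra on {x, y}:
   the evaluation map k<X,Y> -> D (X ↦ x, Y ↦ y) is injective, i.e. the
   distinct words in x, y are k-linearly independent. *)
Definition free_on_pair (k : fieldType) (D : algType k) (x y : D) : Prop :=
  forall (ws : seq (seq bool)) (c : seq bool -> k), uniq ws ->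
    \sum_(w <- ws) c w *: word_eval x y w = 0 -> forall w, w \in ws -> c w = 0.

(* Main.v *)
Require Import Defs.
From HB Require Import structures.
From mathcomp Require Import all_boot all_order all_algebra.
From mathcomp Require Import finmap boolp wochoice.
From mathcomp.multinomials Require Import monalg.
From mathcomp Require Import zify ring.
Set Implicit Arguments. Unset Strict Implicit. Unset Printing Implicit Defensive.
Import Order.TTheory GRing.Theory Num.Theory.
Local Open Scope ring_scope.

(* The Lie elements u, v and w = [v, u] are linearly independent.  Filter U(L) by
   giving u and v weight 2, w weight 4 and the other elements of an ordered
   basis weight 5.  By the Poincare-Birkhoff-Witt theorem the symbol of a
   nonzero element is nonzero, and, w being set to 1, it is a polynomial in
   central variables with coefficients in the first Weyl algebra, which acts on
   polynomials in X by u = -d/dX and v = X.  There S - 2 becomes the diagonal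
   operator with eigenvalue dd n = 16 / ((12 n + 1)(12 n + 5)) on X^(2 n), and
   T - 2 is its conjugate by (1 - X^2)/(1 + X^2).  A relation between words in
   S - 2 and T - 2, multiplied by a common denominator q, gives a relation
   between the actions of these words on polynomials obtained from q, and, by
   triangularity, on all high powers of X^2.  The coefficients of these images
   are iterated alternating sums of powers of dd n; they are linearly
   independent over the rational functions of n, because the equation
   F(n+1) + F(n) = p(dd n) has a rational solution F only for constant p. *)

(** * Free modules *)

(** [D] does not act on polynomials; only symbols of elements of U do. A word is therefore never
    evaluated alone: the choice of q forces every intermediate quotient of word times q into U, and
    its symbol is found by division, which works because [V + w^3/3], [V - w^3/3], [w + v^2] and
    [w - v^2] have injective symbols. The symbols that enter S and T preserve the parity of the
    exponent of X, so even powers suffice. Subtracting 2 turns [a/b + b/a] into [(a - b)^2 / (a b)]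
    with [a - b] constant, so the eigenvalue is a constant over [den]; freeness is not affected. The
    constant 1/3 keeps the poles -1/12 and -5/12 of [dd] from differing by an integer: if they
    differed by a nonzero even integer, partial fractions would give a rational F with
    [F(n+1) + F(n) = dd n]. Since U is known only through its universal property, the
    Poincare-Birkhoff-Witt theorem is obtained by building modules over U. *)

(* An abstract interface for the free module on X: computing in the concrete
   module of finitely supported functions makes unification unfold its
   operations. *)
Record freemod (k : fieldType) (X : choiceType) := FreeMod {
  fm_sort :> lmodType k;
  fm_e : X -> fm_sort;
  fm_coef : fm_sort -> X -> k;
  fm_supp : fm_sort -> seq X;
  fm_coefP : forall x c p q, fm_coef (c *: p + q) x = c * fm_coef p x + fm_coef q x;
  fm_coefE : forall x y, fm_coef (fm_e x) y = (x == y)%:R;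
  fm_supp_uniq : forall p, uniq (fm_supp p);
  fm_suppE : forall p x, (x \in fm_supp p) = (fm_coef p x != 0);
  fm_spanE : forall p, p = \sum_(x <- fm_supp p) fm_coef p x *: fm_e x }.

Lemma freemod_exists (k : fieldType) (X : choiceType) : inhabited (freemod k X).
Proof.
pose M : lmodType k := malg X k.
constructor; unshelve refine (@FreeMod k X M
  (fun x => mkmalgU x 1 : malg X k)
  (fun p x => mcoeff x (p : malg X k))
  (fun p => enum_fset (msupp (p : malg X k))) _ _ _ _ _).
- by move=> x c p q; rewrite mcoeffD mcoeffZ.
- by move=> x y; rewrite mcoeffU.
- by move=> p; apply: fset_uniq.
- by move=> p x; rewrite mcoeff_neq0.
move=> p; rewrite {1}(monalgE p); apply: eq_bigr => x _.
by apply/malgP => y; rewrite mcoeffZ !mcoeffU mulr_natr.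
Qed.

Lemma linear_sumZ (k : fieldType) (V W : lmodType k) (f : V -> W) (I : Type)
    (r : seq I) (c : I -> k) (x : I -> V) : linear f ->
  f (\sum_(i <- r) c i *: x i) = \sum_(i <- r) c i *: f (x i).
Proof.
move=> lf; pose F : {linear V -> W} := HB.pack f (GRing.isLinear.Build k V W _ f lf).
rewrite -[f _]/(F _) linear_sum; apply: eq_bigr => i _.
by rewrite [LHS]linearZ.
Qed.

Section LinearExtension.
Variables (k : fieldType) (X : choiceType) (F : freemod k X) (V : lmodType k).
Implicit Types (f : X -> V) (p : F).
Local Notation coef := (@fm_coef k X F).
Local Notation supp := (@fm_supp k X F).

Lemma fm_coef0 p x : x \notin supp p -> coef p x = 0.
Proof. by rewrite fm_suppE negbK => /eqP. Qed.

Definition lext f p : V := \sum_(x <- supp p) coef p x *: f x.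

Lemma lextw f (d : seq X) p : uniq d -> {subset supp p <= d} ->
  lext f p = \sum_(x <- d) coef p x *: f x.
Proof.
move=> ud sub; rewrite (bigID (mem (supp p))) /= [X in _ + X]big1 ?addr0.
  rewrite -big_filter; apply: perm_big; apply: uniq_perm; rewrite ?fm_supp_uniq ?filter_uniq //.
  by move=> x; rewrite mem_filter; case: (boolP (x \in supp p)) => //= /sub ->.
by move=> x /fm_coef0 ->; rewrite scale0r.
Qed.

Lemma lext_is_linear f : linear (lext f).
Proof.
move=> c p q; pose d := undup (supp p ++ supp q ++ supp (c *: p + q)).
have ud : uniq d by apply: undup_uniq.
have sp : {subset supp p <= d} by move=> x xp; rewrite mem_undup mem_cat xp.
have sq : {subset supp q <= d} by move=> x xp; rewrite mem_undup !mem_cat xp orbT.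
have spq : {subset supp (c *: p + q) <= d} by move=> x xp; rewrite mem_undup !mem_cat xp !orbT.
rewrite !(lextw _ ud) // scaler_sumr -big_split /=.
by apply: eq_bigr => x _; rewrite fm_coefP scalerDl scalerA.
Qed.
HB.instance Definition _ f :=
  GRing.isLinear.Build k F V _ (lext f) (lext_is_linear f).

Lemma lextU f x : lext f (fm_e F x) = f x.
Proof.
rewrite (@lextw f [:: x]) ?big_seq1 ?fm_coefE ?eqxx ?scale1r // => y.
by rewrite fm_suppE fm_coefE inE (eq_sym x); case: (y == x); rewrite ?eqxx.
Qed.

Lemma lextE f p : lext f p = \sum_(x <- supp p) coef p x *: f x.
Proof. by []. Qed.

Lemma eq_lext f g p : (forall x, x \in supp p -> f x = g x) -> lext f p = lext g p.
Proof. by move=> fg; apply: eq_big_seq => x /fg ->. Qed.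

End LinearExtension.

Section Support.
Variables (k : fieldType) (X : choiceType) (F : freemod k X).
Implicit Types (p q : F) (Q R : pred X).

Definition supported Q p := forall x, x \in fm_supp p -> Q x.

Lemma fm_coefZ x c p : fm_coef (c *: p) x = c * fm_coef p x.
Proof.
have E : fm_coef (0 : F) x = 0.
  have := fm_coefP x 1 p 0; rewrite scale1r addr0 mul1r => /eqP.
  by rewrite -subr_eq0 opprD addNKr oppr_eq0 => /eqP.
by rewrite -[c *: p]addr0 fm_coefP E addr0.
Qed.

Lemma fm_coefD x p q : fm_coef (p + q) x = fm_coef p x + fm_coef q x.
Proof. by rewrite -[p in LHS]scale1r fm_coefP mul1r. Qed.

Lemma supported0 Q : supported Q (0 : F).
Proof. by move=> x; rewrite fm_suppE -(scale0r (0 : F)) fm_coefZ mul0r eqxx. Qed.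

Lemma supportedD Q p q : supported Q p -> supported Q q -> supported Q (p + q).
Proof.
move=> Qp Qq x; rewrite fm_suppE fm_coefD => nz.
case: (boolP (x \in fm_supp p)) => [/Qp //|/fm_coef0 p0]; apply: Qq.
by rewrite fm_suppE; move: nz; rewrite p0 add0r.
Qed.

Lemma supportedZ Q c p : supported Q p -> supported Q (c *: p).
Proof.
move=> Qp x; rewrite fm_suppE fm_coefZ mulf_eq0 negb_or => /andP [_ nz].
by apply: Qp; rewrite fm_suppE.
Qed.

Lemma supportedB Q p q : supported Q p -> supported Q q -> supported Q (p - q).
Proof. by move=> Qp Qq; apply: supportedD; rewrite // -scaleN1r; apply: supportedZ. Qed.

Lemma supportedU Q x : Q x -> supported Q (fm_e F x).
Proof. by move=> Qx y; rewrite fm_suppE fm_coefE; case: (x =P y) => [<- //|_]; rewrite eqxx. Qed.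

Lemma supported_sum Q (I : eqType) (r : seq I) (f : I -> F) :
  (forall i, i \in r -> supported Q (f i)) -> supported Q (\sum_(i <- r) f i).
Proof.
move=> Qf; rewrite big_seq.
by apply: (big_ind (supported Q)); [apply: supported0|apply: supportedD|].
Qed.

Lemma supportedW Q R p :
  (forall x, Q x -> R x) -> supported Q p -> supported R p.
Proof. by move=> QR Qp x /Qp /QR. Qed.

End Support.

Lemma supported_lext (k : fieldType) (X Y : choiceType) (F : freemod k X) (G : freemod k Y)
    (Q : pred X) (R : pred Y) (f : X -> G) (p : F) :
  supported Q p -> (forall x, Q x -> supported R (f x)) -> supported R (lext f p).
Proof.
by move=> Qp Rf; apply: supported_sum => x /Qp /Rf Rx; apply: supportedZ.
Qed.

Notation "<< x >>" := (fm_e _ x) (at level 0, format "<< x >>") : ring_scope.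

Lemma lin_eq_supported (k : fieldType) (X : choiceType) (F : freemod k X) (V : lmodType k)
    (f g : F -> V) (Q : pred X) (p : F) : linear f -> linear g ->
  (forall x, Q x -> f << x >> = g << x >>) -> supported Q p -> f p = g p.
Proof.
move=> lf lg fg Qp; rewrite (fm_spanE p) !linear_sumZ //.
by apply: eq_big_seq => x /Qp /fg ->.
Qed.

(** * The Poincare-Birkhoff-Witt theorem *)

Section PBW.
Variables (k : fieldType) (L : lmodType k) (br : L -> L -> L).
Hypothesis brP : lie_bracket br.
Variables (FL : freemod k L) (P : freemod k (seq L)).
Variables (le : rel L) (inB : pred L) (cl : {linear L -> FL}).
Hypothesis le_total : total le.
Hypothesis le_trans : transitive le.
Hypothesis le_anti : antisymmetric le.
Hypothesis cl_supp : forall x, supported inB (cl x).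
Hypothesis cl_sum : forall x, lext id (cl x) = x.
Hypothesis clB : forall b, inB b -> cl b = << b >>.

Definition valid (M : seq L) := sorted le M && all inB M.
Definition ins (x : L) (M : seq L) := sort le (x :: M).

Lemma ins_valid x M : inB x -> valid M -> valid (ins x M).
Proof.
move=> Bx /andP [_ BM]; rewrite /valid (sort_sorted le_total) /=.
by rewrite (perm_all _ (permEl (perm_sort _ _))) /= Bx.
Qed.

Lemma size_ins x M : size (ins x M) = (size M).+1.
Proof. by rewrite size_sort. Qed.

Lemma ins_head x M : valid (x :: M) -> ins x M = x :: M.
Proof. by case/andP=> so _; rewrite /ins sorted_sort. Qed.

Lemma valid_cons y N : valid (y :: N) -> inB y /\ valid N.
Proof.
case/andP=> /= so /andP [By BN]; split=> //; rewrite /valid BN andbT.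
exact: path_sorted so.
Qed.

Lemma valid_consE y N : valid (y :: N) = [&& inB y, valid N & all (le y) N].
Proof.
rewrite /valid /= path_sortedE //.
by case: (inB y); case: (sorted _ _); case: (all _ _); case: (all _ _).
Qed.

Lemma ins_all y x M : all (le y) (ins x M) = le y x && all (le y) M.
Proof. by rewrite (perm_all _ (permEl (perm_sort _ _))). Qed.

Lemma ins_cons x y N : valid (y :: N) -> inB x -> le y x ->
  ins x (y :: N) = y :: ins x N.
Proof.
move=> /[dup] vyN; rewrite valid_consE => /and3P [By vN yN] Bx yx.
have v1 : valid (y :: ins x N).
  by rewrite valid_consE By ins_valid //= ins_all yx.
case/andP: v1 => so _.
apply: (sorted_eq le_trans le_anti) => //; first exact: (sort_sorted le_total).
apply: perm_trans (permEl (perm_sort _ _)) _.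
apply: (@perm_trans _ [:: y, x & N]); first by rewrite -cat1s -(cat1s y) perm_catCA.
by rewrite perm_cons perm_sym; apply: (permEl (perm_sort _ _)).
Qed.

(* The terms of lower length of the action of x on the word M.  The first
   argument is fuel. *)
Fixpoint rest (f : nat) (x : L) (M : seq L) : P :=
  match f, M with
  | f'.+1, y :: N =>
    if le x y then 0 else
      lext (fun M' => << ins y M' >> + rest f' y M') (rest f' x N)
      + lext (fun z => << ins z N >> + rest f' z N) (cl (br x y))
  | _, _ => 0
  end.

Lemma restS f x y N : rest f.+1 x (y :: N) =
  if le x y then 0 else
    lext (fun M' => << ins y M' >> + rest f y M') (rest f x N)
    + lext (fun z => << ins z N >> + rest f z N) (cl (br x y)).
Proof. by []. Qed.
Lemma rest0 f x : rest f x [::] = 0. Proof. by case: f. Qed.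
Lemma rest00 x M : rest 0 x M = 0. Proof. by []. Qed.
#[local] Opaque rest.

Definition short n := [pred M | valid M && (size M <= n)%N].

Lemma rest_short f x M : inB x -> valid M -> supported (short (size M)) (rest f x M).
Proof.
elim: f x M => [|f IH] x [|y N] Bx vM; rewrite ?rest0 ?rest00 ?restS; try exact: supported0.
case: ifP => _; first exact: supported0.
have [By vN] := valid_cons vM.
apply: supportedD.
  apply: supported_lext (IH _ _ Bx vN) _ => M' /andP [vM' sM'].
  apply: supportedD.
    by apply: supportedU; rewrite /= ins_valid // size_ins ltnS.
  apply: (supportedW _ (IH _ _ By vM')) => M2 /= /andP [-> s2] /=.
  exact: leq_trans s2 (leq_trans sM' (leqnSn _)).
apply: supported_lext (@cl_supp _) _ => z Bz.
apply: supportedD.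
  by apply: supportedU; rewrite /= ins_valid // size_ins ltnSn.
apply: (supportedW _ (IH _ _ Bz vN)) => M2 /= /andP [-> s2] /=.
exact: leq_trans s2 (leqnSn _).
Qed.

(** By [rest_short] every recursive call concerns a word shorter than [M], so fuel beyond the length
    changes nothing. *)
Lemma rest_stable f x M : inB x -> valid M -> (size M <= f)%N ->
  rest f x M = rest (size M) x M.
Proof.
elim/ltn_ind: f x M => f IH x [|y N] Bx vM; first by rewrite !rest0.
case: f IH => [//|f] IH; rewrite [size _]/= ltnS => sN.
have [By vN] := valid_cons vM.
rewrite !restS (IH f (ltnSn f) x N Bx vN sN).
case: ifP => _; first by [].
apply: f_equal2.
  apply: eq_lext => M' /(rest_short Bx vN) /andP [vM' sM'].
  rewrite (IH f (ltnSn f) y M' By vM' (leq_trans sM' sN)).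
  by rewrite (IH (size N) _ y M' By vM' sM').
apply: eq_lext => z /cl_supp Bz.
by rewrite (IH f (ltnSn f) z N Bz vN sN).
Qed.

(** Invalid words are killed, so that the bracket relation holds on the whole free module [P] and no
    submodule of valid words has to be formed. *)
Definition act (x : L) (M : seq L) : P :=
  if valid M then << ins x M >> + rest (size M) x M else 0.

Lemma act_head x M : inB x -> valid M -> all (le x) M -> act x M = << x :: M >>.
Proof.
move=> Bx vM xM; have v1 : valid (x :: M) by rewrite valid_consE Bx vM.
rewrite /act vM ins_head //; case: M {vM v1} xM => [|y N]; first by rewrite rest0 addr0.
by case/andP=> xy _; rewrite [size _]/= restS xy addr0.
Qed.

Lemma act_short x M : inB x -> valid M ->
  supported (short (size M)) (act x M - << ins x M >>).
Proof. by move=> Bx vM; rewrite /act vM addrC addKr; apply: rest_short. Qed.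

(** This is the straightening rule [x y N = y x N + [x, y] N] for which [rest] is designed. The top
    term of [y (x N)] is exactly [y :: ins x N], because y lies below all letters involved. *)
Lemma act_cons x y N : inB x -> valid (y :: N) -> ~~ le x y ->
  act x (y :: N) = lext (act y) (act x N) + lext (fun z => act z N) (cl (br x y)).
Proof.
move=> Bx vyN /[dup] xy /negbTE nxy; have [By vN] := valid_cons vyN.
have yx : le y x by have := le_total x y; rewrite nxy.
have yN : all (le y) N by move: vyN; rewrite valid_consE => /and3P [].
rewrite {1}/act vyN [size _]/= restS nxy {2}/act vN raddfD /= lextU act_head //; last 2 first.
- exact: ins_valid.
- by rewrite ins_all yx.
rewrite ins_cons // -addrA; apply: f_equal2; first by [].
apply: f_equal2.
  apply: eq_lext => M' /(rest_short Bx vN) /andP [vM' sM'].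
  by rewrite /act vM' rest_stable.
by apply: eq_lext => z _; rewrite /act vN.
Qed.

Definition lact (x : L) (p : P) : P := lext (fun b => lext (act b) p) (cl x).

Lemma lact_linear x : linear (lact x).
Proof.
move=> c p q; rewrite /lact !(lextE _ (cl x)) scaler_sumr -big_split /=.
apply: eq_bigr => b _; rewrite linearP scalerDr !scalerA.
by rewrite mulrC.
Qed.
HB.instance Definition _ x := GRing.isLinear.Build k P P _ (lact x) (lact_linear x).

Lemma lactPr x c p q : lact x (c *: p + q) = c *: lact x p + lact x q.
Proof. exact: lact_linear. Qed.
Lemma lactPl c x y p : lact (c *: x + y) p = c *: lact x p + lact y p.
Proof. by rewrite /lact !linearP. Qed.
Lemma lactBl x y p : lact (x - y) p = lact x p - lact y p.
Proof. by rewrite /lact !linearB. Qed.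
Lemma lactNl x p : lact (- x) p = - lact x p.
Proof. by rewrite /lact !linearN. Qed.

Lemma lact0l p : lact 0 p = 0.
Proof. by rewrite /lact !linear0. Qed.

Lemma lactB x p : inB x -> lact x p = lext (act x) p.
Proof. by move=> Bx; rewrite /lact clB // lextU. Qed.

Lemma lactU x M : lact x << M >> = lext (fun z => act z M) (cl x).
Proof. by apply: eq_lext => b _; rewrite lextU. Qed.

Lemma lactBU x M : inB x -> lact x << M >> = act x M.
Proof. by move=> Bx; rewrite lactB // lextU. Qed.

Lemma lact_cons x y N : inB x -> valid (y :: N) -> ~~ le x y ->
  lact x << y :: N >> = lact y (lact x << N >>) + lact (br x y) << N >>.
Proof.
move=> Bx vyN nxy; have [By vN] := valid_cons vyN.
by rewrite (lactBU _ Bx) (act_cons Bx vyN nxy) (lactBU _ Bx) (lactB _ By) lactU.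
Qed.

Lemma lact_invalid x M : ~~ valid M -> lact x << M >> = 0.
Proof.
move=> /negbTE vM; rewrite lactU lextE big1 // => z _.
by rewrite /act vM scaler0.
Qed.

Lemma br_linr c a b x : br x (c *: a + b) = c *: br x a + br x b.
Proof. by case: brP. Qed.
Lemma br_linl c a b x : br (c *: a + b) x = c *: br a x + br b x.
Proof. by case: brP. Qed.
Lemma br_self a : br a a = 0.
Proof. by case: brP. Qed.
Lemma br_addr a b x : br x (a + b) = br x a + br x b.
Proof. by have := br_linr 1 a b x; rewrite !scale1r. Qed.
Lemma br_addl a b x : br (a + b) x = br a x + br b x.
Proof. by have := br_linl 1 a b x; rewrite !scale1r. Qed.
Lemma br_anti a b : br a b = - br b a.
Proof.
apply/eqP; rewrite -addr_eq0; apply/eqP.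
by have := br_self (a + b); rewrite br_addl !br_addr !br_self addr0 add0r.
Qed.
Lemma br_oppl a b : br (- a) b = - br a b.
Proof.
apply: (addIr (br a b)); rewrite -br_addl !addNr.
by apply: (addIr (br 0 b)); rewrite -br_addl !add0r.
Qed.
Lemma br_oppr a b : br a (- b) = - br a b.
Proof. by rewrite br_anti br_oppl -br_anti. Qed.
Lemma jacobi x y z : br (br x y) z = br x (br y z) - br y (br x z).
Proof.
case: brP => _ _ _ /(_ x y z) /eqP; rewrite addr_eq0 => /eqP J.
by rewrite br_anti -J (br_anti z x) br_oppr.
Qed.

Definition comm x y p := lact x (lact y p) - lact y (lact x p) - lact (br x y) p.

Lemma comm_linear x y : linear (comm x y).
Proof.
move=> c p q; rewrite /comm !lactPr !scalerBr !opprD.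
by rewrite [LHS](AC (2*2*2) ((1*3*5)*(2*4*6))).
Qed.
HB.instance Definition _ x y :=
  GRing.isLinear.Build k P P _ (comm x y) (comm_linear x y).

Lemma comm_anti x y p : comm x y p = - comm y x p.
Proof.
by rewrite /comm (br_anti x y) lactNl !opprB opprK [RHS]addrC.
Qed.

Lemma comm_linl y p : linear (fun x => comm x y p).
Proof.
move=> c a b /=; rewrite /comm br_linl !lactPl lactPr !scalerBr !opprD.
by rewrite [LHS](AC (2*2*2) ((1*3*5)*(2*4*6))).
Qed.

Lemma comm_basis Q y p : (forall x, inB x -> supported Q p -> comm x y p = 0) ->
  supported Q p -> forall x, comm x y p = 0.
Proof.
move=> H Qp x; rewrite -(cl_sum x) lextE (linear_sumZ _ _ _ (comm_linl y p)).
by rewrite big1_seq // => b /= /cl_supp Bb; rewrite H // scaler0.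
Qed.

Lemma comm_ext n : (forall x y M, inB x -> inB y -> valid M -> (size M <= n)%N ->
    comm x y << M >> = 0) ->
  forall x y p, supported (short n) p -> comm x y p = 0.
Proof.
move=> H x y p Qp; apply: (comm_basis (Q := short n)) x => // x Bx _.
rewrite comm_anti; apply/eqP; rewrite oppr_eq0; apply/eqP.
apply: (comm_basis (Q := short n)) y => // y By _.
rewrite (fm_spanE p) linear_sum big1_seq // => M /= /Qp /andP [vM sM].
by rewrite linearZ /= H // scaler0.
Qed.

Lemma commE x y p : comm x y p = 0 ->
  lact x (lact y p) = lact y (lact x p) + lact (br x y) p.
Proof. by move/eqP; rewrite /comm -addrA -opprD subr_eq0 => /eqP. Qed.

Lemma comm0 x y p : lact x (lact y p) = lact y (lact x p) + lact (br x y) p ->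
  comm x y p = 0.
Proof. by rewrite /comm => ->; rewrite -addrA -opprD subrr. Qed.

(** Here the relation is built into the definition: for y below x it is the recursion for x on
    [y :: M], for x below y it is the recursion for y on [x :: M]. *)
Lemma lact_comm_head x y M : inB x -> valid M -> inB y -> all (le y) M ->
  comm x y << M >> = 0.
Proof.
move=> Bx vM By yM; apply: comm0; case xy: (le x y).
  have xM : all (le x) M by apply: sub_all yM => z; apply: le_trans xy.
  have vyM : valid (y :: M) by rewrite valid_consE By vM.
  have xyM : all (le x) (y :: M) by rewrite /= xy.
  have e1 : lact y << M >> = << y :: M >> by rewrite lactBU // act_head.
  have e2 : lact x << M >> = << x :: M >> by rewrite lactBU // act_head.
  have e3 : lact x << y :: M >> = << x :: y :: M >> by rewrite lactBU // act_head.
  rewrite e1 e2 e3; have [E|nxy] := eqVneq x y.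
    move: e3; rewrite E => ->.
    by rewrite br_self lact0l addr0.
  have nyx : ~~ le y x by apply: contra nxy => yx; apply/eqP/le_anti; rewrite xy.
  have vxM : valid (x :: M) by rewrite valid_consE Bx vM.
  by rewrite (lact_cons By vxM nyx) e1 e3 -addrA (br_anti y x) lactNl addNr addr0.
have vyM : valid (y :: M) by rewrite valid_consE By vM.
by rewrite [lact y << M >>]lactBU // act_head // lact_cons // ?xy.
Qed.

(** Induction on the length. The case left is a word [z :: N] with z below x and y: z is moved to
    the front of both products, using relations known on words no longer than N, and the bracket
    terms that remain cancel by the Jacobi identity. *)
Theorem lact_bracket_valid n x y p : supported (short n) p -> comm x y p = 0.
Proof.
elim: n x y p => [|n IH]; apply: comm_ext => x y [|z N] Bx By vM //= sM.
- exact: lact_comm_head.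
- exact: lact_comm_head.
wlog xy : x y Bx By / le y x => [H|].
  have /orP [xy|yx] := le_total x y; last exact: H.
  by rewrite comm_anti H // oppr0.
have [Bz vN] := valid_cons vM.
case yz : (le y z).
  apply: lact_comm_head => //=; rewrite yz.
  by move: vM; rewrite valid_consE => /and3P [_ _]; apply: sub_all => t; apply: le_trans.
have nyz : ~~ le y z by rewrite yz.
have zx : ~~ le x z by apply: contra nyz; apply: le_trans.
have zN : all (le z) N by move: vM; rewrite valid_consE => /and3P [].
(* The letters of the top term of lact b << N >> are at least z, so
   lact_comm_head applies to it; the rest is no longer than N. *)
have swap a b : inB a -> inB b -> le z b -> comm a z (lact b << N >>) = 0.
  move=> Ba Bb zb; rewrite -(subrK << ins b N >> (lact b << N >>)) raddfD /=.
  rewrite lactBU // (IH a z (_ - _)) ?add0r; last first.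
    by apply: (supportedW _ (act_short Bb vN)) => M /= /andP [-> /leq_trans ->].
  by apply: lact_comm_head => //; rewrite ?ins_valid // ins_all zb.
have IHN a b : comm a b << N >> = 0 by apply: IH; apply: supportedU; rewrite /= vN.
have le_zy : le z y by have := le_total z y; rewrite yz orbF.
have le_zx : le z x := le_trans le_zy xy.
have zE : << z :: N >> = lact z << N >> by rewrite lactBU // act_head.
have step a b : inB a -> inB b -> le z b -> lact a (lact b << z :: N >>) =
   lact z (lact a (lact b << N >>)) + lact (br a z) (lact b << N >>)
   + (lact (br b z) (lact a << N >>) + lact (br a (br b z)) << N >>).
  move=> Ba Bb zb; rewrite zE (commE (IHN b z)) raddfD /=.
  by rewrite (commE (swap a b Ba Bb zb)) (commE (IHN a (br b z))).
apply: comm0; rewrite !step // zE (commE (IHN (br x y) z)) jacobi.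
rewrite (commE (IHN x y)) raddfD /= lactBl.
set A := lact z _; set B := lact z _; set C := lact _ _; set D := lact _ _.
set E := lact _ _; set F := lact _ _.
by rewrite [RHS](AC (2*2*(1*2)) (((1*5)*3*(2*6))*(4*7))) /= subrr addr0.
Qed.

Lemma act_valid x M : inB x -> supported valid (act x M).
Proof.
move=> Bx; rewrite /act; case: ifP => [vM|_]; last exact: supported0.
apply: supportedD; first by apply: supportedU; apply: ins_valid.
by apply: (supportedW _ (rest_short Bx vM)) => M' /andP [].
Qed.

Lemma lact_valid x p : supported valid (lact x p).
Proof.
apply: supported_lext (@cl_supp x) _ => b Bb.
by apply: (@supported_lext _ _ _ _ _ predT) => // M _; apply: act_valid.
Qed.

Lemma lact_bracket x y p :
  lact (br x y) p = lact x (lact y p) - lact y (lact x p).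
Proof.
apply/esym/eqP; rewrite -subr_eq0 -/(comm x y p); apply/eqP.
rewrite (fm_spanE p) linear_sum big1_seq // => M _; rewrite linearZ /=.
have [vM|vM] := boolP (valid M).
  by rewrite (@lact_bracket_valid (size M)) ?scaler0 //; apply: supportedU; rewrite /= vM /=.
by rewrite /comm !lact_invalid // !raddf0 !addr0 scaler0.
Qed.

Section Enveloping.
Variables (U : algType k) (iota : L -> U).
Hypothesis iotaP : lie_hom br iota.

Definition evalU : P -> U :=
  lext (fun M => if valid M then \prod_(b <- M) iota b else 0).
HB.instance Definition _ := GRing.Linear.on evalU.

Lemma evalU_lin : linear evalU.
Proof. exact: lext_is_linear. Qed.

Lemma evalUU M : evalU << M >> = if valid M then \prod_(b <- M) iota b else 0.
Proof. by rewrite /evalU lextU. Qed.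

Lemma iota_lin : linear iota.
Proof. by move=> c a b; case: iotaP. Qed.
HB.instance Definition _ := GRing.isLinear.Build k L U _ iota iota_lin.

Lemma evalU_ext n :
  (forall x M, inB x -> valid M -> (size M <= n)%N ->
     evalU (lact x << M >>) = iota x * evalU << M >>) ->
  forall x p, supported (short n) p -> evalU (lact x p) = iota x * evalU p.
Proof.
move=> H x p Qp; rewrite /lact lextE (linear_sumZ _ _ _ evalU_lin).
have -> : iota x = \sum_(b <- fm_supp (cl x)) fm_coef (cl x) b *: iota b.
  by rewrite -{1}(cl_sum x) lextE (linear_sumZ _ _ _ iota_lin).
rewrite mulr_suml.
apply: eq_big_seq => b /cl_supp Bb; rewrite -scalerAl; apply: f_equal2 => //.
rewrite -lactB // (fm_spanE p) (linear_sumZ _ _ _ (lact_linear b)).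
rewrite !(linear_sumZ _ _ _ evalU_lin) mulr_sumr; apply: eq_big_seq => M /Qp /andP [vM sM].
by rewrite H // scalerAr.
Qed.

(** The straightening rule also holds in U because [iota] respects brackets, so the recursion
    defining the action can be followed there. *)
Lemma evalU_lact_valid n x p : supported (short n) p -> evalU (lact x p) = iota x * evalU p.
Proof.
elim: n x p => [|n IH]; apply: evalU_ext => x M Bx vM sM.
  case: M vM sM => // vM _; rewrite lactBU // act_head // !evalUU /=.
  by rewrite valid_consE Bx /= big_seq1 big_nil mulr1.
have head y N : inB y -> valid N -> all (le y) N -> evalU (lact y << N >>) = iota y * evalU << N >>.
  by move=> By vN yN; rewrite lactBU // act_head // !evalUU valid_consE By vN yN big_cons.
have [xM|] := boolP (all (le x) M); first exact: head.
case: M vM sM => [//|y N] vM sM nx; have [By vN] := valid_cons vM.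
have yN : all (le y) N by move: vM; rewrite valid_consE => /and3P [].
have nxy : ~~ le x y.
  by apply: contra nx => /= xy; rewrite xy; apply: sub_all yN => t; apply: le_trans.
have yx : le y x by have := le_total x y; rewrite (negbTE nxy).
have sN : supported (short n) (fm_e P N) by apply: supportedU; rewrite /= vN; apply: sM.
rewrite lact_cons // raddfD /= (IH (br x y)) //.
rewrite -(subrK << ins x N >> (lact x << N >>)) raddfD /= raddfD /= (IH y); last first.
  by rewrite lactBU //; apply: (supportedW _ (act_short Bx vN)) => M' /= /andP [-> /leq_trans ->].
rewrite (head y (ins x N)) ?ins_valid // ?ins_all ?yx // -mulrDr -raddfD /= subrK.
rewrite IH // (_ : << y :: N >> = lact y << N >>); last by rewrite lactBU // act_head.
rewrite head //; case: iotaP => _ ->.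
by rewrite mulrBl !mulrA addrC subrK.
Qed.

Lemma evalU_lact x p : evalU (lact x p) = iota x * evalU p.
Proof.
rewrite (fm_spanE p) (linear_sumZ _ _ _ (lact_linear x)) !(linear_sumZ _ _ _ evalU_lin).
rewrite mulr_sumr; apply: eq_bigr => M _; rewrite -scalerAr; apply: f_equal2 => //.
have [vM|vM] := boolP (valid M).
  by apply: (@evalU_lact_valid (size M)); apply: supportedU; rewrite /= vM /=.
by rewrite lact_invalid // evalUU (negbTE vM) mulr0 raddf0.
Qed.

Lemma evalU1 : evalU << [::] >> = 1.
Proof. by rewrite evalUU big_nil. Qed.

End Enveloping.

End PBW.

(* The nonzero vector is only there to make this type a nontrivial ring. *)
Record lend (k : fieldType) (V : lmodType k) (v0 : V) (nz : v0 != 0) :=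
  LEnd { lfun :> V -> V; lendP : linear lfun }.

Section EndAlgebra.
Variables (k : fieldType) (V : lmodType k) (v0 : V) (nz : v0 != 0).
Local Notation E := (lend nz).
HB.instance Definition _ := gen_eqMixin E.
HB.instance Definition _ := gen_choiceMixin E.
HB.instance Definition _ (f : E) := GRing.isLinear.Build k V V _ (lfun f) (lendP f).

Lemma lend_ext (f g : E) : f =1 g -> f = g.
Proof.
case: f g => [f fP] [g gP] /= /funext fg; move: fP gP; rewrite fg => fP gP.
by congr LEnd; apply: Prop_irrelevance.
Qed.

Lemma lend0P : linear (fun _ : V => 0 : V).
Proof. by move=> c a b; rewrite scaler0 addr0. Qed.
Lemma lendDP (f g : E) : linear (fun x => f x + g x).
Proof. by move=> c a b; rewrite !linearP scalerDr addrACA. Qed.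
Lemma lendNP (f : E) : linear (fun x => - f x).
Proof. by move=> c a b; rewrite linearP opprD scalerN. Qed.
Lemma lendZP d (f : E) : linear (fun x => d *: f x).
Proof. by move=> c a b; rewrite linearP scalerDr !scalerA mulrC. Qed.
Lemma lend1P : linear (fun x : V => x).
Proof. by []. Qed.
Lemma lendMP (f g : E) : linear (fun x => f (g x)).
Proof. by move=> c a b; rewrite !linearP. Qed.

Definition lend0 : E := LEnd nz lend0P.
Definition lendD f g : E := LEnd nz (lendDP f g).
Definition lendN f : E := LEnd nz (lendNP f).
Definition lendZ d f : E := LEnd nz (lendZP d f).
Definition lend1 : E := LEnd nz lend1P.
Definition lendM f g : E := LEnd nz (lendMP f g).

Lemma lendDA : associative lendD.
Proof. by move=> f g h; apply: lend_ext => x /=; rewrite addrA. Qed.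
Lemma lendDC : commutative lendD.
Proof. by move=> f g; apply: lend_ext => x /=; rewrite addrC. Qed.
Lemma lendD0 : left_id lend0 lendD.
Proof. by move=> f; apply: lend_ext => x /=; rewrite add0r. Qed.
Lemma lendDN : left_inverse lend0 lendN lendD.
Proof. by move=> f; apply: lend_ext => x /=; rewrite addNr. Qed.
HB.instance Definition _ := GRing.isZmodule.Build E lendDA lendDC lendD0 lendDN.

Lemma lendMA : associative lendM.
Proof. by move=> f g h; apply: lend_ext. Qed.
Lemma lend1M : left_id lend1 lendM.
Proof. by move=> f; apply: lend_ext. Qed.
Lemma lendM1 : right_id lend1 lendM.
Proof. by move=> f; apply: lend_ext. Qed.
Lemma lendMDl : left_distributive lendM +%R.
Proof. by move=> f g h; apply: lend_ext. Qed.
Lemma lendMDr : right_distributive lendM +%R.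
Proof. by move=> f g h; apply: lend_ext => x /=; rewrite raddfD. Qed.
Lemma lend_one_neq0 : lend1 != 0.
Proof. by apply/eqP => /(congr1 (fun f : E => f v0)) /= /eqP; rewrite (negbTE nz). Qed.
HB.instance Definition _ := GRing.Zmodule_isNzRing.Build E
  lendMA lend1M lendM1 lendMDl lendMDr lend_one_neq0.

Lemma lendZA c d (f : E) : lendZ c (lendZ d f) = lendZ (c * d) f.
Proof. by apply: lend_ext => x /=; rewrite scalerA. Qed.
Lemma lend1Z : left_id 1 lendZ.
Proof. by move=> f; apply: lend_ext => x /=; rewrite scale1r. Qed.
Lemma lendZDr : right_distributive lendZ +%R.
Proof. by move=> c f g; apply: lend_ext => x /=; rewrite scalerDr. Qed.
Lemma lendZDl (f : E) : {morph lendZ^~ f : c d / c + d}.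
Proof. by move=> c d; apply: lend_ext => x /=; rewrite scalerDl. Qed.
HB.instance Definition _ := GRing.Zmodule_isLmodule.Build k E lendZA lend1Z lendZDr lendZDl.

Lemma lendZAl c (f g : E) : c *: (f * g) = (c *: f) * g.
Proof. by apply: lend_ext. Qed.
HB.instance Definition _ := GRing.Lmodule_isLalgebra.Build k E lendZAl.
Lemma lendZAr c (f g : E) : c *: (f * g) = f * (c *: g).
Proof. by apply: lend_ext => x /=; rewrite [in RHS]linearZ. Qed.
HB.instance Definition _ := GRing.Lalgebra_isAlgebra.Build k E lendZAr.

End EndAlgebra.

(** * Modules over U from its universal property *)

Section EnvelopingModules.
Variables (k : fieldType) (L : lmodType k) (br : L -> L -> L).
Variables (U : algType k) (iota : L -> U).
Hypothesis envU : is_enveloping br iota.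

Definition env_action (V : lmodType k) (r : U -> V -> V) :=
  [/\ forall c x y v, r (c *: x + y) v = c *: r x v + r y v,
      forall x, linear (r x), forall x y v, r (x * y) v = r x (r y v)
    & forall v, r 1 v = v].

Definition lie_action (V : lmodType k) (f : L -> V -> V) :=
  [/\ forall c a b v, f (c *: a + b) v = c *: f a v + f b v,
      forall a, linear (f a)
    & forall a b v, f (br a b) v = f a (f b v) - f b (f a v)].

Lemma env_action_exists (V : lmodType k) (v0 : V) (f : L -> V -> V) : v0 != 0 ->
  lie_action f -> exists2 r, env_action r & forall a v, r (iota a) v = f a v.
Proof.
move=> nz [flin fl fbr].
pose F a : lend nz := LEnd nz (fl a).
have FP : lie_hom br F.
  split=> [c a b|a b]; apply: lend_ext => v; first exact: flin.
  exact: fbr.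
have [[G [[Glin GM G1] GF]] _] := envU.2 _ _ FP.
exists (fun x v => G x v); last by move=> a v; rewrite GF.
split=> [c x y v|x|x y v|v]; first by rewrite Glin.
- exact: lendP.
- by rewrite GM.
- by rewrite G1.
Qed.

(** Two actions are two algebra maps from U to the endomorphisms of V that agree on [iota], and the
    universal property makes them equal. *)
Lemma env_action_uniq (V : lmodType k) (v0 : V) (r1 r2 : U -> V -> V) : v0 != 0 ->
  env_action r1 -> env_action r2 ->
  (forall a v, r1 (iota a) v = r2 (iota a) v) -> forall x v, r1 x v = r2 x v.
Proof.
move=> nz [lin1 l1 M1 one1] [lin2 l2 M2 one2] e12.
pose R1 x : lend nz := LEnd nz (l1 x); pose R2 x : lend nz := LEnd nz (l2 x).
have R1h : alg_hom R1.
  by split=> [c x y|x y|]; apply: lend_ext => v; rewrite /= ?lin1 ?M1 ?one1.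
have R2h : alg_hom R2.
  by split=> [c x y|x y|]; apply: lend_ext => v; rewrite /= ?lin2 ?M2 ?one2.
case: envU => - [iota_lin iota_br] univ.
have FP : lie_hom br (R1 \o iota).
  split=> [c a b|a b]; apply: lend_ext => v /=; first by rewrite iota_lin lin1.
  have r1B y z w : r1 (y - z) w = r1 y w - r1 z w.
    by rewrite [y - z]addrC -(scaleN1r z) lin1 scaleN1r addrC.
  by rewrite iota_br r1B !M1.
have [_ /(_ R1 R2 R1h R2h) H] := univ _ _ FP.
move=> x v; suff E : R1 x = R2 x by have := congr1 (fun R : lend nz => R v) E.
by apply: H => // a; apply: lend_ext => w; rewrite /= e12.
Qed.

(** That U is spanned by products of elements [iota a] is not among the hypotheses, so equivariance
    is deduced from the uniqueness of actions. *)
Lemma env_action_equivariant (V : lmodType k) (r : U -> V -> V) (g : {linear V -> U}) :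
  env_action r -> (forall a v, g (r (iota a) v) = iota a * g v) ->
  forall x v, g (r x v) = x * g v.
Proof.
move=> [lin l M one] gi x v.
(* r2 is r1 conjugated by the shear (a, v) |-> (a - g v, v); both agree on
   iota L, hence on U. *)
pose r1 x (p : U * V) : U * V := (x * p.1, r x p.2).
pose r2 x (p : U * V) : U * V := (x * p.1 - x * g p.2 + g (r x p.2), r x p.2).
have rB y a b : r y (a - b) = r y a - r y b.
  by rewrite [a - b]addrC -(scaleN1r b) l scaleN1r addrC.
have nz : (1, 0) != 0 :> U * V by rewrite xpair_eqE oner_eq0.
have E : r1 x (0, v) = r2 x (0, v).
  apply: (env_action_uniq nz).
  - split=> [c y z [a b]|y c [a b] [a' b']|y z [a b]|[a b]]; rewrite /r1 /=.
    + by rewrite lin mulrDl -scalerAl.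
    + by rewrite l mulrDr -scalerAr.
    + by rewrite M mulrA.
    + by rewrite one mul1r.
  - split=> [c y z [a b]|y c [a b] [a' b']|y z [a b]|[a b]]; rewrite /r2 /=.
    + apply: (congr2 pair); rewrite lin //= !mulrDl linearP /= -!scalerAl opprD -scalerN.
      by rewrite !scalerDr [LHS](AC (2*2*2) ((1*3*5)*(2*4*6))).
    + apply: (congr2 pair); rewrite l //= linearP /= linearP /= !mulrDr -!scalerAr opprD.
      by rewrite -scalerN !scalerDr [LHS](AC (2*2*2) ((1*3*5)*(2*4*6))).
    + apply: (congr2 pair); rewrite M //= !mulrDr !mulrN !mulrA.
      by rewrite addrK.
    + by rewrite one !mul1r subrK.
  - by move=> a [b p]; rewrite /r1 /r2 /= gi subrK.
by move/(congr1 fst): E; rewrite /= mulr0 add0r => /esym /eqP; rewrite addrC subr_eq0 => /eqP.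
Qed.

End EnvelopingModules.

(** * The embedding of U into the free module on sorted words *)

Section Embedding.
Variables (k : fieldType) (L : lmodType k) (br : L -> L -> L).
Hypothesis brP : lie_bracket br.
Variables (FL : freemod k L) (P : freemod k (seq L)).
Variables (le : rel L) (inB : pred L) (cl : {linear L -> FL}).
Hypothesis le_total : total le.
Hypothesis le_trans : transitive le.
Hypothesis le_anti : antisymmetric le.
Hypothesis cl_supp : forall x, supported inB (cl x).
Hypothesis cl_sum : forall x, lext id (cl x) = x.
Hypothesis clB : forall b, inB b -> cl b = << b >>.
Variables (U : algType k) (iota : L -> U).
Hypothesis envU : is_enveloping br iota.

Local Notation valid := (valid le inB).
Local Notation lact := (@lact k L br FL P le inB cl).

Lemma lact_lie_action : lie_action br lact.
Proof.
split=> [c a b v|a|a b v]; first exact: lactPl.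
- exact: lact_linear.
- exact: lact_bracket.
Qed.

(** [ev] lets x act on the empty word. It is injective because [evalU], being equivariant and
    sending the empty word to 1, is a left inverse. *)
Theorem pbw_embedding : exists ev : U -> P,
  [/\ linear ev, injective ev, forall a x, ev (iota a * x) = lact a (ev x)
    & forall x, supported valid (ev x)].
Proof.
have nz : << [::] >> != 0 :> P.
  apply/eqP => E; have := fm_coefE P [::] [::].
  by rewrite E eqxx -(scale0r (0 : P)) fm_coefZ mul0r => /eqP; rewrite eq_sym oner_eq0.
have [r [rlin rl rM r1] riota] := env_action_exists envU nz lact_lie_action.
(* It is not evident for a general x in U that [r x << [::] >>] is supported on valid words. [proj]
   discards the invalid ones, on which both [lact] and [evalU] vanish. *)
pose proj : {linear P -> P} := lext (fun M => if valid M then << M >> else 0).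
have proj_lin : linear proj by move=> c p q; rewrite linearP.
have proj_id p : supported valid p -> proj p = p.
  move=> vp; rewrite [RHS]fm_spanE [LHS]lextE; apply: eq_big_seq => M /vp vM.
  by rewrite vM.
have lact_proj a p : lact a (proj p) = lact a p.
  rewrite [proj p]lextE [in RHS](fm_spanE p) !(linear_sumZ _ _ _ (lact_linear _ _ _ _ _)).
  apply: eq_bigr => M _; apply: f_equal2 => //; case: ifP => // /negbT vM.
  by rewrite lact_invalid // raddf0.
have evalU_proj p : evalU le inB iota (proj p) = evalU le inB iota p.
  rewrite [proj p]lextE [in RHS](fm_spanE p) !(linear_sumZ _ _ _ (evalU_lin _ _ _)).
  apply: eq_bigr => M _; apply: f_equal2 => //; rewrite evalUU; case: ifP => vM.
    by rewrite evalUU vM.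
  by rewrite raddf0.
have [iotaP _] := envU.
have E x : evalU le inB iota (proj (r x << [::] >>)) = x.
  rewrite evalU_proj (env_action_equivariant envU (r := r)) //.
    by rewrite /= evalU1 mulr1.
  move=> a v; rewrite riota.
  exact: (evalU_lact le_total le_trans le_anti cl_supp cl_sum clB iotaP).
exists (fun x => proj (r x << [::] >>)); split=> [c x y|x y e|a x|x].
- by rewrite rlin linearP.
- by rewrite -[x]E e E.
- rewrite rM riota lact_proj proj_id //.
  exact: (lact_valid (br := br) le_total cl_supp).
apply: supported_lext => [//|M _]; case: ifP => vM; last exact: supported0.
exact: supportedU.
Qed.

End Embedding.

(** * Weights and symbols *)

Section Weights.
Variables (k : fieldType) (L : lmodType k) (br : L -> L -> L).
Hypothesis brP : lie_bracket br.
Variables (FL : freemod k L) (P : freemod k (seq L)).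
Variables (le : rel L) (inB : pred L) (cl : {linear L -> FL}).
Hypothesis le_total : total le.
Hypothesis le_trans : transitive le.
Hypothesis le_anti : antisymmetric le.
Hypothesis cl_supp : forall x, supported inB (cl x).
Hypothesis cl_sum : forall x, lext id (cl x) = x.
Hypothesis clB : forall b, inB b -> cl b = << b >>.
Variables (u v w : L).
Hypothesis (Bu : inB u) (Bv : inB v) (Bw : inB w).
Hypothesis (nuv : u != v) (nuw : u != w) (nvw : v != w).
Hypothesis br_vu : br v u = w.
Hypothesis le_u : forall b, inB b -> le u b.
Hypothesis le_v : forall b, inB b -> b != u -> le v b.
Hypothesis le_w : forall b, inB b -> b != u -> b != v -> le w b.

Local Notation valid := (valid le inB).
Local Notation lact := (@lact k L br FL P le inB cl).

(* With these weights [v, u] = w is the only bracket of letters that does not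
   drop in weight: in the associated graded algebra all other letters are
   central. *)
Definition wt (b : L) : nat :=
  if (b == u) || (b == v) then 2%N else if b == w then 4%N else 5%N.
(* The offset 12, the degree of V, keeps the degrees of quotients natural numbers. *)
Definition wtM (M : seq L) : nat := (\sum_(b <- M) wt b + 12)%N.
Definition wtle n := [pred M | valid M && (wtM M <= n)%N].

Lemma wt_u : wt u = 2%N. Proof. by rewrite /wt eqxx. Qed.
Lemma wt_v : wt v = 2%N. Proof. by rewrite /wt eqxx orbT. Qed.
Lemma wt_w : wt w = 4%N. Proof. by rewrite /wt eq_sym (negbTE nuw) eq_sym (negbTE nvw) eqxx. Qed.
Lemma wt_le5 b : (wt b <= 5)%N. Proof. by rewrite /wt; case: ifP => // _; case: ifP. Qed.
Lemma wt_ge2 b : (2 <= wt b)%N. Proof. by rewrite /wt; case: ifP => // _; case: ifP. Qed.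
Lemma wtM_cons b M : wtM (b :: M) = (wt b + wtM M)%N. Proof. by rewrite /wtM big_cons addnA. Qed.
Lemma wtM_ins b M : wtM (ins le b M) = (wt b + wtM M)%N.
Proof. by rewrite -wtM_cons; congr (_ + _)%N; apply: perm_big; rewrite perm_sort. Qed.

(** A sum of weights at most 4 forces both letters to be u or v, whose bracket is 0 or a multiple of
    w. Any other sum is at least 5, and no letter weighs more than 5. *)
Lemma br_wt x y : inB x -> inB y ->
  supported (fun b => inB b && (wt b <= wt x + wt y)%N) (cl (br x y)).
Proof.
move=> Bx By b bs; rewrite (cl_supp bs) /=.
have [lt|] := ltnP 4 (wt x + wt y); first exact: leq_trans (wt_le5 b) lt.
have H z : (wt z <= 2)%N -> (z == u) || (z == v) by rewrite /wt; case: ifP => // _; case: ifP.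
have := wt_ge2 x; have := wt_ge2 y => y2 x2 s4.
have wy : (wt y <= 2)%N by rewrite -(leq_add2l 2) (leq_trans _ s4) // leq_add2r.
have wx : (wt x <= 2)%N by rewrite -(leq_add2r 2) (leq_trans _ s4) // leq_add2l.
have clw : cl w = << w >> by apply: clB.
have brs := br_self brP.
have cl0 : b \notin fm_supp (cl 0).
  by rewrite linear0; apply: contraL isT => b0; have := @supported0 _ _ FL pred0 _ b0.
case/orP: (H _ wx) bs => /eqP ->; case/orP: (H _ wy) => /eqP ->; rewrite ?brs ?(negbTE cl0) // ?wt_u ?wt_v.
- rewrite (br_anti brP) br_vu linearN clw -scaleN1r => bs.
  have /eqP -> : b == w by apply: (supportedZ (supportedU (Q := pred1 w) _) bs); rewrite /= eqxx.
  by rewrite wt_w.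
- rewrite br_vu clw => bs.
  have /eqP -> : b == w by apply: (supportedU (Q := pred1 w) _ bs); rewrite /= eqxx.
  by rewrite wt_w.
Qed.

Lemma lact_wt_ext n e : (forall x M, inB x -> valid M -> (size M <= n)%N ->
    supported (wtle (wtM M + wt x)) (lact x << M >>)) ->
  forall c z p, supported (short le inB n) p -> supported (wtle c) p ->
  supported (fun b => inB b && (wt b <= e)%N) (cl z) -> supported (wtle (c + e)) (lact z p).
Proof.
move=> H c z p sp wp wz; apply: supported_lext wz _ => b /andP [Bb be].
have spw : supported [pred M | short le inB n M && (wtM M <= c)%N] p.
  move=> M Mp; apply/andP; split; first exact: sp.
  by have /andP [] := wp _ Mp.
apply: supported_lext spw _ => M /andP [/andP [vM sM] cM].
have := H b M Bb vM sM; rewrite lactBU // => hb.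
apply: (supportedW _ hb) => M' /= /andP [-> /leq_trans ->] //.
exact: leq_add.
Qed.

Lemma lact_wt_short n x M : inB x -> valid M -> (size M <= n)%N ->
    supported (wtle (wtM M + wt x)) (lact x << M >>).
Proof.
have head x' N : inB x' -> valid N -> all (le x') N ->
    supported (wtle (wtM N + wt x')) (lact x' << N >>).
  move=> Bx vN xN; rewrite lactBU // act_head //; apply: supportedU => /=.
  by rewrite valid_consE // Bx vN xN wtM_cons addnC leqnn.
elim: n x M => [|n IH] x M Bx vM sM.
  by case: M vM sM => // vM _; apply: head.
have [xM|] := boolP (all (le x) M); first exact: head.
case: M vM sM => [//|y N] vM sM nx; have [By vN] := valid_cons vM.
have yN : all (le y) N by move: vM; rewrite valid_consE // => /and3P [].
have nxy : ~~ le x y.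
  by apply: contra nx => /= xy; rewrite xy; apply: sub_all yN => t; apply: le_trans.
have yx : le y x by have := le_total x y; rewrite (negbTE nxy).
have sN : supported (short le inB n) (fm_e P N) by apply: supportedU; rewrite /= vN; apply: sM.
have wN : supported (wtle (wtM N)) (fm_e P N) by apply: supportedU; rewrite /= vN /=.
have wB b : inB b -> supported (fun c => inB c && (wt c <= wt b)%N) (cl b).
  by move=> Bb; rewrite clB //; apply: supportedU; rewrite Bb leqnn.
rewrite lact_cons // wtM_cons; apply: supportedD; last first.
  rewrite (addnC (wt y)) -addnA (addnC (wt y)).
  exact: (lact_wt_ext IH sN wN (br_wt Bx By)).
have hx := IH x N Bx vN sM.
rewrite -(subrK << ins le x N >> (lact x << N >>)) raddfD /=; apply: supportedD.
  rewrite -addnA addnC; apply: (lact_wt_ext IH) => //; last exact: wB.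
    rewrite lactBU //; apply: (supportedW _ (act_short le_total cl_supp Bx vN)) => M' /= /andP [-> /leq_trans ->] //.
  apply: supportedB => //; apply: supportedU.
  by rewrite /= ins_valid // wtM_ins addnC leqnn.
have hd : supported (wtle (wtM (ins le x N) + wt y)) (lact y << ins le x N >>).
  by apply: head; rewrite ?ins_valid ?ins_all ?yx.
by move: hd; rewrite wtM_ins addnC (addnC (wt x)) addnA.
Qed.

Lemma lact_wt c e z p : supported (wtle c) p ->
  supported (fun b => inB b && (wt b <= e)%N) (cl z) -> supported (wtle (c + e)) (lact z p).
Proof.
move=> wp wz; pose n := \max_(M <- fm_supp p) size M.
apply: (@lact_wt_ext n) => // [x M|M Mp]; first exact: lact_wt_short.
have /andP [vM _] := wp _ Mp; rewrite /= vM.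
by rewrite /n (big_rem _ Mp) /= leq_maxl.
Qed.

Lemma lact_wtB c b p : inB b -> supported (wtle c) p ->
  supported (wtle (c + wt b)) (lact b p).
Proof.
move=> Bb wp; apply: lact_wt => //; rewrite clB //; apply: supportedU.
by rewrite Bb leqnn.
Qed.

(** * The symbol as a differential operator *)

Section Symbol.
Variables (I : seq L) (m : nat).

(* The symbol of a word on polynomials: u acts as -d/dX, v as X and w as the
   identity; the remaining letters must spell I. *)
Fixpoint theta (M : seq L) : {poly k} :=
  match M with
  | [::] => if I == [::] then 'X^m else 0
  | x :: N => if x == u then - (theta N)^`() else if x == v then 'X * theta N
      else if x == w then theta N else if M == I then 'X^m else 0
  end.

Lemma theta_u N : theta (u :: N) = - (theta N)^`(). Proof. by rewrite /= eqxx. Qed.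
Lemma theta_v N : theta (v :: N) = 'X * theta N.
Proof. by rewrite /= eq_sym (negbTE nuv) eqxx. Qed.
Lemma theta_w N : theta (w :: N) = theta N.
Proof. by rewrite /= eq_sym (negbTE nuw) eq_sym (negbTE nvw) eqxx. Qed.

Definition Theta (n : nat) (p : P) : {poly k} :=
  lext (fun M => if wtM M == n then theta M else 0) p.

Lemma Theta_lin n : linear (Theta n).
Proof. exact: lext_is_linear. Qed.

Lemma ThetaU n M : Theta n << M >> = if wtM M == n then theta M else 0.
Proof. exact: lextU. Qed.

Lemma ThetaD n p q : Theta n (p + q) = Theta n p + Theta n q.
Proof. by rewrite -[p in LHS]scale1r Theta_lin scale1r. Qed.

Lemma Theta_low n c p : supported (wtle c) p -> (c < n)%N -> Theta n p = 0.
Proof.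
move=> wp cn; rewrite /Theta lextE big1_seq // => M /= /wp /= /andP [_ Mc].
by rewrite ltn_eqF ?scaler0 //; apply: leq_ltn_trans Mc cn.
Qed.

Lemma Theta_u n p : supported valid p ->
  Theta (n + 2) (lact u p) = - (Theta n p)^`().
Proof.
apply: (@lin_eq_supported _ _ P _ (fun p => Theta (n + 2) (lact u p)) (fun p => - (Theta n p)^`()) valid) => [c a b|c a b|M vM].
- by rewrite lactPr Theta_lin.
- by rewrite Theta_lin linearP opprD scalerN.
rewrite lactBU // act_head //; last first.
  by apply/allP => x xM; apply: le_u; case/andP: vM => _ /allP; apply.
rewrite !ThetaU wtM_cons wt_u addnC eqn_add2r theta_u.
by case: ifP => // _; rewrite linear0 oppr0.
Qed.

Lemma le_cases y M : valid M -> inB y -> (y == u) || (y == v) || (y == w) ->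
  all (le y) M \/ exists2 x, ((y == v) && (x == u)) || ((y == w) && ((x == u) || (x == v))) & exists N, M = x :: N.
Proof.
move=> vM By yc; have [|nall] := boolP (all (le y) M); [by left|right].
case: M vM nall => [//|x N] vM nall; exists x; last by exists N.
have [Bx vN] := valid_cons vM.
have xN : all (le x) N by move: vM; rewrite valid_consE // => /and3P [].
have nyx : ~~ le y x.
  by apply: contra nall => /= yx; rewrite yx; apply: sub_all xN => t; apply: le_trans.
case/orP: yc nyx => [/orP [/eqP ->|/eqP ->]|/eqP ->] nyx; rewrite ?eqxx /=.
- by rewrite le_u in nyx.
- by apply/orP; left; apply: contraNT nyx => xu; apply: le_v.
by apply/orP; right; apply: contraNT nyx; rewrite negb_or => /andP [xu xv]; apply: le_w.
Qed.

Definition Theta_vw_spec j := forall n M, valid M -> (size M <= j)%N -> (wtM M <= n)%N ->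
  Theta (n + 2) (lact v << M >>) = 'X * Theta n << M >> /\
  Theta (n + 4) (lact w << M >>) = Theta n << M >>.

(** Moving v past u creates w, so the two statements are proved together by induction on the length.
    Moving w past u or v creates only terms of lower weight. *)
Lemma Theta_vwP j : Theta_vw_spec j.
Proof.
have wE M : valid M -> supported (wtle (wtM M)) (fm_e P M).
  by move=> vM; apply: supportedU; rewrite /= vM /=.
have headv n M : valid M -> all (le v) M ->
    Theta (n + 2) (lact v << M >>) = 'X * Theta n << M >>.
  move=> vM aM; rewrite lactBU // act_head // !ThetaU wtM_cons wt_v addnC eqn_add2r theta_v.
  by case: ifP => // _; rewrite mulr0.
have headw n M : valid M -> all (le w) M ->
    Theta (n + 4) (lact w << M >>) = Theta n << M >>.
  by move=> vM aM; rewrite lactBU // act_head // !ThetaU wtM_cons wt_w addnC eqn_add2r theta_w.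
elim: j => [|j IH] n M vM sM wM.
  by case: M vM sM wM => // vM _ _; split; [apply: headv|apply: headw].
(* The letter v comes first: the case of w below applies v to [lact w << N >>], whose words may
   already have length [j.+1]. *)
have liftv : forall n M, valid M -> (size M <= j.+1)%N -> (wtM M <= n)%N ->
    Theta (n + 2) (lact v << M >>) = 'X * Theta n << M >>.
  move=> {}n {}M {}vM {}sM {}wM.
  have cv : (v == u) || (v == v) || (v == w) by rewrite eqxx orbT.
  have [aM|[x xu [N E]]] := le_cases vM Bv cv.
    exact: headv.
  have {xu}xu : x = u by move: xu; rewrite eqxx (negbTE nvw) orbF => /eqP.
  subst x M; have [_ vN] := valid_cons vM.
  have nvu : ~~ le v u.
    by apply: contra nuv => vu; apply/eqP/le_anti; rewrite vu le_u.
  rewrite lact_cons // ThetaD br_vu.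
  have vv : supported valid (lact v << N >>) by apply: (lact_valid (br := br)).
  move: wM; rewrite wtM_cons wt_u => wM.
  have [n' nE] : exists n', n = (n' + 2)%N.
    by exists (n - 2)%N; rewrite subnK // (leq_trans _ wM).
  subst n; rewrite addnC leq_add2r in wM.
  have [IHv IHw] := IH n' N vN sM wM.
  rewrite Theta_u // IHv -[(n' + 2 + 2)%N]addnA IHw !ThetaU wtM_cons wt_u addnC eqn_add2r theta_u.
  case: ifP => _; last by rewrite !mulr0 deriv0 oppr0 addr0.
  by rewrite derivM derivX mul1r opprD mulrN addrAC addNr add0r.
split; first exact: liftv.
have cw : (w == u) || (w == v) || (w == w) by rewrite eqxx !orbT.
have [aM|[x xuv [N E]]] := le_cases vM Bw cw.
  exact: headw.
have {}xuv : (x == u) || (x == v) by move: xuv; rewrite eq_sym (negbTE nvw) eqxx.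
subst M; have [Bx vN] := valid_cons vM.
have nwx : ~~ le w x.
  case/orP: xuv => /eqP ->.
    by apply: contra nuw => wu; apply/eqP/le_anti; rewrite wu le_u.
  by apply: contra nvw => wv; apply/eqP/le_anti; rewrite wv le_v // eq_sym.
move: wM; rewrite wtM_cons => wM.
have wx : wt x = 2%N by case/orP: xuv => /eqP ->; rewrite ?wt_u ?wt_v.
rewrite wx in wM.
have [n' nE] : exists n', n = (n' + 2)%N.
  by exists (n - 2)%N; rewrite subnK // (leq_trans _ wM).
subst n; rewrite addnC leq_add2r in wM.
have [_ IHw] := IH n' N vN sM wM.
rewrite lact_cons // ThetaD [X in _ + X](_ : _ = 0) ?addr0; last first.
  (* The bracket of w with x weighs at most 5, whereas w and x together weigh 6, so this term is
     invisible in the degree considered. *)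
  apply: (@Theta_low _ (wtM N + 5)); last by rewrite -addnA (leq_ltn_trans (leq_add wM (leqnn 5))) // ltn_add2l.
  apply: lact_wt; first exact: wE.
  by move=> b bs; rewrite (cl_supp bs) wt_le5.
have ww : supported (wtle (n' + 4)) (lact w << N >>).
  rewrite -wt_w; apply: lact_wtB => //.
  by apply: (supportedW _ (wE _ vN)) => M' /= /andP [-> /leq_trans ->].
rewrite addnAC.
case/orP: (xuv) => /eqP xE; subst x.
  rewrite Theta_u //; last by apply: (lact_valid (br := br)).
  rewrite IHw !ThetaU wtM_cons wt_u theta_u addnC eqn_add2r.
  by case: ifP => // _; rewrite deriv0 oppr0.
have sw : supported (short le inB j.+1) (lact w << N >>).
  rewrite -(subrK << ins le w N >> (lact w << N >>)) lactBU //; apply: supportedD.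
    apply: (supportedW _ (act_short le_total cl_supp Bw vN)) => M' /= /andP [-> sM'] /=.
    exact: leq_trans sM' (leqW sM).
  by apply: supportedU; rewrite /= ins_valid // size_ins.
have sww : supported [pred M | short le inB j.+1 M && (wtM M <= n' + 4)%N] (lact w << N >>).
  move=> M' M's; apply/andP; split; first exact: sw.
  by case/andP: (ww _ M's).
rewrite (@lin_eq_supported _ _ P _ (fun p => Theta (n' + 4 + 2) (lact v p)) (fun p => 'X * Theta (n' + 4) p) _ _ _ _ _ sww).
- rewrite IHw !ThetaU wtM_cons wt_v theta_v addnC eqn_add2r.
  by case: ifP => // _; rewrite mulr0.
- by move=> c a b; rewrite lactPr Theta_lin.
- by move=> c a b; rewrite Theta_lin mulrDr scalerAr.
by move=> M' /andP [/andP [vM' sM'] wM']; apply: liftv.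
Qed.

Lemma Theta_v n p : supported (wtle n) p -> Theta (n + 2) (lact v p) = 'X * Theta n p.
Proof.
apply: (@lin_eq_supported _ _ P _ (fun p => Theta (n + 2) (lact v p)) (fun p => 'X * Theta n p) (wtle n)) => [c a b|c a b|M /andP [vM wM]].
- by rewrite lactPr Theta_lin.
- by rewrite Theta_lin mulrDr scalerAr.
by case: (@Theta_vwP (size M) n M vM (leqnn _) wM).
Qed.

Lemma Theta_w n p : supported (wtle n) p -> Theta (n + 4) (lact w p) = Theta n p.
Proof.
apply: (@lin_eq_supported _ _ P _ (fun p => Theta (n + 4) (lact w p)) (fun p => Theta n p) (wtle n)) => [c a b|c a b|M /andP [vM wM]].
- by rewrite lactPr Theta_lin.
- by rewrite Theta_lin.
by case: (@Theta_vwP (size M) n M vM (leqnn _) wM).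
Qed.

End Symbol.

End Weights.

(** * Ordered bases *)

Section WellOrder.
Variables (T : eqType) (R : rel T).

Definition has_minima (S : rel T) :=
  forall A : pred T, (exists x, A x) -> exists2 z, A z & forall y, A y -> S z y.

Hypothesis Rwo : well_order R.

Lemma well_order_minima : has_minima R.
Proof. by move=> A /Rwo [z [[Az lz] _]]; exists z. Qed.

Lemma well_order_total : total R.
Proof.
move=> x y; have [|z] := well_order_minima (A := pred2 x y); first by exists x; rewrite /= eqxx.
by case/orP=> /eqP -> /(_ _) H; rewrite !H ?orbT //= eqxx ?orbT.
Qed.

Lemma well_order_antisym : antisymmetric R.
Proof.
move=> x y /andP [xy yx]; have [|z [_ U]] := Rwo (A := pred2 x y).
  by exists x; rewrite inE eqxx.
have rr t : R t t by have := well_order_total t t; rewrite orbb.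
rewrite -(U x); first rewrite -(U y) //; split; rewrite ?inE ?eqxx ?orbT // => t;
  by rewrite inE => /orP [] /eqP ->.
Qed.

Lemma well_order_trans : transitive R.
Proof.
move=> y x z xy yz; have [|m] := well_order_minima (A := pred3 x y z).
  by exists x; rewrite /= eqxx.
move=> /or3P [] /eqP -> H.
- by apply: H; rewrite /= eqxx !orbT.
- have -> // : x = y by apply: well_order_antisym; rewrite xy H //= eqxx.
have <- // : y = z; apply: well_order_antisym; rewrite yz H //= eqxx ?orbT //.
Qed.

End WellOrder.

(** The rank is compared first and a well-ordering decides ties. This puts u, v and w at the bottom
    of an otherwise arbitrary well-ordering. *)
Lemma rank_order (T : eqType) (rk : T -> nat) : exists le : rel T,
  [/\ total le, transitive le, antisymmetric le, has_minima le
    & forall x y, (rk x < rk y)%N -> le x y /\ ~~ le y x].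
Proof.
have [R Rwo] := well_ordering_principle T.
have Rt := well_order_total Rwo; have Rtr := well_order_trans Rwo.
have Ra := well_order_antisym Rwo; have Rm := well_order_minima Rwo.
exists (fun x y => (rk x < rk y)%N || (rk x == rk y) && R x y); split.
- by move=> x y; case: ltngtP => //= _; apply: Rt.
- move=> y x z; case: ltngtP => //= [xy _|xy].
    by case: ltngtP => [yz _|//|<- _]; rewrite ?xy ?(ltn_trans xy yz).
  by rewrite xy; case: ltngtP => //= _; apply: Rtr.
- by move=> x y; case: ltngtP => //= _; apply: Ra.
- move=> A [x0 Ax0]; pose Q n := `[< exists2 x, A x & rk x = n >].
  have exQ : exists n, Q n by exists (rk x0); apply/asboolP; exists x0.
  have [n /asboolP [x1 Ax1 r1] nmin] := ex_minnP exQ.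
  have [|z /andP [Az /eqP rz] zmin] := Rm (fun x => A x && (rk x == n)).
    by exists x1; rewrite Ax1 r1 eqxx.
  exists z => // y Ay; rewrite rz; have : (n <= rk y)%N.
    by apply: nmin; apply/asboolP; exists y.
  by rewrite leq_eqVlt => /orP [/eqP e|-> //]; rewrite -e ltnn eqxx /= zmin // Ay e eqxx.
- by move=> x y xy; rewrite xy; case: ltngtP xy => //.
Qed.

Section HamelBasis.
Variables (k : fieldType) (L : lmodType k) (FL : freemod k L) (le : rel L).
Hypothesis le_total : total le.
Hypothesis le_trans : transitive le.
Hypothesis le_anti : antisymmetric le.
Hypothesis le_min : has_minima le.

Definition slt x y := le x y && (x != y).
(** The greedy basis of a well-ordered space: the vectors not spanned by strictly smaller ones.
    Independent vectors at the bottom of the order, such as u, v and w, automatically belong to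
    it. *)
Definition inB (x : L) : bool :=
  ~~ `[< exists2 p : FL, supported (slt^~ x) p & lext id p = x >].

Lemma le_reflexive x : le x x. Proof. by have := le_total x x; rewrite orbb. Qed.

Lemma sltNle x y : ~~ le x y = slt y x.
Proof.
rewrite /slt; have [->|nxy] := eqVneq x y; first by rewrite le_reflexive andbF.
case xy: (le x y); case yx: (le y x) => //.
  by case/eqP: nxy; apply: le_anti; rewrite xy.
by have := le_total x y; rewrite xy yx.
Qed.

Lemma lext_lext (X Y : choiceType) (F : freemod k X) (G : freemod k Y) (V : lmodType k)
    (g : Y -> V) (f : X -> G) (p : F) : lext g (lext f p) = lext (fun x => lext g (f x)) p.
Proof. by rewrite [lext f p]lextE (linear_sumZ _ _ _ (lext_is_linear _)). Qed.

Lemma basis_span x : exists p : FL, supported inB p /\ lext id p = x.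
Proof.
pose A := fun x => ~~ `[< exists p : FL, supported inB p /\ lext id p = x >].
suff H : ~~ A x by move: H; rewrite negbK => /asboolP.
apply/negP => Ax; have [|z Az zmin] := le_min (A := A); first by exists x.
apply: (negP Az); apply/asboolP; case Bz: (inB z).
  by exists << z >>; split; [apply: supportedU|rewrite lextU].
move: Bz => /negbFE /asboolP [q qz qE].
have H b : exists p : FL, slt b z -> supported inB p /\ lext id p = b.
  case bz: (slt b z); last by exists 0.
  have : ~~ A b by apply: contraTN bz => /zmin; rewrite -sltNle => ->.
  by rewrite negbK => /asboolP [p pP]; exists p.
have [f fP] := choice H; exists (lext f q); split.
  by apply: supported_lext qz _ => b /fP [].
by rewrite lext_lext -[RHS]qE; apply: eq_lext => b /qz /fP [].
Qed.

Lemma seq_max (s : seq L) : s != [::] -> exists2 b, b \in s & forall c, c \in s -> le c b.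
Proof.
elim: s => // x [|y s] IH _; first by exists x; rewrite ?mem_head // => c /[!inE] /eqP ->; rewrite le_reflexive.
have [//|b bs bm] := IH; have /orP [xb|bx] := le_total x b.
  exists b; first by rewrite in_cons bs orbT.
  by move=> c; rewrite in_cons => /orP [/eqP -> //|/bm].
exists x; rewrite ?mem_head // => c; rewrite in_cons => /orP [/eqP ->|/bm cb]; first exact: le_reflexive.
exact: le_trans cb bx.
Qed.

Lemma basis_free (p : FL) : supported inB p -> lext id p = 0 -> p = 0.
Proof.
move=> Bp p0; have [s0|sn] := eqVneq (fm_supp p) [::].
  by rewrite (fm_spanE p) s0 big_nil.
have [b bs bm] := seq_max sn.
have cb : fm_coef p b != 0 by rewrite -fm_suppE.
case/negP: (Bp b bs); apply/asboolP.
exists (- (fm_coef p b)^-1 *: (p - fm_coef p b *: << b >>)); last first.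
  by rewrite linearZ /= linearB /= linearZ /= p0 lextU sub0r scalerN scaleNr opprK scalerA mulVf ?scale1r.
apply: supportedZ => c; rewrite fm_suppE fm_coefD -scaleN1r !fm_coefZ fm_coefE => nz.
have cb' : c != b by apply: contraNneq nz => ->; rewrite eqxx mulr1 mulN1r subrr.
rewrite (eq_sym b) (negbTE cb') !mulr0 addr0 in nz.
by rewrite /slt cb' andbT bm // fm_suppE.
Qed.

Lemma basis_coordinates : exists cl : {linear L -> FL},
  [/\ forall x, supported inB (cl x), forall x, lext id (cl x) = x
    & forall b, inB b -> cl b = << b >>].
Proof.
have [f fP] := choice basis_span.
have uni (p q : FL) : supported inB p -> supported inB q -> lext id p = lext id q :> L -> p = q.
  move=> Bp Bq e; apply/eqP; rewrite -subr_eq0; apply/eqP; apply: basis_free; first exact: supportedB.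
  by rewrite linearB /= e subrr.
have fl : linear f.
  move=> c x y; have [Bx ex] := fP x; have [By ey] := fP y; have [Bz ez] := fP (c *: x + y).
  apply: uni => //; first by apply: supportedD => //; apply: supportedZ.
  by rewrite ez linearP /= ex ey.
pose F : {linear L -> FL} := HB.pack f (GRing.isLinear.Build k L FL _ f fl).
exists F; split=> [x|x|b Bb]; rewrite -?[F _]/(f _).
- by case: (fP x).
- by case: (fP x).
by apply: uni; [case: (fP b)|apply: supportedU|rewrite lextU; case: (fP b)].
Qed.

End HamelBasis.

Section AdaptedBasis.
Variables (k : fieldType) (L : lmodType k) (FL : freemod k L) (u v w : L).
Hypothesis indep : forall a b c : k, a *: u + b *: v + c *: w = 0 -> [/\ a = 0, b = 0 & c = 0].

Lemma indep_neq : [/\ u != v, u != w, v != w & u != 0].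
Proof.
split; apply/eqP => e.
- have H : 1 *: u + (-1) *: v + 0 *: w = 0.
    by rewrite e scale0r addr0 scale1r scaleN1r subrr.
  by have [/eqP] := indep H; rewrite oner_eq0.
- have H : 1 *: u + 0 *: v + (-1) *: w = 0.
    by rewrite e scale0r addr0 scale1r scaleN1r subrr.
  by have [/eqP] := indep H; rewrite oner_eq0.
- have H : 0 *: u + 1 *: v + (-1) *: w = 0.
    by rewrite e scale0r add0r scale1r scaleN1r subrr.
  by have [_ /eqP] := indep H; rewrite oner_eq0.
have H : 1 *: u + 0 *: v + 0 *: w = 0 by rewrite e !scale0r scaler0 !addr0.
by have [/eqP] := indep H; rewrite oner_eq0.
Qed.

Theorem adapted_basis : exists (le : rel L) (inB : pred L) (cl : {linear L -> FL}),
  [/\ [/\ total le, transitive le & antisymmetric le],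
      [/\ forall x, supported inB (cl x), forall x, lext id (cl x) = x
        & forall b, inB b -> cl b = << b >>],
      [/\ inB u, inB v & inB w]
    & [/\ forall b, inB b -> le u b, forall b, inB b -> b != u -> le v b
        & forall b, inB b -> b != u -> b != v -> le w b]].
Proof.
have [nuv nuw nvw nu] := indep_neq.
pose rk x := if x == u then 0%N else if x == v then 1%N else if x == w then 2%N else 3%N.
have [le [le_total le_trans le_anti le_min le_rk]] := rank_order rk.
have [cl [cl1 cl2 cl3]] := basis_coordinates FL le_total le_trans le_anti le_min.
exists le, (inB FL le), cl.
have ru : rk u = 0%N by rewrite /rk eqxx.
have rv : rk v = 1%N by rewrite /rk eq_sym (negbTE nuv) eqxx.
have rw : rk w = 2%N by rewrite /rk eq_sym (negbTE nuw) eq_sym (negbTE nvw) eqxx.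
have lt_rk x y : slt le x y -> (rk x <= rk y)%N && (x != y).
  by case/andP=> xy ->; rewrite andbT leqNgt; apply: contraL xy => /le_rk [].
have span (s : seq L) (p : FL) : uniq s -> supported (mem s) p ->
    lext id p = \sum_(x <- s) fm_coef p x *: x by move=> us sp; apply: lextw.
split=> //; split.
- apply/negP => /asboolP [p sp pE].
  have {}sp : supported (mem [::]) p.
    by move=> x /sp /lt_rk /andP []; rewrite ru leqn0 /rk; case: (x == u) => //; case: (x == v) => //; case: (x == w).
  by move: pE nu; rewrite (span [::]) // big_nil => <-; rewrite eqxx.
- apply/negP => /asboolP [p sp pE].
  have {}sp : supported (mem [:: u]) p.
    move=> x /sp /lt_rk /andP []; rewrite rv /rk => xv nxv.
    suff : x \in [:: u] by []; move: xv nxv; rewrite inE.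
    by case: (x == u) => //; case: (x == v) => //; case: (x == w).
  move: pE; rewrite (span [:: u]) // big_seq1 => pE.
  have H : fm_coef p u *: u + (-1) *: v + 0 *: w = 0.
    by rewrite pE scale0r addr0 scaleN1r subrr.
  by have [_ /eqP] := indep H; rewrite oppr_eq0 oner_eq0.
- apply/negP => /asboolP [p sp pE].
  have {}sp : supported (mem [:: u; v]) p.
    move=> x /sp /lt_rk /andP []; rewrite rw /rk => xv nxv.
    suff : x \in [:: u; v] by []; move: xv nxv; rewrite !inE.
    by case: (x == u) => //; case: (x == v) => //; case: (x == w).
  have us : uniq [:: u; v] by rewrite /= inE nuv.
  move: pE; rewrite (span _ _ us sp) !big_cons big_nil addr0 => pE.
  have H : fm_coef p u *: u + fm_coef p v *: v + (-1) *: w = 0 by rewrite pE scaleN1r subrr.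
  by have [_ _ /eqP] := indep H; rewrite oppr_eq0 oner_eq0.
- move=> b _; have [->|bu] := eqVneq b u; first by have := le_total u u; rewrite orbb.
  by apply: (le_rk u b _).1; rewrite ru /rk (negbTE bu); case: (b == v) => //; case: (b == w).
- move=> b _ bu; have [->|bv] := eqVneq b v; first by have := le_total v v; rewrite orbb.
  by apply: (le_rk v b _).1; rewrite rv /rk (negbTE bu) (negbTE bv); case: (b == w).
move=> b _ bu bv; have [->|bw] := eqVneq b w; first by have := le_total w w; rewrite orbb.
by apply: (le_rk w b _).1; rewrite rw /rk (negbTE bu) (negbTE bv) (negbTE bw).
Qed.

End AdaptedBasis.

(** * Leading symbols *)

Section PolyNat.
Variable k : fieldType.

Lemma poly_eventually_nonroot (p : {poly k}) : [pchar k] =i pred0 -> p != 0 ->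
  exists N, forall n, (N <= n)%N -> p.[n%:R] != 0.
Proof.
move=> /pcharf0P ch0; have [s] := ubnP (size p); elim: s p => // s IH p sp p0.
have [[n0 r0]|nr] := pselect (exists n0, root p n0%:R); last first.
  by exists 0%N => n _; apply/negP => rn; apply: nr; exists n.
have [q pE] := factor_theorem _ _ r0.
have q0 : q != 0 by apply: contraNneq p0 => q0; rewrite pE q0 mul0r.
have [|N HN] := IH q _ q0.
  by move: sp; rewrite pE size_Mmonic ?monicXsubC // size_XsubC addn2 /= ltnS.
exists (maxn N n0.+1) => n; rewrite geq_max => /andP [Nn n0n].
rewrite pE hornerM mulf_neq0 ?HN // hornerXsubC.
by rewrite -natrB ?ch0 1?ltnW // subn_eq0 -ltnNge.
Qed.

(** The falling factorial of [X + b]. Up to sign it is the coefficient that a derivations produce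
    from the monomial of exponent [b + m], as a polynomial in m. *)
Definition falling (b a : nat) : {poly k} := \prod_(i < a) ('X + (b%:R - i%:R)%:P).

Lemma size_falling b a : size (falling b a) = a.+1.
Proof.
rewrite /falling size_prod => [|i _]; last by rewrite -size_poly_eq0 size_XaddC.
rewrite (eq_bigr (fun _ => 2%N)) => [|i _]; last by rewrite size_XaddC.
by rewrite sum_nat_const card_ord muln2 -addnn subSn ?leq_addr // addnK.
Qed.

Lemma horner_falling b a m : (a <= m)%N -> (falling b a).[m%:R] = ((b + m) ^_ a)%:R.
Proof.
move=> am; rewrite horner_prod ffact_prod natr_prod; apply: eq_bigr => i _.
rewrite hornerD hornerX hornerC natrB ?natrD; last first.
  by rewrite (leq_trans _ (leq_addl _ _)) // (leq_trans _ am) // ltnW.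
by rewrite addrA (addrC m%:R).
Qed.

Lemma iter_nderivXn a j :
  iter a (fun f : {poly k} => - f^`()) 'X^j = ((-1) ^+ a * (j ^_ a)%:R) *: 'X^(j - a).
Proof.
elim: a => [|a IH]; first by rewrite expr0 ffactn0 mulr1 scale1r subn0.
rewrite iterS IH derivZ derivXn -scaleNr -scaler_nat scalerA ffactnSr natrM exprS mulN1r.
by rewrite !mulNr -mulrA subnS.
Qed.

Lemma sum_distinct_size_neq0 (I : eqType) (s : seq I) (c : I -> k) (f : I -> {poly k}) :
  uniq s -> s != [::] -> {in s &, injective (fun i => size (f i))} ->
  (forall i, i \in s -> c i != 0 /\ f i != 0) -> \sum_(i <- s) c i *: f i != 0.
Proof.
move=> us sn inj nz.
have [i0 [i0s i0m]] : exists i, i \in s /\ forall j, j \in s -> (size (f j) <= size (f i))%N.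
  elim: s sn {us inj nz} => // x [|y s] IH _.
    by exists x; rewrite mem_head; split=> // j; rewrite inE => /eqP ->.
  have [//|i [is_ im]] := IH.
  have [xi|ix] := leqP (size (f x)) (size (f i)).
    by exists i; rewrite in_cons is_ orbT; split=> // j; rewrite in_cons => /orP [/eqP ->|/im].
  exists x; rewrite mem_head; split=> // j; rewrite in_cons => /orP [/eqP -> //|/im ji].
  exact: leq_trans ji (ltnW ix).
have [c0 f0] := nz _ i0s.
rewrite (big_rem i0) //= -size_poly_eq0 size_addl ?size_scale ?size_poly_eq0 //.
rewrite big_seq; apply: (big_ind (fun p : {poly k} => size p < size (f i0))%N).
- by rewrite size_poly0 lt0n size_poly_eq0.
- by move=> p q sp sq; rewrite (leq_ltn_trans (size_polyD _ _)) // gtn_max sp.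
move=> i; rewrite mem_rem_uniq // !inE => /andP [ii0 is_].
rewrite (leq_ltn_trans (size_scale_leq _ _)) // ltn_neqAle i0m // andbT.
by apply: contra ii0 => /eqP /inj ->.
Qed.

End PolyNat.

Lemma no_small_annihilator (k : fieldType) (A : 'M[k]_(3, 2)) :
  exists a : 'I_3 -> k, (exists i, a i != 0) /\ forall j, \sum_i a i * A i j = 0.
Proof.
have : kermx A != 0.
  rewrite kermx_eq0 /row_free; apply/eqP => e; have := rank_leq_col A.
  by rewrite e.
case/rowV0Pn => r /sub_kermxP rA r0; exists (r ord0); split.
  by apply/existsP; apply: contraNT r0 => /existsPn H; apply/eqP/rowP => i; rewrite mxE; apply/eqP; have := H i; rewrite negbK.
by move=> j; have := congr1 (fun M : 'M__ => M ord0 j) rA; rewrite !mxE.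
Qed.

(** If [br v u] were a combination of u and v, their span would be closed under the bracket and
    three of its elements could not be independent. A relation with [c = 0] leads to the same case:
    it makes u or v a multiple of the other, so [br v u = 0]. *)
Lemma lie_gen_indep (k : fieldType) (L : lmodType k) (br : L -> L -> L) (u v : L) :
  lie_bracket br -> dim_ge3 (lie_gen br u v) ->
  forall a b c : k, a *: u + b *: v + c *: br v u = 0 -> [/\ a = 0, b = 0 & c = 0].
Proof.
move=> brP [x1 [x2 [x3 [g1 g2 g3 ind]]]] a b c E.
suff nw : ~ exists al be, br v u = al *: u + be *: v.
  have [c0|c0] := eqVneq c 0; last first.
    case: nw; exists (- (c^-1 * a)), (- (c^-1 * b)).
    have : c *: br v u = - (a *: u + b *: v) by apply/eqP; rewrite -addr_eq0 addrC E.
    move/(congr1 (fun x => c^-1 *: x)); rewrite scalerA mulVf // scale1r => ->.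
    by rewrite scalerN scalerDr !scalerA opprD !scaleNr.
  move: E; rewrite c0 scale0r addr0 => E.
  have [a0|a0] := eqVneq a 0.
    have [b0|b0] := eqVneq b 0; first by split.
    move: E; rewrite a0 scale0r add0r => /eqP; rewrite scaler_eq0 (negbTE b0) /= => /eqP v0.
    case: nw; exists 0, 0; rewrite v0 !scale0r addr0.
    by apply: (addIr (br 0 u)); rewrite -(br_addl brP) !addr0 add0r.
  case: nw; exists 0, 0; rewrite !scale0r addr0.
  have -> : u = (- (a^-1 * b)) *: v + 0.
    rewrite addr0; have : a *: u = - (b *: v) by apply/eqP; rewrite -addr_eq0 E.
    by move/(congr1 (fun x => a^-1 *: x)); rewrite scalerA mulVf // scale1r => ->; rewrite scalerN scalerA scaleNr.
  rewrite (br_linr brP) (br_self brP) scaler0 add0r.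
  by apply: (addIr (br v 0)); rewrite -(br_addr brP) !add0r.
move=> [al [be wE]].
have span x : lie_gen br u v x -> exists p q, x = p *: u + q *: v.
  elim=> [|||d y z _ [p [q ->]] _ [p' [q' ->]]|y z _ [p [q ->]] _ [p' [q' ->]]].
  - by exists 1, 0; rewrite scale1r scale0r addr0.
  - by exists 0, 1; rewrite scale1r scale0r add0r.
  - by exists 0, 0; rewrite !scale0r addr0.
  - exists (d * p + p'), (d * q + q'); rewrite scalerDr !scalerA !scalerDl.
    by rewrite [LHS](AC (2*2) ((1*3)*(2*4))).
  exists ((q * p' - p * q') * al), ((q * p' - p * q') * be).
  have bZl e s t : br (e *: s) t = e *: br s t.
    have b0 : br 0 t = 0 by apply: (addIr (br 0 t)); rewrite -(br_addl brP) !add0r.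
    by have := br_linl brP e s 0 t; rewrite b0 !addr0.
  have bZr e s t : br s (e *: t) = e *: br s t.
    by rewrite (br_anti brP) bZl (br_anti brP s) scalerN.
  rewrite (br_addl brP) !(br_addr brP) !bZl !bZr !(br_self brP) (br_anti brP u v) wE.
  rewrite !scaler0 add0r addr0 !scalerN !scalerDr !scalerA !mulrBl !scalerBl.
  by rewrite ?opprD [LHS]addrC [LHS](AC (2*2) ((1*3)*(2*4))).
have [p1 [q1 e1]] := span _ g1; have [p2 [q2 e2]] := span _ g2; have [p3 [q3 e3]] := span _ g3.
have [r [[i ri] rA]] := no_small_annihilator (\matrix_(i < 3, j < 2)
   nth 0 (nth [::] [:: [:: p1; q1]; [:: p2; q2]; [:: p3; q3]] i) j).
have := rA ord0; have := rA (@Ordinal 2 1 isT); rewrite !big_ord_recl !big_ord0 !mxE /= !addr0.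
set r1 := r ord0; set r2 := r (lift _ _); set r3 := r (lift _ _) => Q0 P0.
have [|z1 z2 z3] := ind r1 r2 r3.
  rewrite e1 e2 e3 !scalerDr !scalerA.
  rewrite [LHS](AC (2*2*2) ((1*(3*5))*(2*(4*6)))) /= -!scalerDl P0 Q0 !scale0r addr0 //.
case/negP: ri; apply/eqP; case: i => [[|[|[|//]]] lti].
- by rewrite -z1; congr r; apply: val_inj.
- by rewrite -z2; congr r; apply: val_inj.
by rewrite -z3; congr r; apply: val_inj.
Qed.

Section LeadingTerm.
Variables (k : fieldType) (L : lmodType k) (P : freemod k (seq L)).
Hypothesis ch0 : [pchar k] =i pred0.
Variables (le : rel L) (inB : pred L).
Hypothesis le_total : total le.
Hypothesis le_trans : transitive le.
Hypothesis le_anti : antisymmetric le.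
Variables (u v w : L).
Hypothesis (Bu : inB u) (Bv : inB v) (Bw : inB w).
Hypothesis (nuv : u != v) (nuw : u != w) (nvw : v != w).
Hypothesis le_u : forall b, inB b -> le u b.
Hypothesis le_v : forall b, inB b -> b != u -> le v b.
Hypothesis le_w : forall b, inB b -> b != u -> b != v -> le w b.

Local Notation valid := (valid le inB).
Local Notation wtM := (wtM u v w).
Local Notation theta := (theta u v w).

Definition others (M : seq L) := [seq x <- M | (x != u) && (x != v) && (x != w)].
Local Notation cu M := (count_mem u M).
Local Notation cv M := (count_mem v M).
Local Notation cw M := (count_mem w M).

Lemma word_decomp M : valid M ->
  M = nseq (cu M) u ++ nseq (cv M) v ++ nseq (cw M) w ++ others M.
Proof.
elim: M => // x N IH vM; have [Bx vN] := valid_cons vM.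
have xN : all (le x) N by move: vM; rewrite valid_consE // => /and3P [].
have BN : all inB N by case/andP: vN.
have cnt0 z : x != z -> le z x -> (count_mem z N = 0)%N.
  move=> xz zx; apply/eqP; rewrite -leqn0 leqNgt -has_count has_pred1.
  by apply: contra xz => /(allP xN) xz; apply/eqP/le_anti; rewrite xz zx.
rewrite {1}(IH vN) /=; have [xu|xu] := eqVneq x u.
  by subst x; rewrite (negbTE nuv) (negbTE nuw) add1n !add0n.
have c_u := cnt0 _ xu (le_u Bx).
rewrite c_u /=; have [xv|xv] := eqVneq x v.
  by subst x; rewrite (negbTE nvw) add1n ?add0n /= ?addn0.
have c_v := cnt0 _ xv (le_v Bx xu).
rewrite c_v /=; have [xw|xw] := eqVneq x w.
  by subst x; rewrite add1n ?addn0.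
have c_w := cnt0 _ xw (le_w Bx xu xv).
by rewrite c_w ?addn0.
Qed.

Lemma theta_word I m M : valid M -> theta I m M =
  if others M == I then iter (cu M) (fun f : {poly k} => - f^`()) 'X^(cv M + m) else 0.
Proof.
move=> vM; rewrite {1}(word_decomp vM).
elim: (cu M) => [|a IHa]; last first.
  rewrite iterS (lock iter) /= eqxx -lock IHa.
  by case: ifP => // _; rewrite linear0 oppr0.
elim: (cv M) => [|b IHb]; last first.
  rewrite /= eq_sym (negbTE nuv) eqxx IHb /= addSn exprS.
  by case: ifP => // _; rewrite mulr0.
elim: (cw M) => [|c IHc]; last first.
  by rewrite /= eq_sym (negbTE nuw) eq_sym (negbTE nvw) eqxx IHc.
have : all (fun x => (x != u) && (x != v) && (x != w)) (others M) by apply: filter_all.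
case: (others M) => [|x N] /=; first by rewrite eq_sym.
by case/andP=> /andP [/andP [/negbTE -> /negbTE ->] /negbTE ->] _.
Qed.

Lemma wtM_word M : wtM M = (2 * cu M + 2 * cv M + 4 * cw M + wtM (others M))%N.
Proof.
elim: M => // x N IH; rewrite wtM_cons IH /=.
have [->|xu] := eqVneq x u.
  by rewrite wt_u (negbTE nuv) (negbTE nuw) /= add0n add0n; lia.
have [->|xv] := eqVneq x v.
  by rewrite wt_v (negbTE nvw) /= add0n add0n; lia.
have [->|xw] := eqVneq x w; first by rewrite wt_w // /= !add0n; lia.
by rewrite wtM_cons !add0n addnCA.
Qed.

(** This is why w may be set to 1: in a fixed weight its exponent is determined by the other
    letters. *)
Lemma word_inj I M N : valid M -> valid N -> others M = I -> others N = I -> wtM M = wtM N ->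
  cu M = cu N -> cv M = cv N -> M = N.
Proof.
move=> vM vN oM oN wMN eu ev; rewrite (word_decomp vM) (word_decomp vN) oM oN eu ev.
suff -> : cw M = cw N by [].
by move: wMN; rewrite (wtM_word M) (wtM_word N) oM oN eu ev; lia.
Qed.

(** Take a heaviest word and its central part I. Applied to the m-th power of X, each word with this
    weight and this I gives a monomial of exponent [m + cv - cu]. The coefficients of least exponent
    add up to [Q] evaluated at m, where [Q] is a combination of falling factorials of distinct
    degrees, hence nonzero at all large m. Varying m places the lowest term at any large i. *)
Lemma leading_symbol (p : P) : supported valid p -> p != 0 -> exists n,
  [/\ (12 <= n)%N, supported (wtle le inB u v w n) p & exists I i0, forall i, (i0 <= i)%N -> exists m,
    (forall l, (l < i)%N -> (Theta u v w I m n p)`_l = 0) /\ (Theta u v w I m n p)`_i != 0].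
Proof.
move=> vp p0.
have s0 : fm_supp p != [::] by apply: contraNneq p0 => e; rewrite (fm_spanE p) e big_nil.
have [M0 [M0s M0m]] : exists M, M \in fm_supp p /\ forall N, N \in fm_supp p -> (wtM N <= wtM M)%N.
  have /hasP [x xs _] : has predT (fm_supp p) by rewrite has_predT lt0n size_eq0.
  pose F (i : seq_sub (fm_supp p)) := wtM (val i).
  case: (@arg_maxnP _ (SeqSub xs) predT F isT) => i _ im; exists (val i); split.
    exact: valP.
  by move=> N Ns; apply: (im (SeqSub Ns)).
pose n := wtM M0; pose I := others M0.
exists n; split; [by rewrite /n /wtM leq_addl| |].
  by move=> M Ms; rewrite /wtle /= (vp _ Ms) M0m.
exists I.
pose X := [seq M <- fm_supp p | (wtM M == n) && (others M == I)].
have uX : uniq X by rewrite filter_uniq // fm_supp_uniq.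
have XP M : M \in X -> [/\ M \in fm_supp p, valid M, wtM M = n & others M = I].
  by rewrite mem_filter => /andP [/andP [/eqP ? /eqP ?] Ms]; split=> //; apply: vp.
have M0X : M0 \in X by rewrite mem_filter !eqxx.
have ThE m : Theta u v w I m n p = \sum_(M <- X)
    (fm_coef p M * ((-1) ^+ cu M * ((cv M + m) ^_ cu M)%:R)) *: 'X^(cv M + m - cu M).
  rewrite /Theta lextE big_filter [RHS]big_mkcond /=; apply: eq_big_seq => M /vp vM.
  case: eqP => _ /=; last by rewrite scaler0.
  by rewrite theta_word //; case: eqP => _; rewrite ?scaler0 // iter_nderivXn scalerA.
pose A := \max_(M <- X) cu M.
have AM M : M \in X -> (cu M <= A)%N by move=> MX; apply: leq_bigmax_seq.
(* The exponent of X relative to m, shifted by [A] to stay a natural number. *)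
pose d M := (cv M + A - cu M)%N.
have [M1 [M1X M1m]] : exists M, M \in X /\ forall N, N \in X -> (d M <= d N)%N.
  pose F (i : seq_sub X) := d (val i).
  case: (@arg_minnP _ (SeqSub M0X) predT F isT) => i _ im; exists (val i); split.
    exact: valP.
  by move=> N Ns; apply: (im (SeqSub Ns)).
pose X1 := [seq M <- X | d M == d M1].
pose Q := \sum_(M <- X1) (fm_coef p M * (-1) ^+ cu M) *: falling k (cv M) (cu M).
have X1P M : M \in X1 -> M \in X /\ d M = d M1.
  by rewrite mem_filter => /andP [/eqP].
have Q0 : Q != 0.
  apply: sum_distinct_size_neq0; first by rewrite filter_uniq.
  - by apply: contraTneq isT => e; have : M1 \in X1 by [rewrite mem_filter eqxx]; rewrite e.
  - move=> M N /X1P [MX dM] /X1P [NX dN]; rewrite !size_falling => - [e].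
    have [_ vM wM oM] := XP _ MX; have [_ vN wN oN] := XP _ NX.
    apply: (word_inj vM vN oM oN) => //; first by rewrite wM wN.
    have : d M = d N by rewrite dM dN.
    by rewrite /d e -!addnBA ?AM // => /addIn.
  move=> M /X1P [MX _]; have [Ms _ _ _] := XP _ MX.
  rewrite -size_poly_eq0 size_falling; split=> //.
  by rewrite mulf_neq0 ?signr_eq0 // -fm_suppE.
have [m1 Hm1] := poly_eventually_nonroot ch0 Q0.
exists (d M1 + m1)%N => i i1.
(* With this m the lowest monomial, of exponent [d M1 + (m - A)], has exponent i. *)
pose m := (i + A - d M1)%N.
have mA : (A + m1 <= m)%N by clear -i1; rewrite /m; lia.
have expE M : M \in X -> (cv M + m - cu M = d M + (m - A))%N.
  by move=> MX; have := AM _ MX; clear -mA; rewrite /d; lia.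
have iE : (i = d M1 + (m - A))%N by clear -i1; rewrite /m; lia.
exists m; split=> [l li|].
  rewrite ThE coef_sum big1_seq // => M /= MX.
  rewrite coefZ coefXn expE // (_ : l == _ = false) ?mulr0 //.
  by apply/eqP; have := M1m _ MX; clear -li iE; lia.
rewrite ThE coef_sum.
suff -> : \sum_(M <- X) ((fm_coef p M * ((-1) ^+ cu M * ((cv M + m) ^_ cu M)%:R)) *:
   'X^(cv M + m - cu M))`_i = Q.[m%:R] by apply: Hm1; apply: leq_trans mA; apply: leq_addl.
rewrite horner_sum [RHS]big_filter [RHS]big_mkcond /=; apply: eq_big_seq => M MX.
rewrite coefZ coefXn expE // iE eqn_add2r eq_sym; case: eqP => _; rewrite ?mulr0 // mulr1.
rewrite hornerZ horner_falling ?mulrA //.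
by apply: leq_trans (AM _ MX) (leq_trans _ mA); apply: leq_addr.
Qed.

End LeadingTerm.

(* Fil n is the weight filtration of U.  Th I m n y is the image of X^m under
   the symbol of degree n of y, a polynomial in central variables with
   coefficients in the first Weyl algebra of which one takes the coefficient
   of the monomial I. *)
Record symbol_calculus (k : fieldType) (U : algType k) (iu iv iw : U) (J : Type)
    (Fil : nat -> U -> Prop) (Th : J -> nat -> nat -> U -> {poly k}) : Prop := SymbolCalculus {
  sc_lin : forall I m n, linear (Th I m n);
  sc_fil0 : forall n, Fil n 0;
  sc_filP : forall n c y z, Fil n y -> Fil n z -> Fil n (c *: y + z);
  sc_mono : forall n n' y, (n <= n')%N -> Fil n y -> Fil n' y;
  sc_low : forall I m n n' y, Fil n y -> (n < n')%N -> Th I m n' y = 0;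
  sc_u : forall n y, Fil n y -> Fil (n + 2)%N (iu * y) /\
    forall I m, Th I m (n + 2)%N (iu * y) = - (Th I m n y)^`();
  sc_v : forall n y, Fil n y -> Fil (n + 2)%N (iv * y) /\
    forall I m, Th I m (n + 2)%N (iv * y) = 'X * Th I m n y;
  sc_w : forall n y, Fil n y -> Fil (n + 4)%N (iw * y) /\
    forall I m, Th I m (n + 4)%N (iw * y) = Th I m n y;
  sc_lead : forall y, y != 0 -> exists n, [/\ (12 <= n)%N, Fil n y
    & exists I i0, forall i, (i0 <= i)%N -> exists m,
      (forall l, (l < i)%N -> (Th I m n y)`_l = 0) /\ (Th I m n y)`_i != 0] }.

Theorem symbol_calculus_exists (k : fieldType) (L : lmodType k) (br : L -> L -> L)
    (U : algType k) (iota : L -> U) (u v : L) :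
  [pchar k] =i pred0 -> lie_bracket br -> is_enveloping br iota ->
  dim_ge3 (lie_gen br u v) ->
  exists (Fil : nat -> U -> Prop) (Th : seq L -> nat -> nat -> U -> {poly k}),
    symbol_calculus (iota u) (iota v) (iota (br v u)) Fil Th.
Proof.
move=> ch0 brP envU dim3; set w := br v u.
have ind := lie_gen_indep brP dim3; rewrite -/w in ind.
have [nuv nuw nvw _] := indep_neq ind.
have [FL] := freemod_exists k L; have [P] := freemod_exists k (seq L).
have [le [inB [cl [[le1 le2 le3] [cl1 cl2 cl3] [Bu Bv Bw] [lu lv lw]]]]] := adapted_basis FL ind.
have [ev [evl evi evm evv]] := pbw_embedding brP P le1 le2 le3 cl1 cl2 cl3 envU.
have ev0 : ev 0 = 0 by have := evl 1 0 0; rewrite !scale1r addr0 => /eqP; rewrite -subr_eq0 opprD addNKr oppr_eq0 => /eqP.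
exists (fun n y => supported (wtle le inB u v w n) (ev y)).
exists (fun I m n y => Theta u v w I m n (ev y)).
split.
- by move=> I m n c y z; rewrite evl Theta_lin.
- by move=> n; rewrite ev0; apply: supported0.
- by move=> n c y z Fy Fz; rewrite evl; apply: supportedD => //; apply: supportedZ.
- move=> n n' y nn' Fy; apply: supportedW Fy => M /= /andP [-> Mn] /=.
  exact: leq_trans Mn nn'.
- by move=> I m n n' y Fy nn'; apply: Theta_low Fy nn'.
- move=> n y Fy; rewrite !evm; split=> [|I m].
    have := lact_wtB brP le1 le2 le3 cl1 cl3 Bw nuw nvw (erefl (br v u)) Bu Fy.
    by rewrite wt_u.
  by apply: (Theta_u br le2 cl3 v w Bu lu); apply: evv.
- move=> n y Fy; rewrite !evm; split=> [|I m].
    have := lact_wtB brP le1 le2 le3 cl1 cl3 Bw nuw nvw (erefl (br v u)) Bv Fy.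
    by rewrite wt_v.
  exact: (Theta_v brP le1 le2 le3 cl1 cl3 Bu Bv Bw nuv nuw nvw (erefl (br v u)) lu lv lw I m Fy).
- move=> n y Fy; rewrite !evm; split=> [|I m].
    have := lact_wtB brP le1 le2 le3 cl1 cl3 Bw nuw nvw (erefl (br v u)) Bw Fy.
    by rewrite wt_w.
  exact: (Theta_w brP le1 le2 le3 cl1 cl3 Bu Bv Bw nuv nuw nvw (erefl (br v u)) lu lv lw I m Fy).
move=> y y0; have [|n [n12 Fn lead]] := leading_symbol ch0 le2 le3 Bu Bv Bw nuv nuw nvw lu lv lw (evv y).
  by apply: contraNneq y0 => e; apply/eqP/evi; rewrite e ev0.
by exists n.
Qed.

(** * Iterated sums of rational functions *)

Section RationalGerms.
Variable k : fieldType.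
Hypothesis ch0 : [pchar k] =i pred0.
Implicit Types f g : nat -> k.

Lemma natr_eq0 n : (n%:R == 0 :> k) = (n == 0)%N.
Proof. by move/pcharf0P: ch0. Qed.

Definition eventually (A : nat -> Prop) := exists N, forall n, (N <= n)%N -> A n.

Lemma eventually_and A B : eventually A -> eventually B -> eventually (fun n => A n /\ B n).
Proof.
move=> [N HN] [M HM]; exists (maxn N M) => n; rewrite geq_max => /andP [Nn Mn].
by split; [apply: HN|apply: HM].
Qed.

Lemma eventually_mono A B : (forall n, A n -> B n) -> eventually A -> eventually B.
Proof. by move=> AB [N HN]; exists N => n /HN /AB. Qed.

Lemma eventually_shift A : eventually A -> eventually (fun n => A n.+1).
Proof. by move=> [N HN]; exists N => n Nn; apply: HN; apply: leqW. Qed.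

Lemma eventually_true (A : nat -> Prop) : (forall n, A n) -> eventually A.
Proof. by exists 0%N. Qed.

Definition geq f g := eventually (fun n => f n = g n).

(** Germs at infinity of rational functions. A nonzero polynomial has no large natural roots in
    characteristic zero, so such a germ is zero or eventually invertible and the conventional value
    of a quotient by 0 is harmless. *)
Definition ratl f := exists p q : {poly k},
  q != 0 /\ eventually (fun n => f n = p.[n%:R] / q.[n%:R]).

Lemma ratl_geq f g : geq f g -> ratl f -> ratl g.
Proof.
move=> fg [p [q [q0 fE]]]; exists p, q; split=> //.
by apply: eventually_mono (eventually_and fg fE) => n [<-].
Qed.

Lemma eventually_horner (q : {poly k}) : q != 0 -> eventually (fun n => q.[n%:R] != 0).
Proof. exact: poly_eventually_nonroot. Qed.

Lemma ratl_poly (p : {poly k}) : ratl (fun n => p.[n%:R]).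
Proof.
exists p, 1; split; first exact: oner_neq0.
by apply: eventually_true => n; rewrite hornerC divr1.
Qed.

Lemma ratl_cst c : ratl (fun=> c).
Proof.
by apply: ratl_geq (ratl_poly c%:P); apply: eventually_true => n; rewrite hornerC.
Qed.

Lemma ratlD f g : ratl f -> ratl g -> ratl (fun n => f n + g n).
Proof.
move=> [p [q [q0 fE]]] [p' [q' [q'0 gE]]]; exists (p * q' + p' * q), (q * q').
rewrite mulf_neq0 //; split=> //.
have := eventually_and (eventually_and fE gE)
  (eventually_and (eventually_horner q0) (eventually_horner q'0)).
apply: eventually_mono => n [[-> ->] [nq nq']].
by rewrite hornerD !hornerM addf_div.
Qed.

Lemma ratlM f g : ratl f -> ratl g -> ratl (fun n => f n * g n).
Proof.
move=> [p [q [q0 fE]]] [p' [q' [q'0 gE]]]; exists (p * p'), (q * q').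
rewrite mulf_neq0 //; split=> //; apply: eventually_mono (eventually_and fE gE) => n [-> ->].
by rewrite !hornerM mulf_div.
Qed.

Lemma ratlX f e : ratl f -> ratl (fun n => f n ^+ e).
Proof.
move=> rf; elim: e => [|e IH]; first exact: ratl_cst.
by apply: ratl_geq (ratlM rf IH); apply: eventually_true => n; rewrite exprS.
Qed.

Lemma ratlN f : ratl f -> ratl (fun n => - f n).
Proof.
move=> rf; apply: ratl_geq (ratlM (ratl_cst (-1)) rf).
by apply: eventually_true => n; rewrite mulN1r.
Qed.

Lemma ratl_sum (I : Type) (r : seq I) (F : I -> nat -> k) :
  (forall i, ratl (F i)) -> ratl (fun n => \sum_(i <- r) F i n).
Proof.
move=> H; elim: r => [|i r IH].
  by apply: ratl_geq (ratl_cst 0); apply: eventually_true => n; rewrite big_nil.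
by apply: ratl_geq (ratlD (H i) IH); apply: eventually_true => n; rewrite big_cons.
Qed.

Lemma ratl_dichotomy f : ratl f -> geq f (fun=> 0) \/ eventually (fun n => f n != 0).
Proof.
move=> [p [q [q0 fE]]]; have [p0|p0] := eqVneq p 0.
  by left; apply: eventually_mono fE => n ->; rewrite p0 hornerC mul0r.
right; have := eventually_and fE (eventually_and (eventually_horner p0) (eventually_horner q0)).
by apply: eventually_mono => n [-> [pn qn]]; rewrite mulf_neq0 ?invr_eq0.
Qed.

Lemma ratlV f : ratl f -> ratl (fun n => (f n)^-1).
Proof.
move=> [p [q [q0 fE]]]; have [p0|p0] := eqVneq p 0.
  apply: ratl_geq (ratl_cst 0); apply: eventually_mono fE => n ->.
  by rewrite p0 hornerC mul0r invr0.
by exists q, p; split=> //; apply: eventually_mono fE => n ->; rewrite invf_div.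
Qed.

Lemma horner_shift (p : {poly k}) (n : nat) : (p \Po ('X + 1%:P)).[n%:R] = p.[n.+1%:R].
Proof. by rewrite horner_comp !hornerE -natr1. Qed.

Lemma ratl_shift f : ratl f -> ratl (fun n => f n.+1).
Proof.
move=> [p [q [q0 fE]]]; exists (p \Po ('X + 1%:P)), (q \Po ('X + 1%:P)); split.
  have [N HN] := eventually_horner q0.
  apply: contraTneq (HN N.+1 (leqnSn N)) => e.
  by rewrite -horner_shift e hornerC eqxx.
by apply: eventually_mono (eventually_shift fE) => n ->; rewrite !horner_shift.
Qed.

(** Along steps of two f is constant, so the rational germ [f - c] has arbitrarily large zeros and
    vanishes. Then c equals its opposite. *)
Lemma ratl_alternating f : ratl f -> eventually (fun n => f n.+1 = - f n) -> geq f (fun=> 0).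
Proof.
move=> rf [N HN]; pose c := f N.
have per j : f (N + j.*2)%N = c.
  elim: j => [|j IH]; first by rewrite addn0.
  by rewrite doubleS !addnS !HN ?opprK ?IH ?leqW ?leq_addr.
have rg : ratl (fun n => f n - c) by apply: ratlD => //; apply: ratl_cst.
have [[M HM]|[M HM]] := ratl_dichotomy rg; last first.
  have := HM (N + M.*2)%N; rewrite per subrr eqxx -addnn addnA => H.
  by have := H (leq_addl _ _).
have c0 : c = 0.
  pose n := maxn N M; have := HN n (leq_maxl _ _).
  have /eqP := HM n (leq_maxr _ _); rewrite subr_eq0 => /eqP ->.
  have /eqP := HM n.+1 (leqW (leq_maxr _ _)); rewrite subr_eq0 => /eqP -> /eqP.
  by rewrite -addr_eq0 -mulr2n -mulr_natr mulf_eq0 natr_eq0 orbF => /eqP.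
by exists M => n Mn; have := HM n Mn; rewrite c0 subr0.
Qed.

End RationalGerms.

(** * A difference equation without rational solutions *)

Section PoleArgument.
Variable k : fieldType.
Hypothesis ch0 : [pchar k] =i pred0.

Definition den : {poly k} := (12%:R%:P * 'X + 1%:P) * (12%:R%:P * 'X + 5%:R%:P).
(* The eigenvalue of S - 2 on X^(2n), where (uv + vu)/2w acts on X^i as -(i + 1/2). *)
Definition dd (n : nat) : k := 16%:R / den.[n%:R].

Lemma den_nat n : den.[n%:R] = ((12 * n + 1) * (12 * n + 5))%N%:R.
Proof. by rewrite /den hornerM !hornerD !hornerM !hornerC hornerX natrM !(natrD _ (12 * n)) (natrM _ 12). Qed.

(** The other root of [den] is at distance 1/3 from -1/12, so no other integer translate of -1/12 is
    a root. *)
Lemma den_shift x : den.[- 12%:R^-1 + x] = 12%:R * x * (12%:R * x + 4%:R).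
Proof.
have n12 : 12%:R != 0 :> k by rewrite natr_eq0.
by rewrite /den hornerM !hornerD !hornerM !hornerC hornerX; field.
Qed.
#[local] Opaque den.

Lemma den_nat_neq0 n : den.[n%:R] != 0.
Proof. by rewrite den_nat natr_eq0 // muln_eq0 !addn_eq0 andbF. Qed.

Lemma ratl_dd : ratl dd.
Proof.
apply: ratlM; first exact: ratl_cst.
by apply: ratlV; apply: ratl_poly.
Qed.

Lemma dd_inj : injective dd.
Proof.
have n16 : 16%:R != 0 :> k by rewrite natr_eq0.
move=> n m /(mulfI n16) /invr_inj.
rewrite !den_nat => /eqP; rewrite -subr_eq0.
wlog le_nm : n m / (n <= m)%N.
  move=> W; have [nm|mn] := leqP n m; first exact: W.
  by rewrite -oppr_eq0 opprB => /(W _ _ (ltnW mn)).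
rewrite -oppr_eq0 opprB -natrB ?(natr_eq0 ch0) ?subn_eq0; last by apply: leq_mul; lia.
move=> H; apply/eqP; rewrite eqn_leq le_nm leqNgt; apply/negP => lt_nm.
by move: H; rewrite leqNgt ltn_mul //; lia.
Qed.

Lemma poly_zero_nat (p : {poly k}) : eventually (fun n => p.[n%:R] = 0) -> p = 0.
Proof.
move=> [N HN]; apply/eqP; apply: contraT => /(poly_eventually_nonroot ch0) [M HM].
by have := HM (maxn N M) (leq_maxr _ _); rewrite HN ?leq_maxl ?eqxx.
Qed.

Lemma no_root_progression (q : {poly k}) (a b : k) : q != 0 -> b != 0 ->
  exists n : nat, q.[a + b * n%:R] != 0.
Proof.
move=> q0 b0; have c0 : q \Po (b%:P * 'X + a%:P) != 0.
  have sz : size (b%:P * 'X + a%:P) = 2%N by rewrite size_MXaddC polyC_eq0 (negbTE b0) /= size_polyC b0.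
  by rewrite comp_poly2_eq0.
have [N HN] := poly_eventually_nonroot ch0 c0; exists N.
by have := HN N (leqnn N); rewrite horner_comp !hornerE addrC.
Qed.

(* Outside the roots of den, the roots of the reduced denominator Q of F
   propagate to infinitely many, so that Q vanishes neither at -1/12 nor at
   11/12; but p(dd) has a pole at -1/12 unless p is constant. *)
Lemma total_sum_no_pole (p : {poly k}) (F : nat -> k) : ratl F ->
  eventually (fun n => F n.+1 + F n = p.[dd n]) -> (size p <= 1)%N.
Proof.
move=> [P0 [Q0 [Q00 FE0]]] H; rewrite leqNgt; apply/negP => sp.
have [P [Q [Qn0 cPQ FE]]] : exists P Q : {poly k}, [/\ Q != 0, coprimep P Q &
    eventually (fun n => F n = P.[n%:R] / Q.[n%:R])].
  pose g := gcdp P0 Q0; have g0 : g != 0 by rewrite gcdp_eq0 negb_and Q00 orbT.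
  exists (P0 %/ g), (Q0 %/ g); split.
  - by apply: contraNneq Q00 => e; rewrite -(divpK (dvdp_gcdr P0 Q0)) e mul0r.
  - by apply: coprimep_div_gcd; rewrite Q00 orbT.
  have := eventually_and FE0 (eventually_horner ch0 g0).
  apply: eventually_mono => n [-> gn].
  have e1 : P0.[n%:R] = (P0 %/ g).[n%:R] * g.[n%:R] by rewrite -hornerM divpK ?dvdp_gcdl.
  have e2 : Q0.[n%:R] = (Q0 %/ g).[n%:R] * g.[n%:R] by rewrite -hornerM divpK ?dvdp_gcdr.
  by rewrite e1 e2 -mulf_div divff // mulr1.
pose E := (size p).-1.
(* [Np] is [p(16/den)] multiplied by [den ^+ E] to clear denominators. At a root of [den] only the
   leading term of p survives. *)
pose Np := \sum_(i < size p) (p`_i * 16%:R ^+ i) *: den ^+ (E - i).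
have NpE x : den.[x] != 0 -> p.[16%:R / den.[x]] * den.[x] ^+ E = Np.[x].
  move=> dx; rewrite horner_coef /Np horner_sum mulr_suml; apply: eq_bigr => i _.
  rewrite hornerZ horner_exp expr_div_n -!mulrA; congr (_ * (_ * _)).
  have iE : (i <= E)%N by rewrite /E -ltnS prednK ?ltn_ord // (ltn_trans _ sp).
  by rewrite -{1}(subnK iE) exprD mulrCA mulVf ?mulr1 // expf_neq0.
have Np_root x : den.[x] = 0 -> Np.[x] != 0.
  move=> dx; have sE : size p = E.+1 by rewrite /E prednK // (ltn_trans _ sp).
  rewrite /Np horner_sum sE big_ord_recr /= subnn expr0 big1 ?add0r.
    rewrite hornerZ hornerC mulr1 mulf_neq0 ?expf_neq0 ?natr_eq0 //.
    by rewrite -/(lead_coef p) lead_coef_eq0 -size_poly_eq0 sE.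
  by move=> i _; rewrite hornerZ horner_exp dx expr0n subn_eq0 leqNgt ltn_ord mulr0.
pose Q1 := Q \Po ('X + 1%:P); pose P1 := P \Po ('X + 1%:P).
have ID : Np * (Q * Q1) = den ^+ E * (P1 * Q + P * Q1).
  apply/eqP; rewrite -subr_eq0; apply/eqP/poly_zero_nat.
  have := eventually_and (eventually_and FE (eventually_shift FE)) (eventually_and H
    (eventually_and (eventually_horner ch0 Qn0) (eventually_shift (eventually_horner ch0 Qn0)))).
  apply: eventually_mono => n [[Fn Fn1] [Hn [qn qn1]]].
  rewrite hornerD hornerN (hornerM Np) (hornerM Q) (hornerM (den ^+ E)) -NpE ?den_nat_neq0 // -/(dd n) -Hn Fn Fn1.
  rewrite hornerD (hornerM P1) (hornerM P) !horner_shift horner_exp.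
  by field; rewrite qn qn1.
have IDx x : Np.[x] * (Q.[x] * Q.[x + 1]) = den.[x] ^+ E * (P.[x + 1] * Q.[x] + P.[x] * Q.[x + 1]).
  have := congr1 (fun p : {poly k} => p.[x]) ID.
  rewrite (hornerM Np) (hornerM Q) (hornerM (den ^+ E)) horner_exp hornerD (hornerM P1) (hornerM P).
  by rewrite !horner_comp hornerD hornerX hornerC.
have PQ x : Q.[x] = 0 -> P.[x] != 0.
  by move=> qx; rewrite coprimep_sym in cPQ; apply: (coprimep_root cPQ); apply/eqP.
pose r0 : k := - 12%:R^-1.
have n12 : 12%:R != 0 :> k by rewrite natr_eq0.
have den_r0 := den_shift.
have fwd x : Q.[x] = 0 -> den.[x] != 0 -> Q.[x + 1] = 0.
  move=> qx dx; have /esym/eqP := IDx x; rewrite qx mul0r !mulr0 add0r.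
  by rewrite !mulf_eq0 expf_eq0 (negbTE dx) andbF (negbTE (PQ _ qx)) => /eqP.
have bwd x : Q.[x + 1] = 0 -> den.[x] != 0 -> Q.[x] = 0.
  move=> qx dx; have /esym/eqP := IDx x; rewrite qx !mulr0 addr0.
  by rewrite !mulf_eq0 expf_eq0 (negbTE dx) andbF (negbTE (PQ _ qx)) => /eqP.
have Qr1 : Q.[r0 + 1] != 0.
  apply/negP => /eqP e; have [n] := no_root_progression (r0 + 1) Qn0 (oner_neq0 k).
  suff -> : Q.[r0 + 1 + 1 * n%:R] = 0 by rewrite eqxx.
  elim: n => [|n IH]; first by rewrite mul1r addr0.
  rewrite -natr1 mulrDr mulr1 addrA; apply: fwd => //.
  by rewrite mul1r -addrA den_r0 -(natrD _ 1) -!natrM -natrD -natrM natr_eq0.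
have Qr0 : Q.[r0] != 0.
  apply/negP => /eqP e; have N1 : -1 != 0 :> k by rewrite oppr_eq0 oner_eq0.
  have [n] := no_root_progression r0 Qn0 N1.
  suff -> : Q.[r0 + -1 * n%:R] = 0 by rewrite eqxx.
  elim: n => [|n IH]; first by rewrite mulr0 addr0.
  apply: bwd; first by rewrite -natr1 mulrDr mulr1 addrA subrK.
  rewrite den_r0 mulN1r mulrN mulNr oppr_eq0 mulf_neq0 //.
    by rewrite -natrM natr_eq0.
  rewrite addrC subr_eq0 -natrM eq_sym -subr_eq0 -natrB; last by lia.
  by rewrite natr_eq0 // subn_eq0 -ltnNge; lia.
have /esym/eqP := IDx r0; have d0 : den.[r0] = 0.
  by have := den_r0 0; rewrite addr0 mulr0 mul0r.
have E0 : (0 < E)%N by rewrite /E -ltnS prednK // (ltn_trans _ sp).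
rewrite d0 expr0n gtn_eqF //= mul0r eq_sym !mulf_eq0 (negbTE Qr0) (negbTE Qr1) !orbF.
by rewrite (negbTE (Np_root _ d0)).
Qed.

End PoleArgument.

(** * Linear independence of the iterated sums *)

Section IteratedSums.
Variable k : fieldType.
Hypothesis ch0 : [pchar k] =i pred0.
Implicit Types f g c : nat -> k.

(* Sequences stand for power series in x.  gop (-1) is multiplication by
   (1 - x)/(1 + x) and gop 1 is multiplication by (1 + x)/(1 - x). *)
Fixpoint gop (s : k) f n : k :=
  if n is n'.+1 then f n + s * f n' + s * gop s f n' else f 0.

Definition sg (t : bool) : k := if t then 1 else -1.

Lemma sgN t : sg (~~ t) = - sg t. Proof. by case: t; rewrite /= ?opprK. Qed.
Lemma sg_sqr t : sg t * sg t = 1. Proof. by case: t; rewrite /= ?mulrNN mulr1. Qed.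

Lemma gopS s f n : gop s f n.+1 = f n.+1 + s * f n + s * gop s f n.
Proof. by []. Qed.

Variable m : nat.
Definition pulse (n : nat) : k := (n == m)%:R.

(** Since [T - 2] is [gop (-1)], [dd], [gop 1] composed, the factors [gop (-1)] and [gop 1]
    alternate in a word, separated by powers of [dd]. The innermost one meets the pulse. *)
Fixpoint isum (t : bool) (l : seq nat) : nat -> k :=
  if l is e :: l' then gop (sg t) (fun n => dd k n ^+ e * isum (~~ t) l' n)
  else gop (sg t) pulse.

Definition Y (w : bool * seq nat) := isum w.1 w.2.
(** At an exponent 0 two neighbouring factors [gop 1] and [gop (-1)] would cancel. *)
Definition good (w : bool * seq nat) := all (leq 1) w.2.

Lemma isum_nil_shift t : eventually (fun n => isum t [::] n.+1 = sg t * isum t [::] n).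
Proof.
exists m.+1 => n mn; rewrite [LHS]gopS /pulse !gtn_eqF // ?mulr0 ?add0r //.
exact: leqW.
Qed.

Lemma isum_nil_neq0 t : eventually (fun n => isum t [::] n != 0).
Proof.
have sg0 : sg t != 0 by case: (t); rewrite /= ?oppr_eq0 oner_eq0.
have low n : (n < m)%N -> isum t [::] n = 0.
  elim: n => [|n IH] nm; first by rewrite /= /pulse ltn_eqF.
  by rewrite [LHS]gopS -/(isum t [::] n) IH ?(ltnW nm) // /pulse !ltn_eqF ?mulr0 ?addr0 // ltnW.
have at_m : isum t [::] m = 1.
  case E : m => [|m']; first by rewrite /= /pulse E.
  rewrite [LHS]gopS -/(isum t [::] m') low ?E // /pulse E eqxx ltn_eqF // !mulr0 !addr0 //.
have at_m1 : isum t [::] m.+1 = sg t * 2%:R.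
  by rewrite [LHS]gopS -/(isum t [::] m) at_m /pulse eqxx gtn_eqF // add0r -mulrDr.
exists m.+1 => n mn; rewrite -(subnK mn); elim: (n - m.+1)%N => [|j IH].
  by rewrite add0n at_m1 mulf_neq0 // natr_eq0.
rewrite addSn [isum _ _ _]gopS -/(isum t [::] (j + m.+1)) /pulse !gtn_eqF ?mulr0 ?add0r ?mulf_neq0 //.
- by rewrite addnS ltnS leq_addl.
by rewrite addnS ltnS leqW // leq_addl.
Qed.

(** The filtration by depth along which independence is proved: germs of combinations, over the
    rational functions, of iterated sums with fewer than j exponents. *)
Inductive span (j : nat) : (nat -> k) -> Prop :=
  | span0 f : geq f (fun=> 0) -> span j f
  | spanS f c w g : (size w.2 < j)%N -> good w -> ratl c -> span j g ->
      geq f (fun n => c n * Y w n + g n) -> span j f.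

Lemma geq_trans f g h : geq f g -> geq g h -> geq f h.
Proof. by move=> fg gh; apply: eventually_mono (eventually_and fg gh) => n [-> ->]. Qed.

Lemma geq_sym f g : geq f g -> geq g f.
Proof. by apply: eventually_mono. Qed.

Lemma geq_refl f g : (forall n, f n = g n) -> geq f g.
Proof. exact: eventually_true. Qed.

Lemma span_geq j f g : geq f g -> span j f -> span j g.
Proof.
move=> fg sf; case: sf fg => [h h0|h c w h' sw gw rc sh hE] fg.
  exact: span0 _ (geq_trans (geq_sym fg) h0).
exact: spanS sw gw rc sh (geq_trans (geq_sym fg) hE).
Qed.

Lemma span_ext j f g : (forall n, f n = g n) -> span j f -> span j g.
Proof. by move=> e; apply: span_geq; apply: geq_refl. Qed.

Lemma spanD j f g : span j f -> span j g -> span j (fun n => f n + g n).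
Proof.
move=> sf sg'; elim: sf => {f} [f f0|f c w h sw gw rc _ IH fE].
  by apply: span_geq sg'; apply: eventually_mono f0 => n ->; rewrite add0r.
apply: (spanS sw gw rc IH); apply: eventually_mono fE => n ->.
by rewrite addrA.
Qed.

Lemma spanZ j c f : ratl c -> span j f -> span j (fun n => c n * f n).
Proof.
move=> rc; elim=> {f} [f f0|f d w h sw gw rd _ IH fE].
  by apply: span0; apply: eventually_mono f0 => n ->; rewrite mulr0.
apply: (spanS sw gw (ratlM rc rd) IH); apply: eventually_mono fE => n ->.
by rewrite mulrDr mulrA.
Qed.

Lemma spanZc j (c : k) f : span j f -> span j (fun n => c * f n).
Proof. by apply: spanZ; apply: ratl_cst. Qed.

Lemma spanB j f g : span j f -> span j g -> span j (fun n => f n - g n).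
Proof.
move=> sf sg'; apply: (span_ext _ (spanD sf (spanZc (-1) sg'))) => n.
by rewrite mulN1r.
Qed.

Lemma span_sum j (I : eqType) (r : seq I) (F : I -> nat -> k) :
  (forall i, i \in r -> span j (F i)) -> span j (fun n => \sum_(i <- r) F i n).
Proof.
elim: r => [|i r IH] H.
  by apply: span0; apply: geq_refl => n; rewrite big_nil.
have H1 := H i (mem_head _ _).
have H2 : span j (fun n => \sum_(i <- r) F i n).
  by apply: IH => i' ir; apply: H; rewrite in_cons ir orbT.
by apply: (span_ext _ (spanD H1 H2)) => n; rewrite big_cons.
Qed.

Lemma spanW j j' f : (j <= j')%N -> span j f -> span j' f.
Proof.
move=> jj; elim=> {f} [f f0|f c w h sw gw rc _ IH fE]; first exact: span0.
exact: (spanS (leq_trans sw jj) gw rc IH).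
Qed.

Lemma spanY j w : (size w.2 < j)%N -> good w -> span j (Y w).
Proof.
move=> sw gw; apply: (spanS sw gw (ratl_cst 1) (span0 _ (geq_refl (fun _ => erefl)))).
by apply: geq_refl => n; rewrite mul1r addr0.
Qed.

Lemma ratl_ddX e : ratl (fun n => dd k n ^+ e).
Proof. by apply: ratlX; apply: ratl_dd. Qed.

Lemma Y_cons t e l n : Y (t, e :: l) n.+1 = dd k n.+1 ^+ e * Y (~~ t, l) n.+1
  + sg t * (dd k n ^+ e * Y (~~ t, l) n) + sg t * Y (t, e :: l) n.
Proof. by []. Qed.

Lemma Y_step t l : good (t, l) ->
  span (size l) (fun n => Y (t, l) n.+1 - sg t * Y (t, l) n).
Proof.
elim: l t => [|e l IH] t.
  move=> _; apply: span0; apply: eventually_mono (isum_nil_shift t) => n.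
  by rewrite /Y /= => ->; rewrite subrr.
move=> /andP [_ gl]; have s' := IH (~~ t) gl.
have sY : span (size l).+1 (Y (~~ t, l)) by apply: spanY.
have sY1 : span (size l).+1 (fun n => Y (~~ t, l) n.+1).
  apply: (span_ext _ (spanD (spanW (leqnSn _) s') (spanZc (sg (~~ t)) sY))) => n.
  by rewrite subrK.
have := spanD (spanZ (ratl_shift ch0 (ratl_ddX e)) sY1) (spanZ (ratl_ddX e) (spanZc (sg t) sY)).
apply: span_ext => n; rewrite Y_cons addrK.
by congr (_ + _); rewrite mulrCA.
Qed.

(** Up to shorter sums [Y (~~ t, l)] changes by the factor [- sg t] under the shift, so the two
    terms of [Y_cons] combine into a difference of values of [dd ^+ e]. *)
Lemma Y_step2 t e l : good (t, l) -> span (size l) (fun n =>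
  Y (t, e :: l) n.+1 - sg t * Y (t, e :: l) n
  - sg t * (dd k n ^+ e - dd k n.+1 ^+ e) * Y (~~ t, l) n).
Proof.
move=> gl; have s' : span (size l) (fun n => Y (~~ t, l) n.+1 - sg (~~ t) * Y (~~ t, l) n).
  exact: Y_step.
apply: (span_ext _ (spanZ (ratl_shift ch0 (ratl_ddX e)) s')) => n.
rewrite Y_cons addrK sgN; ring.
Qed.

Lemma span_shift j f : span j f -> span j (fun n => f n.+1).
Proof.
elim=> {f} [f f0|f c w h sw gw rc _ IH fE].
  by apply: span0; apply: eventually_shift f0.
have sY : span j (fun n => Y w n.+1).
  case: w sw gw {fE} => t l sw gw.
  apply: (span_ext _ (spanD (spanW (ltnW sw) (Y_step gw)) (spanZc (sg t) (spanY sw gw)))) => n.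
  by rewrite subrK.
apply: (span_geq _ (spanD (spanZ (ratl_shift ch0 rc) sY) IH)).
by apply: geq_sym; apply: eventually_shift fE.
Qed.

(** The coefficients of the longest sums are separated from the rest. They vanish outside [X], so
    that the sum may later be taken over a larger list. *)
Lemma span_split j f : span j.+1 f -> exists (X : seq (bool * seq nat)) (phi : bool * seq nat -> nat -> k),
  [/\ uniq X, forall w, w \in X -> size w.2 = j /\ good w, forall w, ratl (phi w),
      forall w n, w \notin X -> phi w n = 0
    & span j (fun n => f n - \sum_(w <- X) phi w n * Y w n)].
Proof.
elim=> {f} [f f0|f c w0 h sw gw rc _ [X [phi [uX XP rphi phi0 sh]]] fE].
  exists [::], (fun _ _ => 0); split=> // [w|]; first exact: ratl_cst.
  by apply: span0; apply: eventually_mono f0 => n ->; rewrite big_nil subr0.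
move: sw; rewrite ltnS leq_eqVlt => /orP [/eqP sw|sw]; last first.
  exists X, phi; split=> //; apply: (spanS sw gw rc sh).
  by apply: eventually_mono fE => n ->; rewrite addrA.
exists (if w0 \in X then X else w0 :: X), (fun w n => phi w n + (if w == w0 then c n else 0)).
split.
- by case: ifP => //= w0X; rewrite w0X.
- by move=> w; case: ifP => _; rewrite ?in_cons; [exact: XP|case/orP=> [/eqP -> //|/XP]].
- by move=> w; case: eqP => _; apply: ratlD => //; apply: ratl_cst.
- move=> w n; case: ifP => w0X; rewrite ?in_cons ?negb_or.
    move=> wX; rewrite phi0 // add0r; case: eqP => // e; by rewrite e w0X in wX.
  by case/andP=> /negbTE -> wX; rewrite phi0 // addr0.
apply: (span_geq _ sh); apply: eventually_mono fE => n ->.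
have -> : \sum_(w <- if w0 \in X then X else w0 :: X) (phi w n + (if w == w0 then c n else 0)) * Y w n
   = c n * Y w0 n + \sum_(w <- X) phi w n * Y w n.
  have S : \sum_(w <- X) (if w == w0 then c n else 0) * Y w n = if w0 \in X then c n * Y w0 n else 0.
    have [w0X|w0X] := boolP (w0 \in X).
      rewrite (big_rem w0) //= eqxx big1_seq ?addr0 // => w /=.
      by rewrite mem_rem_uniq // inE => /andP [/negbTE -> _]; rewrite mul0r.
    rewrite big1_seq // => w /= wX; case: eqP => [e|_]; last by rewrite mul0r.
    by rewrite -e wX in w0X.
  have D (r : seq (bool * seq nat)) : \sum_(w <- r) (phi w n + (if w == w0 then c n else 0)) * Y w n =
     \sum_(w <- r) phi w n * Y w n + \sum_(w <- r) (if w == w0 then c n else 0) * Y w n.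
    by rewrite -big_split; apply: eq_bigr => w _; rewrite mulrDl.
  rewrite D; case: ifP S => w0X S; first by rewrite S addrC.
  by rewrite !big_cons S eqxx phi0 ?w0X // mul0r add0r addr0 addrC.
by rewrite opprD addrACA subrr add0r.
Qed.

(* In a relation with the fewest terms, normalized to have a coefficient 1, the
   difference of the relation and its shift shows that the other coefficients
   are constant. *)
Lemma minimal_relation j (I : eqType) (X : seq I) (Z : I -> nat -> k) (s : I -> bool)
    (phi : I -> nat -> k) : uniq X ->
  (forall i, i \in X -> span j (fun n => Z i n.+1 - sg (s i) * Z i n)) ->
  (forall i, ratl (phi i)) -> span j (fun n => \sum_(i <- X) phi i n * Z i n) ->
  (exists2 i, i \in X & ~ geq (phi i) (fun=> 0)) ->
  exists (t : bool) (c : I -> k), [/\ exists2 i, i \in X & c i != 0,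
    forall i, c i != 0 -> s i = t & span j (fun n => \sum_(i <- X) c i * Z i n)].
Proof.
elim: X phi => [|x X IH] phi; first by move=> _ _ _ _ [].
move=> /andP [xX uX] ZX rphi srel nz.
have ZX' i : i \in X -> span j (fun n => Z i n.+1 - sg (s i) * Z i n).
  by move=> iX; apply: ZX; rewrite in_cons iX orbT.
have lift (psi : I -> nat -> k) : (forall i, ratl (psi i)) ->
    span j (fun n => \sum_(i <- X) psi i n * Z i n) ->
    (exists2 i, i \in X & ~ geq (psi i) (fun=> 0)) ->
    exists (t : bool) (c : I -> k), [/\ exists2 i, i \in x :: X & c i != 0,
      forall i, c i != 0 -> s i = t & span j (fun n => \sum_(i <- x :: X) c i * Z i n)].
  move=> rpsi spsi nzpsi; have [t [c [[i iX ci] ct sc]]] := IH psi uX ZX' rpsi spsi nzpsi.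
  exists t, (fun i => if i == x then 0 else c i); split.
  - exists i; first by rewrite in_cons iX orbT.
    by case: (i =P x) => // e; rewrite -e iX in xX.
  - by move=> i'; case: (i' =P x) => _; [rewrite eqxx|exact: ct].
  apply: (span_ext _ sc) => n; rewrite big_cons eqxx mul0r add0r.
  by apply: eq_big_seq => i' i'X; case: (i' =P x) => // e; rewrite -e i'X in xX.
have [x0|x0] := ratl_dichotomy ch0 (rphi x).
  apply: (lift phi) => //.
    apply: (span_geq _ srel); apply: eventually_mono x0 => n e.
    by rewrite big_cons e mul0r add0r.
  case: nz => i; rewrite in_cons => /orP [/eqP -> //|iX] ni; by exists i.
pose psi i n := phi i n / phi x n.
have rpsi i : ratl (psi i) by apply: ratlM => //; apply: ratlV.
have srel2 : span j (fun n => Z x n + \sum_(i <- X) psi i n * Z i n).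
  apply: (span_geq _ (spanZ (ratlV (rphi x)) srel)); apply: eventually_mono x0 => n xn.
  rewrite big_cons mulrDr mulrA mulVf // mul1r mulr_sumr; congr (_ + _).
  by apply: eq_bigr => i _; rewrite mulrA (mulrC _^-1).
(* The coefficients of the shifted relation minus [sg (s x)] times the relation. The term of x
   cancels, so the new relation is shorter. *)
pose chi i n := sg (s i) * psi i n.+1 - sg (s x) * psi i n.
have rchi i : ratl (chi i).
  exact: ratlD (ratlM (ratl_cst _) (ratl_shift ch0 (rpsi i))) (ratlN (ratlM (ratl_cst _) (rpsi i))).
have srel3 : span j (fun n => \sum_(i <- X) chi i n * Z i n).
  have s1 := spanB (span_shift srel2) (spanZc (sg (s x)) srel2).
  have s2 : span j (fun n => \sum_(i <- X) psi i n.+1 * (Z i n.+1 - sg (s i) * Z i n)).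
    apply: span_sum => i iX; apply: spanZ; last exact: ZX'.
    exact: ratl_shift.
  have s3 := spanB (spanB s1 (ZX x (mem_head _ _))) s2.
  apply: (span_ext _ s3) => n.
  rewrite mulrDr opprD addrACA [X in X - _]addrAC subrr add0r mulr_sumr -!sumrB.
  by apply: eq_bigr => i _; rewrite /chi; ring.
have [[i iX ni]|all0] := pselect (exists2 i, i \in X & ~ geq (chi i) (fun=> 0)).
  by apply: (lift chi) => //; exists i.
have {}all0 i : i \in X -> geq (chi i) (fun=> 0).
  by move=> iX; apply: contrapT => ni; apply: all0; exists i.
(* A vanishing [chi i] makes [psi i] eventually constant when [s i = s x], and alternating, hence
   zero, otherwise. *)
have cst i : exists c : k, i \in X -> geq (psi i) (fun=> c) /\ (c != 0 -> s i = s x).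
  have [iX|] := boolP (i \in X); last by exists 0.
  have H : eventually (fun n => psi i n.+1 = (if s i == s x then 1 else -1) * psi i n).
    apply: eventually_mono (all0 i iX) => n /eqP; rewrite /chi subr_eq0 => /eqP.
    case: (s i); case: (s x); rewrite /= ?mul1r ?mulN1r //; first by move=> <-; rewrite opprK.
    by move=> /oppr_inj ->.
  have [e|e] := eqVneq (s i) (s x).
    move: H; rewrite e eqxx => - [N HN]; exists (psi i N) => _; split=> //.
    exists N => n /subnK <-; elim: (n - N)%N => [|d IHd] //.
    by rewrite addSn HN ?leq_addl // mul1r.
  exists 0 => _; split; last by rewrite eqxx.
  apply: (ratl_alternating ch0) => //; apply: eventually_mono H => n ->.
  by rewrite (negbTE e) mulN1r.
have [c cP] := choice cst.
exists (s x), (fun i => if i == x then 1 else if i \in X then c i else 0); split.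
- by exists x; rewrite ?mem_head // eqxx oner_neq0.
- move=> i; case: (i =P x) => [-> //|_]; case: ifP => [iX ci|_]; last by rewrite eqxx.
  by have [_ ->] := cP i iX.
apply: (span_geq _ srel2).
have ev : eventually (fun n => forall i, i \in X -> psi i n = c i).
  clear -cP; elim: X cP => [|y X IH] cP; first by exists 0%N.
  have [e1 _] := cP y (mem_head _ _).
  have e2 : eventually (fun n => forall i, i \in X -> psi i n = c i).
    by apply: IH => i iX; apply: cP; rewrite in_cons iX orbT.
  apply: eventually_mono (eventually_and e1 e2) => n [h1 h2] i.
  by rewrite in_cons => /orP [/eqP ->|/h2].
apply: eventually_mono ev => n H; rewrite big_cons eqxx mul1r; congr (_ + _).
apply: eq_big_seq => i iX; rewrite iX H //; case: (i =P x) => // e.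
by rewrite -e iX in xX.
Qed.

Definition tailw (w : bool * seq nat) := (~~ w.1, behead w.2).
Definition headw (w : bool * seq nat) := head 0%N w.2.

Definition independent_level j := forall (X : seq (bool * seq nat)) (phi : bool * seq nat -> nat -> k),
  uniq X -> (forall w, w \in X -> size w.2 = j /\ good w) -> (forall w, ratl (phi w)) ->
  span j (fun n => \sum_(w <- X) phi w n * Y w n) -> forall w, w \in X -> geq (phi w) (fun=> 0).

Lemma span_zero f : span 0 f -> geq f (fun=> 0).
Proof. by case. Qed.

Lemma independent_level0 (t : bool) (X : seq (bool * seq nat)) (c : bool * seq nat -> k) :
  uniq X -> (forall w, w \in X -> size w.2 = 0%N) -> (forall w, c w != 0 -> w.1 = t) ->
  span 0 (fun n => \sum_(w <- X) c w * Y w n) -> forall w, w \in X -> c w = 0.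
Proof.
move=> uX X0 ct /span_zero [N HN] w wX; apply/eqP; apply: contraT => cw.
have [M HM] := isum_nil_neq0 t; pose n := maxn N M.
have := HN n (leq_maxl _ _); rewrite (big_rem w) //= big1_seq ?addr0.
  case: w wX cw => [t' l] wX cw; have /= t't := ct _ cw; have /size0nil /= l0 := X0 _ wX.
  subst t' l => /eqP; rewrite mulf_eq0 (negbTE cw) /= => /eqP e.
  by have := HM n (leq_maxr _ _); rewrite [isum _ _ _]e eqxx.
move=> w' /=; rewrite mem_rem_uniq // inE => /andP [w'w w'X].
have [->|cw'] := eqVneq (c w') 0; first by rewrite mul0r.
case/eqP: w'w; rewrite (surjective_pairing w) (surjective_pairing w').
by rewrite (ct _ cw) (ct _ cw') (size0nil (X0 _ wX)) (size0nil (X0 _ w'X)).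
Qed.

(* The shift of a relation with constant coefficients c between words of length
   j + 1 is a relation between their tails.  By induction it is trivial, which
   gives F(n+1) + F(n) = p(dd n) with F rational and the coefficients of p
   proportional to those c with a given tail. *)
Theorem Y_independent j : independent_level j.
Proof.
elim: j => [|j IH] X phi uX XP rphi rel w0 w0X; apply: contrapT => nw0.
  have [t [c [[w wX cw] ct sc]]] : exists (t : bool) (c : bool * seq nat -> k),
      [/\ exists2 i, i \in X & c i != 0, forall i, c i != 0 -> i.1 = t
        & span 0 (fun n => \sum_(i <- X) c i * Y i n)].
    apply: (minimal_relation uX _ rphi rel); last by exists w0.
    by move=> [t l] /XP [/= /size0nil -> _]; apply: (@Y_step t [::]).
  have X0 w' : w' \in X -> size w'.2 = 0%N by case/XP.
  by have /eqP := independent_level0 uX X0 ct sc wX; rewrite (negbTE cw).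
have [t [c [[w wX cw] ct sc]]] : exists (t : bool) (c : bool * seq nat -> k),
    [/\ exists2 i, i \in X & c i != 0, forall i, c i != 0 -> i.1 = t
      & span j.+1 (fun n => \sum_(i <- X) c i * Y i n)].
  apply: (minimal_relation uX _ rphi rel); last by exists w0.
  by move=> [t l] /XP [/= <- gl]; apply: Y_step.
have [X1 [psi [uX1 X1P rpsi psi0 sX1]]] := span_split sc.
have tw : w.1 = t by apply: ct.
have XE w' : w' \in X -> w' = (w'.1, headw w' :: behead w'.2) /\ size (behead w'.2) = j.
  by case: w' => t' [|e l] /XP [] //= [<-] _.
pose xs := tailw w.
pose X2 := undup (X1 ++ [seq tailw w' | w' <- X]).
have xsX2 : xs \in X2 by rewrite mem_undup mem_cat map_f ?orbT.
have X2P x : x \in X2 -> size x.2 = j /\ good x.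
  rewrite mem_undup mem_cat => /orP [/X1P //|/mapP [w' w'X ->]].
  by case: w' w'X => t' [|e l] /XP [] //= [<-] /andP [].
(* Shifting the relation and subtracting [sg t] times it turns, up to shorter sums, each
   [c w' * Y w'] into [a w'] times the sum of the tail of w', and each [psi x * Y x] into
   [b x * Y x]. *)
pose a (w' : bool * seq nat) n := c w' * sg t * (dd k n ^+ headw w' - dd k n.+1 ^+ headw w').
have ra w' : ratl (a w').
  apply: ratlM; first exact: ratl_cst.
  exact: ratlD (ratl_ddX _) (ratlN (ratl_shift ch0 (ratl_ddX _))).
pose b (x : bool * seq nat) n := sg x.1 * psi x n.+1 - sg t * psi x n.
have rb x : ratl (b x).
  exact: ratlD (ratlM (ratl_cst _) (ratl_shift ch0 (rpsi x))) (ratlN (ratlM (ratl_cst _) (rpsi x))).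
pose chi (x : bool * seq nat) n := \sum_(w' <- X | tailw w' == x) a w' n - b x n.
have rchi x : ratl (chi x).
  apply: (ratl_geq _ (ratlD ch0 (ratl_sum ch0 (filter (fun w' => tailw w' == x) X) ra) (ratlN (rb x)))).
  by apply: geq_refl => n; rewrite big_filter.
have schi : span j (fun n => \sum_(x <- X2) chi x n * Y x n).
  have s1 := spanB (span_shift sX1) (spanZc (sg t) sX1).
  have s2 : span j (fun n => \sum_(w' <- X) c w' * (Y w' n.+1 - sg t * Y w' n
      - sg t * (dd k n ^+ headw w' - dd k n.+1 ^+ headw w') * Y (tailw w') n)).
    apply: span_sum => w' w'X; have [c0|c0] := eqVneq (c w') 0.
      by apply: span0; apply: geq_refl => n; rewrite c0 mul0r.
    apply: spanZc; have [w'E sj] := XE _ w'X; have [_ gw'] := XP _ w'X.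
    have tw' := ct _ c0; rewrite /tailw /headw; move: gw' sj; rewrite w'E tw' /= => gw' <-.
    by apply: Y_step2; case/andP: gw'.
  have s3 : span j (fun n => \sum_(x <- X1) psi x n.+1 * (Y x n.+1 - sg x.1 * Y x n)).
    apply: span_sum => -[t' l] xX1; have [/= sl gl] := X1P _ xX1.
    by rewrite -sl; apply: spanZ; [apply: ratl_shift|apply: Y_step].
  have s4 := spanD (spanB s1 s2) s3; apply: (span_ext _ s4) => n.
  have E1 : \sum_(w' <- X) c w' * (Y w' n.+1 - sg t * Y w' n
      - sg t * (dd k n ^+ headw w' - dd k n.+1 ^+ headw w') * Y (tailw w') n) =
     \sum_(w' <- X) c w' * Y w' n.+1 - sg t * (\sum_(w' <- X) c w' * Y w' n)
     - \sum_(w' <- X) a w' n * Y (tailw w') n.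
    rewrite mulr_sumr -!sumrB; apply: eq_bigr => w' _; rewrite /a; ring.
  have E2 : \sum_(x <- X1) psi x n.+1 * (Y x n.+1 - sg x.1 * Y x n) =
     \sum_(x <- X1) psi x n.+1 * Y x n.+1 - sg t * (\sum_(x <- X1) psi x n * Y x n)
     - \sum_(x <- X1) b x n * Y x n.
    rewrite mulr_sumr -!sumrB; apply: eq_bigr => x _; rewrite /b; ring.
  have E3 : \sum_(x <- X2) chi x n * Y x n =
     \sum_(w' <- X) a w' n * Y (tailw w') n - \sum_(x <- X1) b x n * Y x n.
    rewrite (eq_bigr (fun x => (\sum_(w' <- X | tailw w' == x) a w' n) * Y x n - b x n * Y x n)); last first.
      by move=> x _; rewrite mulrBl.
    rewrite sumrB; congr (_ - _).
      rewrite (eq_bigr (fun x => \sum_(w' <- X) if tailw w' == x then a w' n * Y x n else 0)); last first.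
        by move=> x _; rewrite mulr_suml -big_mkcond.
      rewrite exchange_big /=; apply: eq_big_seq => w' w'X.
      rewrite -big_mkcond /= (big_rem (tailw w')) /=; last by rewrite mem_undup mem_cat map_f ?orbT.
      rewrite eqxx big1_seq ?addr0 // => x /andP [/eqP <-].
      by rewrite mem_rem_uniq ?undup_uniq // inE eqxx.
    rewrite /X2 -[RHS]addr0 (bigID (mem X1)) /=; congr (_ + _).
      rewrite -big_filter; apply: perm_big; apply: uniq_perm => //.
        by rewrite filter_uniq ?undup_uniq.
      by move=> x; rewrite mem_filter mem_undup mem_cat; case: (x \in X1).
    by rewrite big1 // => x xX1; rewrite /b !psi0 // !mulr0 subrr mul0r.
  rewrite E1 E2 E3; ring.
have H : geq (chi xs) (fun=> 0) := IH X2 chi (undup_uniq _) X2P rchi schi xs xsX2.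
(* Let A and B be the sums of [c w' * dd ^+ headw w'] at n and at n + 1. The vanishing of [chi xs]
   reads [psi(n+1) + psi(n) = B - A]. For [F], which is psi minus this sum, the left side becomes
   -2A, a polynomial in [dd n]. *)
pose p : {poly k} := \sum_(w' <- X | tailw w' == xs) (- (2%:R * c w')) *: 'X^(headw w').
pose F n := psi xs n - \sum_(w' <- X | tailw w' == xs) c w' * dd k n ^+ headw w'.
have rF : ratl F.
  apply: ratlD => //; apply: ratlN.
  have rw w' : ratl (fun n => c w' * dd k n ^+ headw w') := ratlM (ratl_cst _) (ratl_ddX _).
  apply: (ratl_geq _ (ratl_sum ch0 (filter (fun w' => tailw w' == xs) X) rw)).
  by apply: geq_refl => n; rewrite big_filter.
have Fp : eventually (fun n => F n.+1 + F n = p.[dd k n]).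
  apply: eventually_mono H => n; rewrite /chi /b /xs /= sgN tw -/xs => /eqP.
  have -> : \sum_(w' <- X | tailw w' == xs) a w' n = sg t *
     (\sum_(w' <- X | tailw w' == xs) c w' * dd k n ^+ headw w' -
      \sum_(w' <- X | tailw w' == xs) c w' * dd k n.+1 ^+ headw w').
    by rewrite -sumrB mulr_sumr; apply: eq_bigr => w' _; rewrite /a; ring.
  have -> : p.[dd k n] = - (2%:R * \sum_(w' <- X | tailw w' == xs) c w' * dd k n ^+ headw w').
    rewrite /p horner_sum mulr_sumr -sumrN; apply: eq_bigr => w' _.
    by rewrite hornerZ hornerXn mulNr mulrA.
  rewrite /F; set A := \sum_(w' <- X | _) _; set B := \sum_(w' <- X | _) _.
  set f1 := psi xs n.+1; set f0 := psi xs n => /eqP e.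
  have : sg t * (sg t * (A - B) - (- sg t * f1 - sg t * f0)) = 0 by rewrite e mulr0.
  have -> : sg t * (sg t * (A - B) - (- sg t * f1 - sg t * f0)) = (sg t * sg t) * (A - B + f1 + f0) by ring.
  rewrite sg_sqr mul1r => e2; apply/eqP; rewrite -subr_eq0 -e2; apply/eqP; ring.
have sp := total_sum_no_pole ch0 rF Fp.
have := congr1 (fun q : {poly k} => q`_(headw w)) (size1_polyC sp).
have [wE _] := XE _ wX; have [_ gw] := XP _ wX.
have hw : (0 < headw w)%N by move: gw; rewrite wE /good /= => /andP [].
(* Words with the same tail and the same head coincide, so the coefficient of p at the positive
   exponent [headw w] is [-2 c w]. It must vanish because p is constant. *)
rewrite coefC gtn_eqF //= /p coef_sum big_mkcond (big_rem w wX) /= eqxx.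
rewrite big1_seq ?addr0.
  rewrite coefZ coefXn eqxx mulr1 => /eqP; rewrite oppr_eq0 mulf_eq0 (negbTE cw) orbF.
  by rewrite (natr_eq0 ch0).
move=> w' /=; rewrite mem_rem_uniq // inE => /andP [w'w w'X].
case: eqP => // tE; rewrite coefZ coefXn; case: eqP => [hE|_]; last by rewrite mulr0.
case/eqP: w'w; have [-> _] := XE _ w'X; rewrite wE -hE.
case: tE => e1 ->; congr (_, _).
by apply: (can_inj negbK).
Qed.

End IteratedSums.

(** * Words as operators on sequences *)

Definition enc_S (x : nat * seq nat * nat) : nat * seq nat * nat :=
  let: (i, l, r) := x in if l is [::] then (0%N, [::], r.+1) else (i.+1, l, r).
Definition enc_T (x : nat * seq nat * nat) : nat * seq nat * nat :=
  let: (i, l, r) := x in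
  if l is j :: l' then if i == 0%N then (0%N, j.+1 :: l', r) else (0%N, [:: 1, i & l], r)
  else (0%N, [:: 1%N], r).

(* (i, l, r) encodes the word S^i T^(l_1) S^(l_2) T^(l_3) ... S^r, with r
   counting all the letters of a power of S. *)
Definition enc (w : seq bool) : nat * seq nat * nat :=
  foldr (fun b : bool => if b then enc_T else enc_S) (0%N, [::], 0%N) w.

Fixpoint runs (b : bool) (l : seq nat) : seq bool :=
  if l is j :: l' then nseq j b ++ runs (~~ b) l' else [::].
Definition dec (x : nat * seq nat * nat) : seq bool :=
  let: (i, l, r) := x in nseq i false ++ runs true l ++ nseq r false.

Lemma enc_inv w : let: (i, l, r) := enc w in (l = [::] -> i = 0%N) /\ all (leq 1) l.
Proof.
elim: w => //= b w; case: (enc w) => [[i l] r] [H pl]; case: b => /=.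
  case: l H pl => [|j l] H pl //=; case: eqP => [_|/eqP i0] /=; split=> //.
    by case/andP: pl.
  by rewrite lt0n i0.
by case: l H pl.
Qed.

Lemma encK : cancel enc dec.
Proof.
elim=> // b w IH /=; have := enc_inv w; move: IH; case: (enc w) => [[i l] r] /= E [H _].
case: b => /=; case: l E H => [|j l] E H /=; rewrite -[in RHS]E //=.
- by rewrite H.
- by case: (i =P 0%N) => [->|_] //=; rewrite -!catA.
by rewrite H.
Qed.

Section Sequences.
Variable k : fieldType.
Hypothesis ch0 : [pchar k] =i pred0.
Implicit Types f g : nat -> k.
Local Notation gop := (@gop k).

(** [S - 2] and, below, [T - 2] acting on a polynomial in X through its sequence of even
    coefficients. *)
Definition seqS f n : k := dd k n * f n.
Definition seqT f : nat -> k := gop (-1) (seqS (gop 1 f)).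
Definition seq_word (w : seq bool) f : nat -> k :=
  foldr (fun b : bool => if b then seqT else seqS) f w.

Lemma gopZ s (a : k) f n : gop s (fun n => a * f n) n = a * gop s f n.
Proof. by elim: n => //= n ->; ring. Qed.

Lemma gopK f n : gop 1 (gop (-1) f) n = f n.
Proof. by elim: n => // n IH; rewrite gopS IH gopS; ring. Qed.

Definition word_value (m : nat) (x : nat * seq nat * nat) (n : nat) : k :=
  let: (i, l, r) := x in
  dd k m ^+ r * (if l is [::] then pulse k m n else dd k n ^+ i * isum k m false l n).

(** Inside a power of T the inner factors [gop 1] and [gop (-1)] cancel and leave a power of [dd].
    The final power of S meets only the index m, whence the factor [dd k m ^+ r]. *)
Lemma seq_wordE m w n : seq_word w (pulse k m) n = word_value m (enc w) n.
Proof.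
move: n; suff E : seq_word w (pulse k m) = word_value m (enc w) by move=> n; rewrite E.
elim: w => [|b w IH]; first by apply/funext => n; rewrite /= mul1r.
have := enc_inv w; rewrite /= IH; case: (enc w) => [[i l] r] [H _]; apply/funext => n.
case: b; rewrite /= /seqT /seqS.
  case: l H => [|j l] H.
    have -> : (fun n => dd k n * gop 1 (word_value m (i, [::], r)) n) =
        (fun n => dd k m ^+ r * (dd k n ^+ 1 * gop 1 (pulse k m) n)).
      apply/funext => n'; rewrite expr1 mulrCA; congr (_ * _).
      by rewrite -gopZ.
    by rewrite gopZ /= expr0 mul1r.
  case: eqP => i0.
    have -> : (fun n => dd k n * gop 1 (word_value m (i, j :: l, r)) n) =
        (fun n => dd k m ^+ r * (dd k n ^+ j.+1 * isum k m true l n)).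
      apply/funext => n'; rewrite /word_value i0.
      have -> : (fun n => dd k m ^+ r * (dd k n ^+ 0 * isum k m false (j :: l) n)) =
         (fun n => dd k m ^+ r * isum k m false (j :: l) n).
        by apply/funext => n2; rewrite expr0 mul1r.
      by rewrite gopZ /= gopK exprS; ring.
    by rewrite gopZ /= expr0 mul1r.
  have -> : (fun n => dd k n * gop 1 (word_value m (i, j :: l, r)) n) =
      (fun n => dd k m ^+ r * (dd k n ^+ 1 * isum k m true [:: i, j & l] n)).
    by apply/funext => n'; rewrite expr1 mulrCA; congr (_ * _); rewrite /word_value gopZ.
  by rewrite gopZ /= expr0 mul1r.
case: l H => [|j l] H /=; last by rewrite exprS; ring.
rewrite /pulse; case: eqP => [->|_]; last by rewrite !mulr0.
by rewrite exprS !mulr1.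
Qed.

Lemma poly_zero_dd (p : {poly k}) (N : nat) :
  (forall n, (N <= n)%N -> p.[dd k n] = 0) -> p = 0.
Proof.
move=> H; apply/eqP; apply: contraT => p0.
pose s := [seq dd k n | n <- iota N (size p)].
have us : uniq s by rewrite map_inj_uniq ?iota_uniq //; apply: dd_inj.
have rs : all (root p) s.
  by apply/allP => x /mapP [n]; rewrite mem_iota => /andP [Nn _] ->; apply/rootP/H.
by have := max_poly_roots p0 rs us; rewrite size_map size_iota ltnn.
Qed.

(** Downward induction on the number of runs. Independence modulo shorter sums isolates the words
    with a given list l. What is left is a polynomial in [dd n], which separates the exponents i,
    whose coefficients are polynomials in [dd m], which separate the exponents r. *)
Theorem seq_words_free (ws : seq (seq bool)) (c : seq bool -> k) (m1 : nat) : uniq ws ->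
  (forall m n, (m1 <= m)%N -> \sum_(w <- ws) c w * seq_word w (pulse k m) n = 0) ->
  forall w, w \in ws -> c w = 0.
Proof.
move=> uws rel.
pose i_ w := (enc w).1.1; pose l_ w := (enc w).1.2; pose r_ w := (enc w).2.
have encE w : enc w = (i_ w, l_ w, r_ w) by rewrite /i_ /l_ /r_; case: (enc w) => [[]].
have enc_inj w w' : i_ w = i_ w' -> l_ w = l_ w' -> r_ w = r_ w' -> w = w'.
  by move=> e1 e2 e3; rewrite -(encK w) -(encK w') !encE e1 e2 e3.
have pick_r (A : pred (seq bool)) : (forall m, (m1 <= m)%N -> \sum_(w <- ws | A w) c w * dd k m ^+ r_ w = 0) ->
    {in A &, injective r_} -> forall w, w \in ws -> A w -> c w = 0.
  move=> H inj w wws Aw; pose p : {poly k} := \sum_(w <- ws | A w) c w *: 'X^(r_ w).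
  have p0 : p = 0.
    apply: (@poly_zero_dd p m1) => m /H; rewrite /p horner_sum => e.
    by rewrite -[RHS]e; apply: eq_bigr => w' _; rewrite hornerZ hornerXn.
  have := congr1 (fun q : {poly k} => q`_(r_ w)) p0.
  rewrite coef0 /p coef_sum big_mkcond (big_rem w wws) /= Aw coefZ coefXn eqxx mulr1.
  rewrite big1_seq ?addr0 // => w' /=; rewrite mem_rem_uniq // inE => /andP [w'w _].
  case: ifP => // Aw'; rewrite coefZ coefXn; case: eqP => [e|_]; last by rewrite mulr0.
  by case/eqP: w'w; apply: inj.
(* Powers of S alone, with l empty, yield pulses and not iterated sums. They are treated last, by
   evaluation at n = m. *)
have level j : (0 < j)%N -> (forall w, w \in ws -> (j < size (l_ w))%N -> c w = 0) ->
    forall w, w \in ws -> size (l_ w) = j -> c w = 0.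
  move=> j0 H w wws wj.
  pose A := [pred w' | (l_ w' == l_ w) && (i_ w' == i_ w)].
  have Aw : A w by rewrite /= !eqxx.
  apply: (pick_r A _ _ w wws Aw) => [m mm|w1 w2 /andP [/eqP l1 /eqP i1] /andP [/eqP l2 /eqP i2] e]; last first.
    by apply: enc_inj => //; rewrite ?l1 ?i1.
  pose X := undup [seq (false, l_ w') | w' <- ws & size (l_ w') == j].
  pose phi (x : bool * seq nat) n := \sum_(w' <- ws | l_ w' == x.2) c w' * dd k m ^+ r_ w' * dd k n ^+ i_ w'.
  have rt w' : ratl (fun n => c w' * dd k m ^+ r_ w' * dd k n ^+ i_ w').
    by apply: ratlM; [apply: ratl_cst|apply: ratl_ddX].
  have rphi x : ratl (phi x).
    apply: (ratl_geq _ (ratl_sum ch0 (filter (fun w' => l_ w' == x.2) ws) rt)).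
    by apply: geq_refl => n; rewrite big_filter.
  have XP x : x \in X -> size x.2 = j /\ good x.
    rewrite mem_undup => /mapP [w']; rewrite mem_filter => /andP [/eqP sj _] -> /=.
    by split=> //; rewrite /good /=; have := enc_inv w'; rewrite encE => - [].
  have wX : (false, l_ w) \in X.
    by rewrite mem_undup; apply/mapP; exists w; rewrite // mem_filter wj eqxx.
  have sp : span m j (fun n => \sum_(x <- X) phi x n * Y k m x n).
    have low : span m j (fun n => \sum_(w' <- ws | (size (l_ w') < j)%N)
        c w' * word_value m (enc w') n).
      apply: (span_ext (f := fun n => \sum_(w' <- [seq w' <- ws | (size (l_ w') < j)%N])
        c w' * word_value m (enc w') n)) => [n|]; first by rewrite big_filter.
      apply: span_sum => w'; rewrite mem_filter => /andP [sj _]; apply: spanZc.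
      rewrite encE /word_value; apply: spanZc.
      case E : (l_ w') => [|e l].
        apply: span0; exists m.+1 => n mn; rewrite /pulse gtn_eqF //.
      rewrite -E; apply: spanZ; first exact: ratl_ddX.
      have gl : good (false, l_ w') by rewrite /good /=; have := enc_inv w'; rewrite encE => - [].
      have sY : span m j (Y k m (false, l_ w')) by apply: spanY.
      exact: sY.
    apply: (span_ext (f := fun n => - 1 * \sum_(w' <- ws | (size (l_ w') < j)%N)
        c w' * word_value m (enc w') n)); last exact: spanZc.
    move=> n; rewrite mulN1r; apply/eqP; rewrite eq_sym -subr_eq0 opprK; apply/eqP.
    rewrite -[RHS](rel m n mm) [RHS](bigID (fun w' => (size (l_ w') < j)%N)) /= addrC; congr (_ + _);
      last by apply: eq_bigr => w' _; rewrite seq_wordE.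
    rewrite (bigID (fun w' => size (l_ w') == j)) /= [X in _ = _ + X]big1_seq ?addr0; last first.
      move=> w' /andP [/andP [h1 h2] w'ws]; rewrite H ?mul0r //.
      by rewrite ltn_neqAle eq_sym h2 leqNgt.
    rewrite (eq_bigr (fun x => \sum_(w' <- ws | l_ w' == x.2)
       c w' * dd k m ^+ r_ w' * dd k n ^+ i_ w' * Y k m x n)); last first.
      by move=> x _; rewrite mulr_suml.
    under eq_bigr => x _ do rewrite big_mkcond.
    rewrite exchange_big /= [RHS]big_mkcond /=; apply: eq_big_seq => w' w'ws.
    rewrite -leqNgt; case: (eqVneq (size (l_ w')) j) => [sj|sj].
      rewrite sj leqnn /= seq_wordE encE (big_rem (false, l_ w')) /=; last first.
        by rewrite mem_undup; apply/mapP; exists w'; rewrite // mem_filter sj eqxx.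
      rewrite eqxx big1_seq ?addr0.
        by case: (l_ w') sj => [e|e l _]; [rewrite -e in j0|rewrite /Y /= !mulrA].
      move=> [t l] /=; rewrite mem_rem_uniq ?undup_uniq // inE => /andP [xn xX].
      case: eqP => // e; case/eqP: xn; rewrite e.
      by move: xX; rewrite mem_undup => /mapP [? _ [-> _]].
    rewrite andbF big1_seq // => x /XP [sx _]; case: eqP => // e.
    by rewrite e sx eqxx in sj.
  have [N HN] := Y_independent ch0 (undup_uniq _) XP rphi sp wX.
  pose p : {poly k} := \sum_(w' <- ws | l_ w' == l_ w) (c w' * dd k m ^+ r_ w') *: 'X^(i_ w').
  have p0 : p = 0.
    apply: (@poly_zero_dd p N) => n /HN; rewrite /phi /p horner_sum => e.
    by rewrite -[RHS]e; apply: eq_bigr => w' _; rewrite hornerZ hornerXn.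
  have := congr1 (fun q : {poly k} => q`_(i_ w)) p0; rewrite coef0 /p coef_sum => e.
  rewrite -[RHS]e [LHS]big_mkcond [RHS]big_mkcond /=; apply: eq_bigr => w' _.
  case: eqP => //= _; rewrite coefZ coefXn eq_sym.
  by case: eqP => _; rewrite ?mulr1 ?mulr0.
have high t w : w \in ws -> (0 < size (l_ w))%N -> (\max_(w' <- ws) size (l_ w') <= size (l_ w) + t)%N -> c w = 0.
  elim/ltn_ind: t w => t IH w wws w0 wt; apply: (level _ w0) => // w' w'ws lt.
  have le' : (size (l_ w') <= \max_(w' <- ws) size (l_ w'))%N by apply: leq_bigmax_seq.
  have t0 : (0 < t)%N.
    by rewrite lt0n; apply: contraTneq wt => ->; rewrite addn0 -ltnNge (leq_trans lt).
  apply: (IH t.-1) => //; first by rewrite prednK.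
  - exact: leq_ltn_trans (leq0n _) lt.
  apply: leq_trans wt _; rewrite -{1}(prednK t0) addnS -addSn leq_add2r //.
have high0 w : w \in ws -> (0 < size (l_ w))%N -> c w = 0.
  by move=> wws w0; apply: (high _ w wws w0); apply: leq_addl.
move=> w wws; case: (posnP (size (l_ w))) => [s0|]; last exact: high0.
have Aw : (fun w' => size (l_ w') == 0%N) w by rewrite /= s0.
apply: (pick_r (fun w' => size (l_ w') == 0%N) _ _ w wws Aw) => [m mm|w1 w2 s1 s2 e].
  rewrite -[RHS](rel m m mm) [LHS]big_mkcond; apply: eq_big_seq => w' w'ws.
  case: eqP => [/size0nil l0|/eqP]; last by rewrite -lt0n => /high0 ->; rewrite ?mul0r.
  by rewrite seq_wordE encE l0 /= /pulse eqxx mulr1.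
have {}s1 : l_ w1 = [::] by apply: size0nil; apply/eqP.
have {}s2 : l_ w2 = [::] by apply: size0nil; apply/eqP.
have iz x : l_ x = [::] -> i_ x = 0%N by move=> lx; have := enc_inv x; rewrite encE lx => - [->].
by apply: enc_inj; rewrite ?s1 ?s2 // !iz.
Qed.

End Sequences.

(** * Triangularity of the words *)

Section Triangular.
Variable k : fieldType.
Implicit Types f g : nat -> k.
Local Notation gop := (@gop k).

Lemma eq_gop s f g N : (forall n, (n <= N)%N -> f n = g n) -> gop s f N = gop s g N.
Proof.
elim: N => [|N IH] fg /=; first exact: fg.
by rewrite IH ?fg ?leqnn ?leqnSn // => n nN; apply: fg; apply: leqW.
Qed.

Lemma gopD s f g n : gop s (fun n => f n + g n) n = gop s f n + gop s g n.
Proof. by elim: n => //= n ->; ring. Qed.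

Lemma gopKn f n : gop (-1) (gop 1 f) n = f n.
Proof. by elim: n => // n IH; rewrite gopS IH gopS; ring. Qed.

Lemma eq_seq_word w f g N : (forall n, (n <= N)%N -> f n = g n) ->
  seq_word w f N = seq_word w g N.
Proof.
elim: w N => [|b w IH] N fg /=; first exact: fg.
have fgN n : (n <= N)%N -> seq_word w f n = seq_word w g n.
  by move=> nN; apply: IH => n' n'n; apply: fg; apply: leq_trans n'n nN.
case: b; last by rewrite /seqS fgN.
apply: eq_gop => n nN; rewrite /seqS; congr (_ * _); apply: eq_gop => n' n'n.
by apply: fgN; apply: leq_trans n'n nN.
Qed.

Lemma seq_word_lin w (a : k) f g n : seq_word w (fun n => a * f n + g n) n =
  a * seq_word w f n + seq_word w g n.
Proof.
elim: w n => //= b w IH n; case: b; last by rewrite /seqS IH; ring.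
have E n1 : gop 1 (seq_word w (fun n => a * f n + g n)) n1 =
    a * gop 1 (seq_word w f) n1 + gop 1 (seq_word w g) n1.
  by rewrite -gopZ -gopD; apply: eq_gop => n2 _; apply: IH.
rewrite /seqT -gopZ -gopD; apply: eq_gop => n1 _; rewrite /seqS E; ring.
Qed.

Lemma seq_word0 w n : seq_word w (fun=> 0) n = 0 :> k.
Proof.
have := seq_word_lin w (-1) (fun=> 0) (fun=> 0) n.
by rewrite mulr0 addr0 (mulN1r (seq_word _ _ _)) addNr.
Qed.

Lemma seq_word_sum w f (r : seq nat) N :
  seq_word w (fun n => \sum_(l <- r) f l * pulse k l n) N =
  \sum_(l <- r) f l * seq_word w (pulse k l) N.
Proof.
elim: r => [|l r IH].
  by rewrite big_nil -[RHS](seq_word0 w N); apply: eq_seq_word => n _; rewrite big_nil.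
rewrite big_cons -IH -seq_word_lin; apply: eq_seq_word => n _.
by rewrite big_cons.
Qed.

Lemma seq_word_triangular w f N :
  seq_word w f N = \sum_(l <- iota 0 N.+1) f l * seq_word w (pulse k l) N.
Proof.
rewrite -seq_word_sum; apply: eq_seq_word => n nN.
have ur := iota_uniq 0 N.+1; have nr : n \in iota 0 N.+1 by rewrite mem_iota.
move: (iota 0 N.+1) ur nr => r ur nr; rewrite (big_rem n) //= /pulse eqxx mulr1.
rewrite big1_seq ?addr0 // => l /=.
by rewrite mem_rem_uniq // inE => /andP [/negbTE ln _]; rewrite eq_sym ln mulr0.
Qed.

Lemma seq_word_above w l N : (N < l)%N -> seq_word w (pulse k l) N = 0.
Proof.
move=> Nl; rewrite -[RHS](seq_word0 w N); apply: eq_seq_word => n nN.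
by rewrite /pulse ltn_eqF // (leq_ltn_trans nN).
Qed.

(** At index m + d the relation for [F] involves only the pulses at l between m and m + d. For l > m
    the distance from l to this index is less than d, so these terms vanish by induction, and
    [F m != 0] leaves the pulse at m. *)
Lemma lowest_terms (ws : seq (seq bool)) (c : seq bool -> k) (i0 : nat) :
  (forall i, (i0 <= i)%N -> exists F : nat -> k, [/\ forall l, (l < i)%N -> F l = 0, F i != 0
     & forall n, \sum_(w <- ws) c w * seq_word w F n = 0]) ->
  forall m n, (i0 <= m)%N -> \sum_(w <- ws) c w * seq_word w (pulse k m) n = 0.
Proof.
move=> H m n; have [mn|nm] := leqP m n; last first.
  by move=> _; rewrite big1 // => w _; rewrite seq_word_above ?mulr0.
rewrite -(subnKC mn); move: (n - m)%N => d {n mn}; elim/ltn_ind: d m => d IH m mi.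
have [F [Flow Fm FW]] := H m mi; have := FW (m + d)%N.
rewrite (eq_bigr (fun w => \sum_(l <- iota 0 (m + d).+1) F l * (c w * seq_word w (pulse k l) (m + d)%N))); last first.
  by move=> w _; rewrite seq_word_triangular mulr_sumr; apply: eq_bigr => l _; rewrite mulrCA.
have ur := iota_uniq 0 (m + d).+1.
have rP l : (l \in iota 0 (m + d).+1) = (l <= m + d)%N by rewrite mem_iota add0n ltnS.
move: (iota _ _) ur rP => r ur rP.
rewrite exchange_big /= (big_rem m) /=; last by rewrite rP leq_addr.
rewrite [X in _ + X]big1_seq ?addr0 => [e|l /=].
  by move: e => /eqP; rewrite -mulr_sumr mulf_eq0 (negbTE Fm) => /eqP.
rewrite mem_rem_uniq // inE rP => /andP [lm ld].
rewrite -mulr_sumr; have [lm'|ml] := ltnP l m; first by rewrite Flow ?mul0r.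
have {lm}ml : (m < l)%N by rewrite ltn_neqAle eq_sym lm.
have -> : (m + d = l + (m + d - l))%N by rewrite subnKC.
rewrite IH ?mulr0 //; last by apply: leq_trans mi (ltnW ml).
by rewrite ltn_subLR // ltn_add2r.
Qed.

End Triangular.

(** * Fractions *)

Section Symbols.
Variables (k : fieldType) (U : algType k) (iu iv iw : U) (J : Type).
Variables (Fil : nat -> U -> Prop) (Th : J -> nat -> nat -> U -> {poly k}).
Hypothesis ch0 : [pchar k] =i pred0.
Hypothesis sc : symbol_calculus iu iv iw Fil Th.

Lemma ThD I m n y z : Th I m n (y + z) = Th I m n y + Th I m n z.
Proof. by have := sc_lin sc I m n 1 y z; rewrite !scale1r. Qed.
Lemma Th0 I m n : Th I m n 0 = 0.
Proof. by apply: (addIr (Th I m n 0)); rewrite -ThD !add0r. Qed.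
Lemma ThZ I m n c y : Th I m n (c *: y) = c *: Th I m n y.
Proof. by have := sc_lin sc I m n c y 0; rewrite Th0 !addr0. Qed.
Lemma FilD n y z : Fil n y -> Fil n z -> Fil n (y + z).
Proof. by move=> Fy Fz; have := sc_filP sc 1 Fy Fz; rewrite scale1r. Qed.
Lemma FilZ n c y : Fil n y -> Fil n (c *: y).
Proof.
by move=> Fy; have := sc_filP sc c Fy (sc_fil0 sc n); rewrite addr0.
Qed.

(** The identity concerns the component of degree n of y even when y has smaller weight or the image
    is 0, so sums and products need no case distinction. *)
Definition has_symbol (a : U) (e : nat) (A : {poly k} -> {poly k}) :=
  forall n y, Fil n y -> Fil (n + e)%N (a * y) /\
    forall I m, Th I m (n + e)%N (a * y) = A (Th I m n y).

Lemma has_symbolM a e A b e' B : has_symbol a e A -> has_symbol b e' B ->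
  has_symbol (a * b) (e' + e) (A \o B).
Proof.
move=> sa sb n y Fy; have [Fb Tb] := sb n y Fy; have [Fa Ta] := sa _ _ Fb.
by rewrite -mulrA addnA; split=> // I m; rewrite Ta Tb.
Qed.

Lemma has_symbolD a b e A B : has_symbol a e A -> has_symbol b e B ->
  has_symbol (a + b) e (fun f => A f + B f).
Proof.
move=> sa sb n y Fy; have [Fb Tb] := sb n y Fy; have [Fa Ta] := sa n y Fy.
by rewrite mulrDl; split=> [|I m]; [apply: FilD|rewrite ThD Ta Tb].
Qed.

Lemma has_symbolZ a e A c : has_symbol a e A -> has_symbol (c *: a) e (fun f => c *: A f).
Proof.
move=> sa n y Fy; have [Fa Ta] := sa n y Fy.
by rewrite -scalerAl; split=> [|I m]; [apply: FilZ|rewrite ThZ Ta].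
Qed.

Lemma has_symbolB a b e A B : has_symbol a e A -> has_symbol b e B ->
  has_symbol (a - b) e (fun f => A f - B f).
Proof.
move=> sa sb n y Fy.
have [F1 T1] := has_symbolD sa (has_symbolZ (-1) sb) Fy; rewrite scaleN1r in F1 T1.
by split=> // I m; rewrite T1 scaleN1r.
Qed.

Lemma symbol_u : has_symbol iu 2 (fun f => - f^`()). Proof. exact: (sc_u sc). Qed.
Lemma symbol_v : has_symbol iv 2 (fun f => 'X * f). Proof. exact: (sc_v sc). Qed.
Lemma symbol_w : has_symbol iw 4 id. Proof. exact: (sc_w sc). Qed.

Lemma has_symbol_neq0 a e A : has_symbol a e A -> (forall f, A f = 0 -> f = 0) -> a != 0.
Proof.
move=> sa inj; apply/eqP => a0.
have [n [_ F1 [I [i0 H]]]] := sc_lead sc (oner_neq0 U).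
have [m [_ /negP nz]] := H i0 (leqnn _); apply: nz.
have [_ /(_ I m)] := sa _ _ F1; rewrite a0 mul0r Th0 => /esym /inj ->.
by rewrite coef0.
Qed.

(** Degrees pass through inverses: if y had degree greater than N, the injective [A] would kill its
    nonzero symbol. *)
Lemma has_symbol_div a e A y N : has_symbol a e A -> (forall f, A f = 0 -> f = 0) ->
  Fil (N + e)%N (a * y) -> Fil N y.
Proof.
move=> sa inj Fay; have [->|y0] := eqVneq y 0; first exact: (sc_fil0 sc).
have [n [_ Fy [I [i0 H]]]] := sc_lead sc y0.
have [nN|Nn] := leqP n N; first exact: (sc_mono sc) Fy.
have [m [_ /negP nz]] := H i0 (leqnn _); case: nz.
have [_ /(_ I m)] := sa _ _ Fy; rewrite (sc_low sc I m Fay) ?ltn_add2r // => /esym /inj ->.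
by rewrite coef0.
Qed.

(** [lp] and [lm] are the eigenvalues of [V + w^3/3] and [V - w^3/3] on the i-th power of X, with w
    set to 1. *)
Definition lp (i : nat) : k := 3%:R^-1 - (i%:R + 2%:R^-1).
Definition lm (i : nat) : k := - 3%:R^-1 - (i%:R + 2%:R^-1).

Definition VU : U := (2%:R : k)^-1 *: (iw * (iu * iv + iv * iu) * iw).
Definition VmU : U := VU - (3%:R : k)^-1 *: iw ^+ 3.
Definition VpU : U := VU + (3%:R : k)^-1 *: iw ^+ 3.

Definition symbol_V (f : {poly k}) : {poly k} :=
  2%:R^-1 *: (- ('X * f)^`() + 'X * - f^`()).

Lemma symbol_VU : has_symbol VU 12 symbol_V.
Proof.
have suv := has_symbolD (has_symbolM symbol_u symbol_v) (has_symbolM symbol_v symbol_u).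
exact: has_symbolZ (has_symbolM (has_symbolM symbol_w suv) symbol_w).
Qed.

Lemma symbol_w3 : has_symbol (iw ^+ 3) 12 id.
Proof. exact: has_symbolM symbol_w (has_symbolM symbol_w symbol_w). Qed.

Lemma neq0_2 : 2%:R != 0 :> k. Proof. by rewrite natr_eq0. Qed.
Lemma neq0_3 : 3%:R != 0 :> k. Proof. by rewrite natr_eq0. Qed.

Lemma coef_symbol_V f i : (symbol_V f)`_i = - (i%:R + 2%:R^-1) * f`_i.
Proof.
have n2 := neq0_2.
have e1 : ('X * f)^`()`_i = (i%:R + 1) * f`_i.
  by rewrite coef_deriv coefXM /= natr1 mulr_natl.
have e2 : ('X * - f^`())`_i = - (i%:R * f`_i).
  rewrite coefXM; case: i {e1} => [|i] /=; first by rewrite mul0r oppr0.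
  by rewrite coefN coef_deriv mulr_natl.
rewrite /symbol_V coefZ coefD coefN e1 e2; move: (i%:R) (f`_i) => x y.
by field.
Qed.

Lemma lpE i : lp i = - ((6 * i + 1)%N%:R / 6%:R).
Proof.
have n2 := neq0_2; have n3 := neq0_3; have n6 : 6%:R != 0 :> k by rewrite natr_eq0.
rewrite /lp natrD (natrM _ 6); field; rewrite ?n2 ?n3 ?n6 //.
Qed.

Lemma lmE i : lm i = - ((6 * i + 5)%N%:R / 6%:R).
Proof.
have n2 := neq0_2; have n3 := neq0_3; have n6 : 6%:R != 0 :> k by rewrite natr_eq0.
rewrite /lm (natrD _ (6 * i)) (natrM _ 6); field; rewrite ?n2 ?n3 ?n6 //.
Qed.

Lemma lp_neq0 i : lp i != 0.
Proof. by rewrite lpE oppr_eq0 mulf_neq0 ?invr_eq0 ?natr_eq0 // addn_eq0 andbF. Qed.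
Lemma lm_neq0 i : lm i != 0.
Proof. by rewrite lmE oppr_eq0 mulf_neq0 ?invr_eq0 ?natr_eq0 // addn_eq0 andbF. Qed.

(** One has [a/b + b/a - 2 = (a - b)^2 / (a b)], where [lm - lp] is the constant -2/3. Clearing the
    denominators 6 of [lp] and [lm] gives the numerator 16. *)
Lemma eigenvalue_S n : lm n.*2 / lp n.*2 + lp n.*2 / lm n.*2 = dd k n + 2%:R.
Proof.
have n6 : 6%:R != 0 :> k by rewrite natr_eq0.
have e1 : (6 * n.*2 + 1 = 12 * n + 1)%N by rewrite -muln2; lia.
have e5 : (6 * n.*2 + 5 = 12 * n + 5)%N by rewrite -muln2; lia.
have a1 : (12 * n + 1)%N%:R != 0 :> k by rewrite natr_eq0 // addn_eq0 andbF.
have a5 : (12 * n + 5)%N%:R != 0 :> k by rewrite natr_eq0 // addn_eq0 andbF.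
rewrite lpE lmE /dd den_nat e1 e5 natrM.
rewrite natrD in a1; rewrite natrD in a5; rewrite !(natrD _ (12 * n)).
move: (12 * n)%N%:R a1 a5 => x a1 a5.
by field; rewrite !oppr_eq0 n6 a1 a5.
Qed.

Definition sym_p f := symbol_V f + 3%:R^-1 *: f.
Definition sym_m f := symbol_V f - 3%:R^-1 *: f.

Lemma symbol_Vp : has_symbol VpU 12 sym_p.
Proof. exact: has_symbolD symbol_VU (has_symbolZ _ symbol_w3). Qed.
Lemma symbol_Vm : has_symbol VmU 12 sym_m.
Proof. exact: has_symbolB symbol_VU (has_symbolZ _ symbol_w3). Qed.

Lemma coef_sym_p f i : (sym_p f)`_i = lp i * f`_i.
Proof. by rewrite /sym_p coefD coef_symbol_V coefZ /lp; ring. Qed.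
Lemma coef_sym_m f i : (sym_m f)`_i = lm i * f`_i.
Proof. by rewrite /sym_m coefB coef_symbol_V coefZ /lm; ring. Qed.

Lemma sym_p_inj f : sym_p f = 0 -> f = 0.
Proof.
move=> f0; apply/polyP => i; have := congr1 (fun g : {poly k} => g`_i) f0.
by rewrite coef_sym_p !coef0 => /eqP; rewrite mulf_eq0 (negbTE (lp_neq0 i)) => /eqP.
Qed.
Lemma sym_m_inj f : sym_m f = 0 -> f = 0.
Proof.
move=> f0; apply/polyP => i; have := congr1 (fun g : {poly k} => g`_i) f0.
by rewrite coef_sym_m !coef0 => /eqP; rewrite mulf_eq0 (negbTE (lm_neq0 i)) => /eqP.
Qed.

Definition sym_wp (f : {poly k}) := f + 'X * ('X * f).
Definition sym_wm (f : {poly k}) := f - 'X * ('X * f).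

Lemma symbol_wp : has_symbol (iw + iv ^+ 2) 4 sym_wp.
Proof. exact: has_symbolD symbol_w (has_symbolM symbol_v symbol_v). Qed.
Lemma symbol_wm : has_symbol (iw - iv ^+ 2) 4 sym_wm.
Proof. exact: has_symbolB symbol_w (has_symbolM symbol_v symbol_v). Qed.

Lemma sym_wp_inj f : sym_wp f = 0 -> f = 0.
Proof.
rewrite /sym_wp -{1}[f]mul1r mulrA -mulrDl => /eqP; rewrite mulf_eq0 => /orP [|/eqP //].
by move=> /eqP /(congr1 (fun g : {poly k} => g`_0)); rewrite coefD coefXM coef1 coef0 addr0 => /eqP; rewrite oner_eq0.
Qed.
Lemma sym_wm_inj f : sym_wm f = 0 -> f = 0.
Proof.
rewrite /sym_wm -{1}[f]mul1r mulrA -mulrBl => /eqP; rewrite mulf_eq0 => /orP [|/eqP //].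
by move=> /eqP /(congr1 (fun g : {poly k} => g`_0)); rewrite coefB coefXM coef1 coef0 subr0 => /eqP; rewrite oner_eq0.
Qed.

Definition evens (f : {poly k}) (n : nat) : k := f`_(n.*2).

Lemma evens_XX f n : evens ('X * ('X * f)) n = if n is n'.+1 then evens f n' else 0.
Proof. by rewrite /evens; case: n => [|n]; rewrite ?doubleS coefXM //= coefXM. Qed.

Lemma evens_wp f n : evens (sym_wp f) n = evens f n + if n is n'.+1 then evens f n' else 0.
Proof. by rewrite -evens_XX /evens coefD. Qed.
Lemma evens_wm f n : evens (sym_wm f) n = evens f n - if n is n'.+1 then evens f n' else 0.
Proof. by rewrite -evens_XX /evens coefB. Qed.

Lemma evens_wp_div f n : evens (sym_wp f) n = gop 1 (evens (sym_wm f)) n.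
Proof.
elim: n => [|n IH]; first by rewrite /= evens_wp evens_wm addr0 subr0.
rewrite gopS -IH !evens_wp !evens_wm; case: n {IH} => [|n]; ring.
Qed.

Lemma evens_wm_div f g n : sym_wp f = sym_wm g -> evens f n = gop (-1) (evens g) n.
Proof.
move=> e; have E n' : evens f n' + (if n' is n''.+1 then evens f n'' else 0) =
    evens g n' - (if n' is n''.+1 then evens g n'' else 0).
  by rewrite -evens_wp -evens_wm e.
elim: n => [|n IH]; first by have := E 0%N; rewrite addr0 subr0.
by rewrite gopS -IH; have := E n.+1; move=> /(canRL (addrK _)) ->; ring.
Qed.

(* y1, y2 stand for Vp^-1 y and Vm^-1 Vp y, so that VmU * y1 + y2 is S y. *)
Lemma S_step N y y1 y2 : VpU * y1 = y -> VmU * y2 = VpU * y -> Fil (N + 12)%N y ->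
  Fil (N + 12)%N (VmU * y1 + y2) /\ forall I m n,
    evens (Th I m (N + 12)%N (VmU * y1 + y2)) n = (dd k n + 2%:R) * evens (Th I m (N + 12)%N y) n.
Proof.
move=> e1 e2 Fy.
have F1 : Fil N y1 by apply: (has_symbol_div symbol_Vp sym_p_inj); rewrite e1.
have [Fpy Tpy] := symbol_Vp Fy.
have F2 : Fil (N + 12)%N y2 by apply: (has_symbol_div symbol_Vm sym_m_inj); rewrite e2.
have [Fm1 Tm1] := symbol_Vm F1; have [_ Tp1] := symbol_Vp F1; have [_ Tm2] := symbol_Vm F2.
split; first exact: FilD.
move=> I m n; rewrite ThD Tm1 /evens coefD coef_sym_m -eigenvalue_S (mulrDl (lm _ / _)).
have E1 : (Th I m (N + 12)%N y)`_(n.*2) = lp n.*2 * (Th I m N y1)`_(n.*2).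
  by rewrite -e1 Tp1 coef_sym_p.
have E2 : lm n.*2 * (Th I m (N + 12)%N y2)`_(n.*2) = lp n.*2 * (Th I m (N + 12)%N y)`_(n.*2).
  by rewrite -coef_sym_m -Tm2 e2 Tpy coef_sym_p.
congr (_ + _); first by rewrite E1 mulrA divfK ?lp_neq0.
by apply: (mulfI (lm_neq0 n.*2)); rewrite E2 mulrA mulrCA divff ?lm_neq0 ?mulr1.
Qed.

(* f1 stands for (w - v^2)^-1 y, z for S y' and f4 for T y. *)
Lemma T_step N y f1 y1 y2 f4 : let y' := (iw + iv ^+ 2) * f1 in
  let z := VmU * y1 + y2 in
  (iw - iv ^+ 2) * f1 = y -> VpU * y1 = y' -> VmU * y2 = VpU * y' ->
  (iw + iv ^+ 2) * f4 = (iw - iv ^+ 2) * z -> Fil (N + 12)%N y ->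
  Fil (N + 12)%N f4 /\ forall I m n,
    evens (Th I m (N + 12)%N f4) n =
    gop (-1) (fun n => (dd k n + 2%:R) * gop 1 (evens (Th I m (N + 12)%N y)) n) n.
Proof.
move=> y' z e1 e2 e3 e4 Fy; have n12 : (N + 12 = N + 8 + 4)%N by rewrite -addnA.
have F1 : Fil (N + 8)%N f1.
  by apply: (has_symbol_div symbol_wm sym_wm_inj); rewrite e1 -n12.
have [F2 T2] := symbol_wp F1; have [_ T1] := symbol_wm F1.
rewrite -n12 -/y' in F2 T2; rewrite -n12 e1 in T1.
have [Fz Tz] := S_step e2 e3 F2; rewrite -/z in Fz Tz.
have [F3 T3] := symbol_wm Fz.
have F4 : Fil (N + 12)%N f4.
  by apply: (has_symbol_div symbol_wp sym_wp_inj); rewrite e4.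
have [_ T4] := symbol_wp F4; split=> // I m n.
rewrite (evens_wm_div (g := Th I m (N + 12)%N z)); last by rewrite -T4 e4 T3.
apply: eq_gop => n' _; rewrite Tz T2 evens_wp_div T1.
by [].
Qed.

End Symbols.

Lemma common_denominator (k : fieldType) (U : algType k) (D : unitAlgType k) (j : U -> D)
  (ds : seq D) : is_ore_fractions j ->
  exists q : U, j q != 0 /\ forall d, d \in ds -> exists y, d * j q = j y.
Proof.
move=> [unitD [jlin jM j1] jinj fracr _].
have nzM (x y : D) : x != 0 -> y != 0 -> x * y != 0.
  move=> x0 y0; apply: contraNneq y0 => e.
  by rewrite -(mulKr (unitD _ x0) y) e mulr0.
elim: ds => [|d ds [q [q0 H]]]; first by exists 1; rewrite j1 oner_neq0.
have [f [g [g0 e]]] := fracr (d * j q).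
exists (q * g); rewrite jM nzM //; split=> // d'; rewrite in_cons => /orP [/eqP ->|/H [y E]].
  by exists f; rewrite mulrA e divrK // unitD.
by exists (y * g); rewrite mulrA E jM.
Qed.

Lemma word_eval_cons (k : fieldType) (D : algType k) (x y : D) b w :
  word_eval x y (b :: w) = (if b then y else x) * word_eval x y w.
Proof. by rewrite /word_eval big_cons. Qed.

Section Fractions.
Variables (k : fieldType) (U : algType k) (D : unitAlgType k) (j : U -> D) (iu iv iw : U).
Variables (J : Type) (Fil : nat -> U -> Prop) (Th : J -> nat -> nat -> U -> {poly k}).
Hypothesis ch0 : [pchar k] =i pred0.
Hypothesis sc : symbol_calculus iu iv iw Fil Th.
Hypothesis ore : is_ore_fractions j.

Local Notation Vp := (j (VpU iu iv iw)).
Local Notation Vm := (j (VmU iu iv iw)).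
Local Notation wp := (j (iw + iv ^+ 2)).
Local Notation wm := (j (iw - iv ^+ 2)).

Definition fracS : D := Vm * Vp^-1 + Vm^-1 * Vp.
Definition fracT : D := wp^-1 * wm * fracS * wp * wm^-1.

Lemma oreM a b : j (a * b) = j a * j b. Proof. by case: ore => _ []. Qed.
Lemma oreD a b : j (a + b) = j a + j b.
Proof. by case: ore => _ [jl _ _] _ _ _; have := jl 1 a b; rewrite !scale1r. Qed.
Lemma ore0 : j 0 = 0.
Proof. by apply: (addIr (j 0)); rewrite -oreD !add0r. Qed.
Lemma oreZ c a : j (c *: a) = c *: j a.
Proof. by case: ore => _ [jl _ _] _ _ _; have := jl c a 0; rewrite ore0 !addr0. Qed.
Lemma oreN a : j (- a) = - j a.
Proof. by rewrite -scaleN1r oreZ scaleN1r. Qed.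
Lemma ore_inj : injective j. Proof. by case: ore. Qed.

Lemma symbol_unit a e A : has_symbol Fil Th a e A -> (forall f, A f = 0 -> f = 0) ->
  j a \is a GRing.unit.
Proof.
move=> sa inj; case: (ore) => unitD _ _ _ _; apply: unitD; rewrite -ore0.
by apply: contra_neq (has_symbol_neq0 sc sa inj) => /ore_inj.
Qed.

Let uVp := symbol_unit (symbol_Vp sc) (sym_p_inj ch0).
Let uVm := symbol_unit (symbol_Vm sc) (sym_m_inj ch0).
Let uwp := symbol_unit (symbol_wp sc) (@sym_wp_inj k).
Let uwm := symbol_unit (symbol_wm sc) (@sym_wm_inj k).

(* The fractions which become elements of U when S d and T d are applied to a
   common denominator. *)
Definition denomS (d : D) : seq D := [:: Vp^-1 * d; Vm^-1 * (Vp * d)].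
Definition denomT (d : D) : seq D := let d2 := wp * (wm^-1 * d) in
  [:: wm^-1 * d, wp^-1 * (wm * (fracS * d2)) & denomS d2].
Fixpoint denoms (w : seq bool) : seq D :=
  if w is b :: w' then
    (if b then denomT else denomS) (word_eval (fracS - 2%:R) (fracT - 2%:R) w') ++ denoms w'
  else [::].

Definition integral q d := exists y, d * j q = j y.

Lemma denomS_step N q d y : (forall d', d' \in denomS d -> integral q d') ->
  d * j q = j y -> Fil (N + 12)%N y ->
  exists z, [/\ fracS * d * j q = j z, Fil (N + 12)%N z & forall I m n,
    evens (Th I m (N + 12)%N z) n = (dd k n + 2%:R) * evens (Th I m (N + 12)%N y) n].
Proof.
move=> H e Fy.
have [|y1 e1] := H (Vp^-1 * d); first by rewrite inE eqxx.
have [|y2 e2] := H (Vm^-1 * (Vp * d)); first by rewrite !inE eqxx orbT.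
exists (VmU iu iv iw * y1 + y2).
have E1 : VpU iu iv iw * y1 = y by apply: ore_inj; rewrite oreM -e1 mulrA mulVKr.
have E2 : VmU iu iv iw * y2 = VpU iu iv iw * y.
  by apply: ore_inj; rewrite !oreM -e2 -e !mulrA mulrV // mul1r.
have [Fz Tz] := S_step ch0 sc E1 E2 Fy; split=> //.
by rewrite oreD oreM -e1 -e2 /fracS !mulrDl !mulrA.
Qed.

Lemma denomT_step N q d y : (forall d', d' \in denomT d -> integral q d') ->
  d * j q = j y -> Fil (N + 12)%N y ->
  exists z, [/\ fracT * d * j q = j z, Fil (N + 12)%N z & forall I m n,
    evens (Th I m (N + 12)%N z) n = gop (-1) (fun n => (dd k n + 2%:R) *
      gop 1 (evens (Th I m (N + 12)%N y)) n) n].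
Proof.
rewrite /denomT; set d2 := wp * _ => H e Fy.
have [|f1 e1] := H (wm^-1 * d); first by rewrite inE eqxx.
have [|f4 e4] := H (wp^-1 * (wm * (fracS * d2))); first by rewrite !inE eqxx orbT.
have [|y1 e2] := H (Vp^-1 * d2); first by rewrite !inE eqxx !orbT.
have [|y2 e3] := H (Vm^-1 * (Vp * d2)); first by rewrite !inE eqxx !orbT.
have ed2 : j ((iw + iv ^+ 2) * f1) = d2 * j q by rewrite oreM -e1 /d2 !mulrA.
exists f4.
have E1 : (iw - iv ^+ 2) * f1 = y by apply: ore_inj; rewrite oreM -e1 mulrA mulVKr.
have E2 : VpU iu iv iw * y1 = (iw + iv ^+ 2) * f1.
  by apply: ore_inj; rewrite ed2 oreM -e2 mulrA mulVKr.
have E3 : VmU iu iv iw * y2 = VpU iu iv iw * ((iw + iv ^+ 2) * f1).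
  by apply: ore_inj; rewrite oreM -e3 [RHS]oreM ed2 !mulrA mulrV // mul1r.
have E4 : (iw + iv ^+ 2) * f4 = (iw - iv ^+ 2) * (VmU iu iv iw * y1 + y2).
  have eS : j (VmU iu iv iw * y1 + y2) = fracS * d2 * j q.
    by rewrite oreD oreM -e2 -e3 /fracS !mulrDl !mulrA.
  by apply: ore_inj; rewrite oreM -e4 [RHS]oreM eS !mulrA mulrV // mul1r.
have [Fz Tz] := T_step ch0 sc E1 E2 E3 E4 Fy; split=> //.
by rewrite -e4 /fracT /d2 !mulrA.
Qed.

Lemma word_symbol N q w : Fil (N + 12)%N q -> (forall d, d \in denoms w -> integral q d) ->
  exists y, [/\ word_eval (fracS - 2%:R) (fracT - 2%:R) w * j q = j y, Fil (N + 12)%N y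
    & forall I m n, evens (Th I m (N + 12)%N y) n =
                    seq_word w (evens (Th I m (N + 12)%N q)) n].
Proof.
move=> Fq; elim: w => [|b w IH] H.
  by exists q; rewrite /word_eval big_nil mul1r.
have [|y [e Fy Ty]] := IH.
  by move=> d dw; apply: H; rewrite /= mem_cat dw orbT.
have sub2 x z : x * word_eval (fracS - 2%:R) (fracT - 2%:R) w * j q = j z ->
    Fil (N + 12)%N z ->
    [/\ (x - 2%:R) * word_eval (fracS - 2%:R) (fracT - 2%:R) w * j q = j (z - 2%:R *: y),
      Fil (N + 12)%N (z - 2%:R *: y) & forall I m n, evens (Th I m (N + 12)%N (z - 2%:R *: y)) n =
        evens (Th I m (N + 12)%N z) n - 2%:R * evens (Th I m (N + 12)%N y) n].
  move=> ez Fz; rewrite -scaleNr; split.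
  - by rewrite oreD oreZ -ez -e scaleNr scaler_nat !mulrBl mulr_natl mulrnAl.
  - by apply: (FilD sc) => //; apply: (FilZ sc).
  by move=> I m n; rewrite (ThD sc) (ThZ sc) /evens coefD coefZ mulNr.
have Hb d : d \in (if b then denomT else denomS) (word_eval (fracS - 2%:R) (fracT - 2%:R) w) ->
    integral q d by move=> dd; apply: H; rewrite /= mem_cat dd.
rewrite word_eval_cons; case: b Hb {H} => H.
  have [z [ez Fz Tz]] := denomT_step H e Fy.
  exists (z - 2%:R *: y); have [e' F' T'] := sub2 _ _ ez Fz; split=> // I m n.
  rewrite T' Tz /= /seqT; set f := evens _.
  have Ef n' : f n' = seq_word w (evens (Th I m (N + 12)%N q)) n' by apply: Ty.
  (* Writing f as [gop (-1)] of [gop 1 f] moves the subtraction of 2 inside the conjugation. *)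
  rewrite -[f n]gopKn -mulNr -gopZ -gopD; apply: eq_gop => n' _.
  rewrite /seqS (_ : gop 1 (seq_word _ _) n' = gop 1 f n'); last exact: eq_gop.
  ring.
have [z [ez Fz Tz]] := denomS_step H e Fy.
exists (z - 2%:R *: y); have [e' F' T'] := sub2 _ _ ez Fz; split=> // I m n.
by rewrite T' Tz /= /seqS -Ty; ring.
Qed.

Lemma free_shifted : free_on_pair (fracS - 2%:R) (fracT - 2%:R).
Proof.
move=> ws c uws rel; set x := fracS - _ in rel; set y := fracT - _ in rel.
have [q [jq0 Hq]] := common_denominator (flatten [seq denoms w | w <- ws]) ore.
have Hw w : w \in ws -> forall d, d \in denoms w -> integral q d.
  by move=> wws d dw; apply: Hq; apply/flatten_mapP; exists w.
have q0 : q != 0 by apply: contra_neq jq0 => ->; apply: ore0.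
have [N1 [N12 Fq [I [i0 lead]]]] := sc_lead sc q0.
(* The offset in [wtM] makes the degree of q at least 12, which leaves room for the degrees N and N
   + 8 of the quotients. *)
have NE : (N1 = N1 - 12 + 12)%N by rewrite subnK.
move: (N1 - 12)%N NE => N NE; rewrite {}NE {N1 N12} in Fq lead.
apply: (seq_words_free (m1 := i0) ch0 uws); apply: lowest_terms => i i0i.
(* The index i of the even coefficients is the exponent 2i of X. *)
have [|m [low nz]] := lead i.*2; first by rewrite (leq_trans i0i) // -addnn leq_addr.
exists (evens (Th I m (N + 12)%N q)); split=> // [l li|n].
  by apply: low; rewrite ltn_double.
have wsP w : w \in ws -> exists z, word_eval x y w * j q = j z /\
    evens (Th I m (N + 12)%N z) n = seq_word w (evens (Th I m (N + 12)%N q)) n.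
  by move=> /Hw /(word_symbol Fq) [z [e _ Tz]]; exists z.
suff [Z [eZ TZ]] : exists Z, (\sum_(w <- ws) c w *: word_eval x y w) * j q = j Z /\
    evens (Th I m (N + 12)%N Z) n =
    \sum_(w <- ws) c w * seq_word w (evens (Th I m (N + 12)%N q)) n.
  rewrite -TZ; have -> : Z = 0 by apply: ore_inj; rewrite -eZ rel mul0r ore0.
  by rewrite (Th0 sc) /evens coef0.
elim: ws wsP {uws rel Hq Hw} => [|w ws IH] wsP.
  by exists 0; rewrite !big_nil mul0r ore0 (Th0 sc) /evens coef0.
have [|Z [eZ TZ]] := IH; first by move=> w' ww; apply: wsP; rewrite inE ww orbT.
have [|z [ez Tz]] := wsP w; first by rewrite inE eqxx.
exists (c w *: z + Z); rewrite !big_cons mulrDl oreD oreZ -ez -eZ scalerAl; split=> //.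
by rewrite (ThD sc) (ThZ sc) /evens coefD coefZ -TZ -Tz.
Qed.

End Fractions.

(** * Adding a constant to both generators *)

Section Shift.
Variables (k : fieldType) (D : algType k) (x y : D) (e : k).

(* The word w in x + e and y + e, expanded in words in x and y. *)
Fixpoint shift_word (w : seq bool) : seq (k * seq bool) :=
  if w is b :: w' then
    [seq (p.1, b :: p.2) | p <- shift_word w'] ++ [seq (e * p.1, p.2) | p <- shift_word w']
  else [:: (1, [::])].

Lemma shift_wordE w : word_eval (x + e%:A) (y + e%:A) w =
  \sum_(p <- shift_word w) p.1 *: word_eval x y p.2.
Proof.
elim: w => [|b w IH]; first by rewrite big_seq1 scale1r /word_eval !big_nil.
rewrite word_eval_cons big_cat !big_map /= -(_ : (if b then y else x) + e%:A =
  if b then y + e%:A else x + e%:A); last by case: b.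
rewrite mulrDl {}IH !mulr_sumr; congr (_ + _); apply: eq_bigr => p _.
  by rewrite word_eval_cons scalerAr.
by rewrite mulr_algl scalerA.
Qed.

Lemma shift_word_top w w' : (size w <= size w')%N ->
  \sum_(p <- shift_word w | p.2 == w') p.1 = (w == w')%:R.
Proof.
elim: w w' => [|b w IH] w' sw; first by rewrite big_mkcond big_seq1 /=; case: (_ == _).
rewrite big_cat !big_map /= -(mulr_sumr _ _ _ e) (IH w') ?(ltnW sw) //.
have -> : (w == w') = false by apply: contraTF sw => /eqP ->; rewrite ltnn.
rewrite mulr0 addr0; case: w' sw => [|b' w'] //=; rewrite ltnS => /IH {}IH.
rewrite eqseq_cons; case: eqP => [->|nb] /=.
  by rewrite -IH; apply: eq_bigl => p; rewrite eqseq_cons eqxx.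
by rewrite big1 // => p; rewrite eqseq_cons; case: eqP.
Qed.

Lemma free_on_pair_coef (r : seq (k * seq bool)) w0 : free_on_pair x y ->
  \sum_(p <- r) p.1 *: word_eval x y p.2 = 0 -> \sum_(p <- r | p.2 == w0) p.1 = 0.
Proof.
move=> free rel; pose W := undup [seq p.2 | p <- r].
pose c w := \sum_(p <- r | p.2 == w) p.1.
have [w0W|w0W] := boolP (w0 \in W); last first.
  rewrite big1_seq // => p /andP [/eqP e0 pr]; case/negP: w0W.
  by rewrite mem_undup -e0 map_f.
apply: (free W c (undup_uniq _)) w0W; rewrite -[RHS]rel /c.
under eq_bigr => w _ do rewrite scaler_suml big_mkcond /=.
rewrite exchange_big big_seq [RHS]big_seq; apply: eq_bigr => p pr.
rewrite (bigD1_seq p.2) ?undup_uniq ?mem_undup ?map_f //= eqxx big1 ?addr0 // => w.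
by rewrite eq_sym => /negbTE ->.
Qed.

(** Expanding a shifted word gives the word itself and strictly shorter ones, so the longest words
    of a relation have coefficient 0, and one descends on the length. *)
Lemma free_on_pair_shift : free_on_pair x y -> free_on_pair (x + e%:A) (y + e%:A).
Proof.
move=> free ws c uws rel.
suff top N : (forall w, w \in ws -> (N <= size w)%N -> c w = 0) -> forall w, w \in ws -> c w = 0.
  apply: (top (\max_(w <- ws) size w).+1) => w wws.
  by rewrite ltnNge leq_bigmax_seq.
elim: N => [|N IH] cN; first by move=> w wws; apply: cN.
apply: IH => w0 w0ws Nw0; have [|w0N] := ltnP N (size w0); first exact: cN.
pose r := flatten [seq [seq (c w * p.1, p.2) | p <- shift_word w] | w <- ws].
have rel' : \sum_(p <- r) p.1 *: word_eval x y p.2 = 0.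
  rewrite -[RHS]rel big_flatten big_map; apply: eq_bigr => w _.
  rewrite shift_wordE big_map scaler_sumr; apply: eq_bigr => p _.
  by rewrite scalerA.
have := free_on_pair_coef w0 free rel'; rewrite big_flatten big_map /= (bigD1_seq w0) //=.
rewrite big_map -mulr_sumr shift_word_top // eqxx mulr1 big1_seq ?addr0 // => w /andP [ww0 wws].
rewrite big_map -mulr_sumr; have [/cN -> //|wN] := ltnP N (size w); first by rewrite mul0r.
by rewrite shift_word_top ?(negbTE ww0) ?mulr0 // (leq_trans wN).
Qed.

End Shift.

(** * The involution *)

Section Involution.
Variables (k : fieldType) (D : unitAlgType k) (star : D -> D).
Hypothesis starP : k_involution star.

Lemma starD x y : star (x + y) = star x + star y.
Proof. by case: starP => sl _ _ _; have := sl 1 x y; rewrite !scale1r. Qed.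
Lemma starM x y : star (x * y) = star y * star x.
Proof. by case: starP. Qed.
Lemma star0 : star 0 = 0.
Proof. by apply: (addIr (star 0)); rewrite -starD !add0r. Qed.
Lemma starZ c x : star (c *: x) = c *: star x.
Proof. by case: starP => sl _ _ _; have := sl c x 0; rewrite star0 !addr0. Qed.
Lemma starB x y : star (x - y) = star x - star y.
Proof. by rewrite starD -scaleN1r starZ scaleN1r. Qed.

Lemma star_unit x : x \is a GRing.unit -> star x \is a GRing.unit.
Proof.
case: starP => _ _ s1 _ ux; apply/unitrP; exists (star x^-1).
by rewrite -!starM divrr ?mulVr.
Qed.

Lemma starV x : star x^-1 = (star x)^-1.
Proof.
have [ux|nux] := boolP (x \is a GRing.unit); last first.
  rewrite !invr_out //; apply: contra nux => /star_unit.
  by case: starP => _ _ _ ->.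
apply: (mulrI (star_unit ux)); rewrite divrr ?star_unit // -starM mulVr //.
by case: starP.
Qed.

(** [V] has four odd factors and is fixed, while [w ^+ 3] changes sign, so the involution exchanges
    [Vm] and [Vp] and with them the two summands of [S]. It also exchanges [w + b ^+ 2] and
    [w - b ^+ 2] up to sign, and the signs cancel in [T]. *)
Lemma star_fixed (c d : k) (a b w : D) : star a = - a -> star b = - b -> star w = - w ->
  let V := c *: (w * (a * b + b * a) * w) in
  let Vm := V - d *: w ^+ 3 in
  let Vp := V + d *: w ^+ 3 in
  let S := Vm * Vp^-1 + Vm^-1 * Vp in
  let T := (w + b ^+ 2)^-1 * (w - b ^+ 2) * S * (w + b ^+ 2) * (w - b ^+ 2)^-1 in
  star S = S /\ star T = T.
Proof.
move=> sa sb sw V Vm Vp S T.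
have sV : star V = V.
  by rewrite starZ !starM starD !starM sa sb sw !(mulrNN, mulNr, mulrN, opprK) addrC mulrA.
have sw3 : star (d *: w ^+ 3) = - (d *: w ^+ 3).
  rewrite starZ !starM sw !(mulrNN, mulNr, mulrN) scalerN. by rewrite !exprS mulr1 mulrA.
have sVm : star Vm = Vp by rewrite starB sV sw3 opprK.
have sVp : star Vp = Vm by rewrite starD sV sw3.
have sS : star S = S by rewrite starD !starM !starV sVm sVp addrC.
have sbb : star (b ^+ 2) = b ^+ 2 by rewrite starM sb mulrNN.
have sp : star (w + b ^+ 2) = - (w - b ^+ 2) by rewrite starD sw sbb opprB addrC.
have sm : star (w - b ^+ 2) = - (w + b ^+ 2) by rewrite starB sw sbb opprD.
split=> //; rewrite /T !starM !starV sS sp sm !invrN.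
by rewrite !(mulrNN, mulNr, mulrN, opprK) !mulrA.
Qed.

End Involution.

Theorem mainTheorem11 (k : fieldType) (L : lmodType k) (br : L -> L -> L)
  (U : algType k) (iota : L -> U) (D : unitAlgType k) (j : U -> D) (u v : L) :
  [pchar k] =i pred0 ->
  lie_bracket br ->
  is_enveloping br iota ->
  is_ore_fractions j ->
  dim_ge3 (lie_gen br u v) ->
  let w := br v u in
  let iu := j (iota u) in
  let iv := j (iota v) in
  let iw := j (iota w) in
  let V := (2%:R : k)^-1 *: (iw * (iu * iv + iv * iu) * iw) in
  let Vm := V - (3%:R : k)^-1 *: iw ^+ 3 in
  let Vp := V + (3%:R : k)^-1 *: iw ^+ 3 in
  let S := Vm * Vp^-1 + Vm^-1 * Vp in
  let T := (iw + iv ^+ 2)^-1 * (iw - iv ^+ 2) * S * (iw + iv ^+ 2) * (iw - iv ^+ 2)^-1 in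
  free_on_pair S T /\
  (forall star : D -> D, k_involution star ->
     (forall a : L, star (j (iota a)) = - j (iota a)) ->
     star S = S /\ star T = T).
Proof.
move=> ch0 brP envU ore dim3 w iu iv iw V Vm Vp S T; split; last first.
  by move=> star starP sj; exact: (star_fixed starP 2%:R^-1 3%:R^-1 (sj u) (sj v) (sj w)).
have [Fil [Th sc]] := symbol_calculus_exists ch0 brP envU dim3.
have jM := oreM ore; have jD := oreD ore; have jZ := oreZ ore; have jN := oreN ore.
have eV : j (VU (iota u) (iota v) (iota w)) = V by rewrite jZ !jM jD !jM.
have ew3 : j (3%:R^-1 *: iota w ^+ 3) = 3%:R^-1 *: iw ^+ 3 by rewrite jZ !jM.
have evv : j (iota v ^+ 2) = iv ^+ 2 by rewrite jM.
have eS : fracS j (iota u) (iota v) (iota w) = S by rewrite /fracS !jD jN eV ew3.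
have eT : fracT j (iota u) (iota v) (iota w) = T by rewrite /fracT eS !jD jN evv.
have := free_on_pair_shift (e := 2%:R) (free_shifted ch0 sc ore).
by rewrite eS eT scaler_nat !subrK.
Qed.
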